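(* Let $E$ be the space of complex Borel measures $\mu$ on $\mathbb{T}$ such that $\widehat{\mu}(n)\to 0$ as $|n|\to+\infty$, normed by total variation. For every $\theta\in(0,1)$, set $X_\theta=(L^1(\mathbb{T}),c_0(\mathbb{Z}))_\theta$ and $Z_\theta=(E,c_0(\mathbb{Z}))_\theta$ (complex interpolation spaces). Then $X_\theta=Z_\theta$ isometrically, i.e. $X_\theta$ and $Z_\theta$ coincide as vector subspaces of $c_0(\mathbb{Z})$ and $\|x\|_{X_\theta}=\|x\|_{Z_\theta}$ for every $x$ in this common space.
   Context: $\mathbb{T}$ is the circle group, and $M(\mathbb{T})$ is the Banach space of complex Borel measures on $\mathbb{T}$ with the total variation norm. $E$ is a subspace of $M(\mathbb{T})$ and carries the norm of $M(\mathbb{T})$. $L^1(\mathbb{T})$ is the usual space for normalized Haar measure, identified with the absolutely continuous measures, so $L^1(\mathbb{T})\subset E$ by the Riemann–Lebesgue lemma. The spaces $L^1(\mathbb{T})$ and $E$ are regarded as continuously embedded in $c_0(\mathbb{Z})$ through the Fourier coefficient map $\mu\mapsto(\widehat{\mu}(n))_{n\in\mathbb{Z}}$; this is how $(L^1(\mathbb{T}),c_0(\mathbb{Z}))$ and $(E,c_0(\mathbb{Z}))$ are interpolation couples. Here $c_0(\mathbb{Z})$ is the space of complex sequences indexed by $\mathbb{Z}$ tending to $0$ at $\pm\infty$, with the supremum norm. For an interpolation couple $(A_0,A_1)$ of complex Banach spaces, $A_\theta=(A_0,A_1)_\theta$ denotes Calderón's complex interpolation space (as in Bergh–Löfström): the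 space of values $f(\theta)$ with the quotient norm, where $f$ ranges over bounded continuous functions on the strip $\{0\le \mathrm{Re}\, z\le 1\}$ with values in $A_0+A_1$, holomorphic in the interior, such that $t\mapsto f(j+it)$ is continuous into $A_j$ and tends to $0$ in $A_j$ as $|t|\to\infty$ for $j=0,1$, normed by $\max_{j=0,1}\sup_t\|f(j+it)\|_{A_j}$. *)

(* Defs.v *)
From HB Require Import structures.
From mathcomp Require Import all_boot all_order all_algebra.
From mathcomp Require Import all_classical all_reals all_analysis.
From mathcomp Require Import complex.

Set Implicit Arguments.
Unset Strict Implicit.
Unset Printing Implicit Defensive.
Import Order.TTheory GRing.Theory Num.Theory.
Import numFieldNormedType.Exports.
Import ComplexField.Normc.
Local Open Scope classical_set_scope.
Local Open Scope ring_scope.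
Local Open Scope complex_scope.

(* R[i] with the topology and normed module structure given by its modulus. *)
HB.instance Definition _ (R : rcfType) := NormedModule.copy R[i] R[i]^o.

Section complex_facts.
Variable R : realType.
Implicit Types z : R[i].

Lemma Re_add z1 z2 : complex.Re (z1 + z2) = complex.Re z1 + complex.Re z2.
Proof. by case: z1 => a b; case: z2. Qed.

Lemma Im_add z1 z2 : complex.Im (z1 + z2) = complex.Im z1 + complex.Im z2.
Proof. by case: z1 => a b; case: z2. Qed.

Lemma Re_sum I (r : seq I) (P : pred I) (F : I -> R[i]) :
  complex.Re (\sum_(i <- r | P i) F i) = \sum_(i <- r | P i) complex.Re (F i).
Proof. exact: (big_morph _ Re_add (erefl : complex.Re (0 : R[i]) = 0)). Qed.

Lemma Im_sum I (r : seq I) (P : pred I) (F : I -> R[i]) :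
  complex.Im (\sum_(i <- r | P i) F i) = \sum_(i <- r | P i) complex.Im (F i).
Proof. exact: (big_morph _ Im_add (erefl : complex.Im (0 : R[i]) = 0)). Qed.

Lemma norm_complexE z : `|z| = (normc z)%:C.
Proof. by []. Qed.

Lemma ler_norm_Re z : `|complex.Re z| <= normc z.
Proof.
by case: z => a b /=; rewrite -sqrtr_sqr ler_wsqrtr// lerDl sqr_ge0.
Qed.

Lemma ler_norm_Im z : `|complex.Im z| <= normc z.
Proof.
by case: z => a b /=; rewrite -sqrtr_sqr ler_wsqrtr// lerDr sqr_ge0.
Qed.

Lemma normc_le_ReIm z : normc z <= `|complex.Re z| + `|complex.Im z|.
Proof.
case: z => a b /=; rewrite -[leRHS]ger0_norm ?addr_ge0// -sqrtr_sqr.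
rewrite ler_wsqrtr// sqrrD !real_normK ?num_real// lerD2r lerDl.
by rewrite mulrn_wge0// mulr_ge0.
Qed.

Lemma continuous_Re : continuous (@complex.Re R).
Proof.
move=> z; apply/(@cvgrPdist_lt _ _ _ (nbhs z)) => e e0.
have e0C : 0 < e%:C by rewrite ltcR.
near=> w.
have zw : `|z - w| < e%:C by near: w; exact: (@cvgr_dist_lt _ _ _ (nbhs z) _ id z).
have -> : complex.Re z - complex.Re w = complex.Re (z - w).
  by case: (z) (w) => [a b] [c d].
by apply: le_lt_trans (ler_norm_Re _) _; rewrite -ltcR.
Unshelve. all: by end_near. Qed.

Lemma continuous_Im : continuous (@complex.Im R).
Proof.
move=> z; apply/(@cvgrPdist_lt _ _ _ (nbhs z)) => e e0.
have e0C : 0 < e%:C by rewrite ltcR.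
near=> w.
have zw : `|z - w| < e%:C by near: w; exact: (@cvgr_dist_lt _ _ _ (nbhs z) _ id z).
have -> : complex.Im z - complex.Im w = complex.Im (z - w).
  by case: (z) (w) => [a b] [c d].
by apply: le_lt_trans (ler_norm_Im _) _; rewrite -ltcR.
Unshelve. all: by end_near. Qed.

End complex_facts.

Section circle.
Variable R : realType.

Definition unit_circle : set R[i] := [set z | `|z| = 1].

Lemma unit_circle1 : 1 \in unit_circle.
Proof. by apply/mem_set; rewrite /unit_circle/= normr1. Qed.

Definition circle_top := set_type unit_circle.
HB.instance Definition _ := Topological.on circle_top.
HB.instance Definition _ :=
  isPointed.Build circle_top (exist _ 1 unit_circle1).

Definition circle := g_sigma_algebraType (@open circle_top).
HB.instance Definition _ := Measurable.on circle.

Definition circle_val (z : circle) : R[i] := set_val (z : circle_top).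

Lemma cis_subproof (t : R) : (cos t +i* sin t) \in unit_circle.
Proof.
by apply/mem_set; rewrite /unit_circle/= norm_complexE/= cos2Dsin2 sqrtr1.
Qed.

Definition cis (t : measurableTypeR R) : circle :=
  exist _ (cos t +i* sin t) (cis_subproof t).

Lemma continuous_cis_val : continuous (fun t => circle_val (cis t)).
Proof.
move=> t; apply/cvgrPdist_lt => -[e e'] ee0.
have [e'0 e0] : e' = 0 /\ 0 < e.
  by move: ee0; rewrite ltcE/= => /andP[/eqP].
rewrite {}e'0 {e' ee0}; near=> s; rewrite norm_complexE ltcR.
apply: le_lt_trans (normc_le_ReIm _) _ => /=.
rewrite (splitr e) ltrD//.
- near: s; apply: cvgr_dist_lt; rewrite ?divr_gt0//; exact: continuous_cos.
- near: s; apply: cvgr_dist_lt; rewrite ?divr_gt0//; exact: continuous_sin.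
Unshelve. all: by end_near. Qed.

Lemma measurable_cis : measurable_fun [set: measurableTypeR R] cis.
Proof.
apply: (@measurability _ _ (measurableTypeR R) circle setT cis
  (@open circle_top)) => // _ [_ [V oV <-] <-]; rewrite setTI.
apply: (@measurable_realfun.open_measurable R).
exact: (continuousP (fun t => circle_val (cis t))).1 continuous_cis_val V oV.
Qed.

HB.instance Definition _ :=
  isMeasurableFun.Build _ _ (measurableTypeR R) circle cis measurable_cis.

Lemma pi2_gt0 : 0 < pi *+ 2 :> R.
Proof. by rewrite mulrn_wgt0// pi_gt0. Qed.

(* Normalized Haar measure: the image of the uniform probability on [0, 2 pi]
   under t |-> exp (i t). *)
Definition haar : set circle -> \bar R :=
  distribution (uniform_prob pi2_gt0) cis.

HB.instance Definition _ := Probability.on haar.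

End circle.

(* A complex measure is a charge with values in R[i]: charges are finite on
   measurable sets, and their sigma-additivity is convergence for the topology
   of R[i] at finite points. *)
Section charge_parts.
Context d (T : measurableType d) (R : realType).
Variable mu : {charge set T -> \bar R[i]}.

Definition charge_Re (A : set T) : \bar R := (complex.Re (fine (mu A)))%:E.
Definition charge_Im (A : set T) : \bar R := (complex.Im (fine (mu A)))%:E.

Let fin_mu A : measurable A -> mu A \is a fin_num.
Proof. exact: fin_num_measure. Qed.

Let fine_mu_sigma_additive (F : nat -> set T) :
  (forall i, measurable (F i)) -> trivIset setT F ->
  measurable (\bigcup_n F n) ->
  (\sum_(0 <= i < n) fine (mu (F i))) @[n --> \oo] -->
  fine (mu (\bigcup_n F n)).
Proof.
move=> mF tF mUF.
have := @charge_semi_sigma_additive _ _ _ mu F mF tF mUF.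
rewrite -[X in _ --> X -> _]fineK; last exact: fin_mu.
move=> /fine_cvg; apply: cvg_trans; apply: near_eq_cvg.
near=> n => /=; rewrite sum_fine// => i _; exact: fin_mu.
Unshelve. all: by end_near. Qed.

Let charge_Re0 : charge_Re set0 = 0%E.
Proof. by rewrite /charge_Re charge0. Qed.

Let charge_Re_fin A : measurable A -> charge_Re A \is a fin_num.
Proof. by []. Qed.

Let charge_Re_sigma_additive : semi_sigma_additive charge_Re.
Proof.
move=> F mF tF mUF; under eq_fun do rewrite sumEFin.
apply: cvg_EFin; first exact: nearW.
under eq_fun do rewrite /= -Re_sum.
have cF := fine_mu_sigma_additive mF tF mUF.
exact: (cvg_comp _ _ cF (@continuous_Re R _)).
Qed.

HB.instance Definition _ := isCharge.Build _ _ _ charge_Re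
  charge_Re0 charge_Re_fin charge_Re_sigma_additive.

Let charge_Im0 : charge_Im set0 = 0%E.
Proof. by rewrite /charge_Im charge0. Qed.

Let charge_Im_fin A : measurable A -> charge_Im A \is a fin_num.
Proof. by []. Qed.

Let charge_Im_sigma_additive : semi_sigma_additive charge_Im.
Proof.
move=> F mF tF mUF; under eq_fun do rewrite sumEFin.
apply: cvg_EFin; first exact: nearW.
under eq_fun do rewrite /= -Im_sum.
have cF := fine_mu_sigma_additive mF tF mUF.
exact: (cvg_comp _ _ cF (@continuous_Im R _)).
Qed.

HB.instance Definition _ := isCharge.Build _ _ _ charge_Im
  charge_Im0 charge_Im_fin charge_Im_sigma_additive.

End charge_parts.

Section complex_integrals.
Context d (T : measurableType d) (R : realType).

Definition integralC (m : {measure set T -> \bar R}) (f : T -> R[i]) : R[i] :=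
  (\int[m]_x complex.Re (f x)) +i* (\int[m]_x complex.Im (f x)).

Definition integrableC (m : {measure set T -> \bar R}) (f : T -> R[i]) :=
  m.-integrable setT (fun x => (complex.Re (f x))%:E) /\
  m.-integrable setT (fun x => (complex.Im (f x))%:E).

(* The Jordan decomposition does not depend on the chosen Hahn decomposition
   (see Hahn_decomposition_uniq). *)
Definition integral_charge (nu : {charge set T -> \bar R}) (f : T -> R[i])
    : R[i] :=
  let nuPN := projT2 (cid (projT2 (cid (Hahn_decomposition nu)))) in
  integralC (jordan_pos nuPN) f - integralC (jordan_neg nuPN) f.

Definition integral_complex_measure (mu : {charge set T -> \bar R[i]})
    (f : T -> R[i]) : R[i] :=
  integral_charge (charge_Re mu) f + 'i%C * integral_charge (charge_Im mu) f.

Definition total_variation (mu : {charge set T -> \bar R[i]}) : \bar R :=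
  ereal_sup [set (\sum_(0 <= i <oo) (normc (fine (mu (F i))))%:E)%E
    | F in [set F : (set T)^nat | [/\ forall i, measurable (F i),
        trivIset setT F & \bigcup_i F i = setT]]].

End complex_integrals.

Section interpolation.
Variables (R : realType) (U : lmodType R[i]).

(* A Banach space continuously embedded in U, given as its image in U together
   with its norm; the value of the norm outside the carrier is irrelevant. *)
Record normed_sub := NormedSub { carrier : set U ; normS : U -> R }.

(* The image of a space under an embedding j, where A are the elements of the
   space and N is the norm. The elements of A are representatives (of functions
   modulo a.e. equality, of set functions modulo equality on measurable sets)
   and j is injective modulo this identification, so that N is constant on the
   fibres of j in A and the infimum below is over a singleton. *)
Definition embedded (V : Type) (j : V -> U) (A : set V) (N : V -> R) :=
  NormedSub (j @` A) (fun x => inf [set N v | v in A `&` j @^-1` [set x]]).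

Implicit Types (A : normed_sub) (f : R[i] -> U).

Definition sum_sub A0 A1 := NormedSub
  [set x | exists a0 a1, [/\ carrier A0 a0, carrier A1 a1 & x = a0 + a1]]
  (fun x => inf [set r | exists a0 a1, [/\ carrier A0 a0, carrier A1 a1,
     x = a0 + a1 & r = normS A0 a0 + normS A1 a1]]).

Definition closed_strip : set R[i] := [set z | 0 <= complex.Re z <= 1].

Definition open_strip : set R[i] := [set z | 0 < complex.Re z < 1].

Definition bounded_on_strip A f :=
  exists M, forall z, closed_strip z -> normS A (f z) <= M.

Definition continuous_on_strip A f := forall z0, closed_strip z0 ->
  normS A (f z - f z0) @[z --> within closed_strip (nbhs z0)] --> (0 : R).

Definition holomorphic_on_strip A f := forall z0, open_strip z0 ->
  exists2 l, carrier A l &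
    normS A (h^-1 *: (f (z0 + h) - f z0) - l) @[h --> (0 : R[i])^'] --> (0 : R).

Definition C0_boundary A (g : R -> U) :=
  [/\ forall t, carrier A (g t),
      forall t0, normS A (g t - g t0) @[t --> t0] --> (0 : R),
      normS A (g t) @[t --> +oo] --> (0 : R) &
      normS A (g t) @[t --> -oo] --> (0 : R)].

Definition calderon A0 A1 : set (R[i] -> U) := [set f |
  [/\ forall z, closed_strip z -> carrier (sum_sub A0 A1) (f z),
      bounded_on_strip (sum_sub A0 A1) f,
      continuous_on_strip (sum_sub A0 A1) f,
      holomorphic_on_strip (sum_sub A0 A1) f &
      C0_boundary A0 (fun t => f (0 +i* t)) /\
      C0_boundary A1 (fun t => f (1 +i* t))]].

Definition calderon_norm A0 A1 f : R :=
  Num.max (sup (range (fun t : R => normS A0 (f (0 +i* t)))))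
          (sup (range (fun t : R => normS A1 (f (1 +i* t))))).

Definition complex_interpolation A0 A1 (theta : R) := NormedSub
  [set f theta%:C | f in calderon A0 A1]
  (fun x => inf [set calderon_norm A0 A1 f
     | f in calderon A0 A1 `&` [set f | f theta%:C = x]]).

End interpolation.

Section spaces.
Variable R : realType.

Definition vanishes_at_infinity (x : int -> R[i]) :=
  x n%:Z @[n --> \oo] --> (0 : R[i]) /\ x (- n%:Z) @[n --> \oo] --> (0 : R[i]).

Definition c0Z : normed_sub (int -> R[i]) :=
  NormedSub vanishes_at_infinity (fun x => sup (range (fun n => normc (x n)))).

(* The Fourier embeddings below are injective (modulo a.e. equality, resp.
   equality on Borel sets) by uniqueness of Fourier coefficients. *)
Definition circle_pow (n : int) (z : circle R) : R[i] := circle_val z ^ n.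

Definition fourier_fun (f : circle R -> R[i]) (n : int) : R[i] :=
  integralC (@haar R) (fun z => f z * circle_pow (- n) z).

Definition fourier_measure (mu : {charge set (circle R) -> \bar R[i]})
    (n : int) : R[i] :=
  integral_complex_measure mu (circle_pow (- n)).

Definition L1T : normed_sub (int -> R[i]) :=
  embedded fourier_fun [set f | integrableC (@haar R) f]
    (fun f => \int[@haar R]_z normc (f z)).

(* The total variation of a complex measure is finite, so fine loses nothing. *)
Definition E_space : normed_sub (int -> R[i]) :=
  embedded fourier_measure
    [set mu | vanishes_at_infinity (fourier_measure mu)]
    (fun mu => fine (total_variation mu)).

End spaces.

(* Main.v *)
Require Import Defs.
From HB Require Import structures.
From mathcomp Require Import all_boot all_order all_algebra.
From mathcomp Require Import all_classical all_reals all_analysis.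
From mathcomp Require Import measurable_realfun complex.
From mathcomp Require Import zify ring lra.

Set Implicit Arguments.
Unset Strict Implicit.
Unset Printing Implicit Defensive.
Import Order.TTheory GRing.Theory Num.Theory.
Import numFieldNormedType.Exports.
Import ComplexField.Normc.
Local Open Scope classical_set_scope.
Local Open Scope ring_scope.
Local Open Scope complex_scope.

(** Write L1 and E for the two spaces of Fourier transforms, c0 for the null
    sequences, and f for an element of the Calderon class of (E, c0).

    The norm of E dominates the supremum norm, so the sum norm on E + c0 is the
    supremum norm (sum_c0_norm) and the conditions on the strip do not see E: they
    say that f is bounded, continuous and holomorphic with values in c0. The same
    holds for L1 by the Riemann-Lebesgue lemma. Since a density has total variation
    at most its L1 norm, the class of (L1, c0) is contained in that of (E, c0) with
    smaller norms. The point is the converse: from f and e > 0 one builds g in the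
    class of (L1, c0) with g theta = f theta and norm at most that of f plus e
    (calderon_E_L1).

    Let P_k be de la Vallee Poussin means, equal to 1 for |j| <= N_k, of finite
    support, and convolving E into L1 with norm at most 1 + 2/s, close to 1
    (vallee_poussin_smoothing). Put
      m(z) = P_0 + sum_k exp (a_k (z - theta)) (P_(k+1) - P_k)
    and g(z) = d(z) m(z) f(z), with d(z) = exp (delta (z^2 - theta^2)) and delta
    small. The sum telescopes at z = theta, so g theta = f theta. On the line
    Re z = 0 the exponentials have modulus exp (- a_k theta): taking the a_k large,
    g(it) is an L1-convergent series, of norm at most 1 + small times the norm of
    f(it) in E (multiplier_E_L1). On the rest of the strip the exponentials may be
    large, but the k-th difference only acts on frequencies |j| > N_k, where d f is
    as small as desired once N_k is large: by the Gaussian decay of d and continuity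
    of f into c0, the values of d f form a relatively compact set of c0
    (damped_uniform_tails).

    Each coordinate of g is a finite sum, hence holomorphic; its tails are
    uniformly small on the strip, and this makes g continuous and holomorphic into
    c0 (strip_regular_coordinates). Holomorphy uses the Cauchy estimate
    |f'(z)| <= C sup |f| / r, obtained from Goursat's theorem on a rectangle in
    logarithmic coordinates: F(w) = (f (z + exp w) - f z) exp (- w) is periodic, so
    its mean over vertical segments is constant, and it tends to f'(z).

    Integrals against a complex measure are handled through Riemann sums along fine
    partitions of the circle: the sums depend only on the values of the measure on
    sets, which gives additivity of Fourier coefficients, and they compare with the
    total variation, which bounds the L1 norm of Fejer sums. *)

(** * Modulus, derivatives and exponential of complex numbers *)

Section complex_modulus.
Variable R : realType.
Implicit Types (x y z h : R[i]) (r : R).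

Lemma normc_ge0 z : 0 <= normc z.
Proof. by case: z => a b /=; exact: sqrtr_ge0. Qed.

Lemma normc_real r : normc r%:C = `|r|.
Proof. by rewrite /= expr0n addr0 sqrtr_sqr. Qed.

Lemma normc_zero : normc (0 : R[i]) = 0.
Proof. exact: normc0. Qed.

Lemma normc_one : normc (1 : R[i]) = 1.
Proof. exact: normc1. Qed.

Lemma normc_eq0 z : (normc z == 0) = (z == 0).
Proof. by apply/eqP/eqP => [/eq0_normc//|->]; exact: normc_zero. Qed.

Lemma normc_gt0 z : (0 < normc z) = (z != 0).
Proof. by rewrite lt_neqAle normc_ge0 andbT eq_sym normc_eq0. Qed.

Lemma normcB x y : normc (x - y) = normc (y - x).
Proof. by rewrite -normcN opprB. Qed.

Lemma le_normcB x y : normc (x - y) <= normc x + normc y.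
Proof. by rewrite -(normcN y); exact: le_normcD. Qed.

Lemma le_normcBD x y z : normc (x - z) <= normc (x - y) + normc (y - z).
Proof.
have -> : x - z = (x - y) + (y - z) by ring.
exact: le_normcD.
Qed.

Lemma le_normc_diff x y : normc x <= normc y + normc (x - y).
Proof. by have := le_normcD y (x - y); rewrite addrC subrK. Qed.

Lemma normcX z n : normc (z ^+ n) = normc z ^+ n.
Proof.
by elim: n => [|n IH]; rewrite ?expr0 ?normc_one// !exprS normcM IH.
Qed.

Lemma le_normc_sum I (s : seq I) (P : pred I) (F : I -> R[i]) :
  normc (\sum_(i <- s | P i) F i) <= \sum_(i <- s | P i) normc (F i).
Proof.
apply: (big_ind2 (fun a b => normc a <= b)) => //; first by rewrite normc_zero.
by move=> x1 y1 x2 y2 h1 h2; exact: le_trans (le_normcD _ _) (lerD h1 h2).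
Qed.

Lemma normc_iM z : normc ('i%C * z) = normc z.
Proof. by case: z => a b; rewrite normcM /= expr0n add0r expr1n sqrtr1 mul1r. Qed.

Lemma Re_sub x y : complex.Re (x - y) = complex.Re x - complex.Re y.
Proof. by case: x => ? ?; case: y. Qed.

Lemma Im_sub x y : complex.Im (x - y) = complex.Im x - complex.Im y.
Proof. by case: x => ? ?; case: y. Qed.

Lemma Re_mul x y : complex.Re (x * y) =
  complex.Re x * complex.Re y - complex.Im x * complex.Im y.
Proof. by case: x => ? ?; case: y. Qed.

Lemma Im_mul x y : complex.Im (x * y) =
  complex.Re x * complex.Im y + complex.Im x * complex.Re y.
Proof. by case: x => ? ?; case: y. Qed.

Lemma complex_eq x y : complex.Re x = complex.Re y ->
  complex.Im x = complex.Im y -> x = y.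
Proof. by case: x => ? ?; case: y => ? ? /= -> ->. Qed.

Lemma sqr_normcE z : normc z ^+ 2 = complex.Re z ^+ 2 + complex.Im z ^+ 2.
Proof. by case: z => a b /=; rewrite sqr_sqrtr// addr_ge0// sqr_ge0. Qed.

End complex_modulus.

Section pointwise_calculus.
Variable R : realType.
Implicit Types (f g : R[i] -> R[i]) (z l m h : R[i]) (D : set R[i]).

Definition ccont D f z := forall e : R, 0 < e -> exists2 d : R, 0 < d &
  forall w, D w -> normc (w - z) < d -> normc (f w - f z) <= e.

(** Stated without dividing by the increment, so that h = 0 needs no separate
    treatment in products and compositions. *)
Definition cderive f z l := forall e : R, 0 < e -> exists2 d : R, 0 < d &
  forall h, normc h < d -> normc (f (z + h) - f z - l * h) <= e * normc h.

Lemma ccont_cst D c z : ccont D (fun=> c) z.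
Proof. by move=> e e0; exists 1 => // w _ _; rewrite subrr normc_zero ltW. Qed.

Lemma ccontD D f g z : ccont D f z -> ccont D g z ->
  ccont D (fun w => f w + g w) z.
Proof.
move=> cf cg e e0; have e2 : 0 < e / 2 by lra.
have [d1 d10 h1] := cf _ e2; have [d2 d20 h2] := cg _ e2.
exists (Num.min d1 d2); first by rewrite lt_min d10.
move=> w Dw; rewrite lt_min => /andP[w1 w2].
have -> : f w + g w - (f z + g z) = (f w - f z) + (g w - g z) by ring.
have := le_normcD (f w - f z) (g w - g z).
have := h1 _ Dw w1; have := h2 _ Dw w2; lra.
Qed.

Lemma ccontM D f g z : ccont D f z -> ccont D g z ->
  ccont D (fun w => f w * g w) z.
Proof.
move=> cf cg e e0.
set A := normc (f z) + 1; set B := normc (g z) + 1.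
have A0 : 0 < A by rewrite /A ltr_wpDl ?normc_ge0.
have B0 : 0 < B by rewrite /B ltr_wpDl ?normc_ge0.
have e1 : 0 < Num.min 1 (e / (2 * A)) by rewrite lt_min ltr01 divr_gt0 ?mulr_gt0.
have e2 : 0 < e / (2 * B) by rewrite divr_gt0 ?mulr_gt0.
have [d1 d10 h1] := cg _ e1; have [d2 d20 h2] := cf _ e2.
exists (Num.min d1 d2); first by rewrite lt_min d10.
move=> w Dw; rewrite lt_min => /andP[w1 w2].
have {h1} := h1 _ Dw w1; rewrite le_min => /andP[g1 g2].
have {}h2 := h2 _ Dw w2.
have -> : f w * g w - f z * g z = (f w - f z) * g w + f z * (g w - g z) by ring.
apply: le_trans (le_normcD _ _) _; rewrite !normcM.
have gB : normc (g w) <= B.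
  by have := le_normc_diff (g w) (g z); rewrite /B; lra.
have fA : normc (f z) <= A by rewrite /A; lra.
have {}h2 : normc (f w - f z) * normc (g w) <= e / (2 * B) * B.
  by rewrite ler_pM ?normc_ge0.
have {}g2 : normc (f z) * normc (g w - g z) <= A * (e / (2 * A)).
  by rewrite ler_pM ?normc_ge0.
have E1 : e / (2 * B) * B = e / 2 by field; rewrite gt_eqF.
have E2 : A * (e / (2 * A)) = e / 2 by field; rewrite gt_eqF.
by move: h2 g2; rewrite E1 E2; lra.
Qed.

Lemma ccont_sum D n (F : nat -> R[i] -> R[i]) z :
  (forall k, ccont D (F k) z) -> ccont D (fun w => \sum_(k < n) F k w) z.
Proof.
move=> cF; elim: n => [|n IH].
  by move=> e e0; exists 1 => // w _ _; rewrite !big_ord0 subrr normc_zero ltW.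
have := ccontD IH (cF n); rewrite /ccont => H e e0.
by have [d d0 hd] := H e e0; exists d => // w Dw wd; rewrite !big_ord_recr; exact: hd.
Qed.

Lemma cderive_cont D f z l : cderive f z l -> ccont D f z.
Proof.
move=> df e e0; have [d d0 hd] := df 1 ltr01.
set A := normc l + 1; have A0 : 0 < A by rewrite /A ltr_wpDl ?normc_ge0.
exists (Num.min d (e / A)); first by rewrite lt_min d0 divr_gt0.
move=> w _; rewrite lt_min => /andP[w1 w2].
have := hd _ w1; rewrite subrKC mul1r.
have := le_normc_diff (f w - f z) (l * (w - z)); rewrite normcM.
have : (normc l + 1) * normc (w - z) <= e.
  by move: (ltW w2); rewrite ler_pdivlMr// mulrC.
lra.
Qed.

Lemma cderive_cst c z : cderive (fun=> c) z 0.
Proof.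
move=> e e0; exists 1 => // h _.
by rewrite subrr mul0r subrr normc_zero mulr_ge0 ?normc_ge0// ltW.
Qed.

Lemma cderive_id z : cderive id z 1.
Proof.
move=> e e0; exists 1 => // h _; have -> : z + h - z - 1 * h = 0 by ring.
by rewrite normc_zero mulr_ge0 ?normc_ge0// ltW.
Qed.

Lemma cderive_eq f g z l : f =1 g -> cderive f z l -> cderive g z l.
Proof.
by move=> fg df e e0; have [d d0 hd] := df e e0; exists d => // h hh; rewrite -!fg hd.
Qed.

Lemma cderiveD f g z l m : cderive f z l -> cderive g z m ->
  cderive (fun w => f w + g w) z (l + m).
Proof.
move=> df dg e e0; have e2 : 0 < e / 2 by lra.
have [d1 d10 h1] := df _ e2; have [d2 d20 h2] := dg _ e2.
exists (Num.min d1 d2); first by rewrite lt_min d10.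
move=> h; rewrite lt_min => /andP[w1 w2].
have -> : f (z + h) + g (z + h) - (f z + g z) - (l + m) * h =
  (f (z + h) - f z - l * h) + (g (z + h) - g z - m * h) by ring.
have := le_normcD (f (z + h) - f z - l * h) (g (z + h) - g z - m * h).
have := h1 _ w1; have := h2 _ w2; lra.
Qed.

Lemma cderiveM f g z l m : cderive f z l -> cderive g z m ->
  cderive (fun w => f w * g w) z (l * g z + f z * m).
Proof.
move=> df dg e e0.
set A := normc (f z) + 1; set B := normc (g z) + 1; set L := normc l + 1.
have A0 : 0 < A by rewrite /A ltr_wpDl ?normc_ge0.
have B0 : 0 < B by rewrite /B ltr_wpDl ?normc_ge0.
have L0 : 0 < L by rewrite /L ltr_wpDl ?normc_ge0.
have e1 : 0 < Num.min 1 (e / (3 * L)) by rewrite lt_min ltr01 divr_gt0 ?mulr_gt0.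
have e2 : 0 < e / (3 * B) by rewrite divr_gt0 ?mulr_gt0.
have e3 : 0 < e / (3 * A) by rewrite divr_gt0 ?mulr_gt0.
have [d1 d10 h1] := (@cderive_cont setT _ _ _ dg) _ e1.
have [d2 d20 h2] := df _ e2; have [d3 d30 h3] := dg _ e3.
exists (Num.min d1 (Num.min d2 d3)); first by rewrite !lt_min d10 d20.
move=> h; rewrite !lt_min => /and3P[w1 w2 w3].
have {h1} := h1 (z + h) I; rewrite (_ : z + h - z = h); last by ring.
move=> /(_ w1).
rewrite le_min => /andP[g1 g2].
have {}h2 := h2 _ w2; have {}h3 := h3 _ w3.
have -> : f (z + h) * g (z + h) - f z * g z - (l * g z + f z * m) * h =
  (f (z + h) - f z - l * h) * g (z + h) + (l * (g (z + h) - g z)) * h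
  + f z * (g (z + h) - g z - m * h) by ring.
apply: le_trans (le_normcD _ _) _; rewrite [X in _ + X]normcM.
have := le_normcD ((f (z + h) - f z - l * h) * g (z + h)) (l * (g (z + h) - g z) * h).
rewrite !(normcM _ h) !(normcM _ (g _)) (normcM l).

have gB : normc (g (z + h)) <= B.
  by have := le_normc_diff (g (z + h)) (g z); rewrite /B; lra.
have fA : normc (f z) <= A by rewrite /A; lra.
have lL : normc l <= L by rewrite /L; lra.
have h0 := normc_ge0 h.
have {}h2 : normc (f (z + h) - f z - l * h) * normc (g (z + h)) <= e / (3 * B) * normc h * B.
  by rewrite ler_pM ?normc_ge0.
have {}h3 : normc (f z) * normc (g (z + h) - g z - m * h) <= A * (e / (3 * A) * normc h).
  by rewrite ler_pM ?normc_ge0.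
have {}g2 : normc l * normc (g (z + h) - g z) * normc h <= L * (e / (3 * L)) * normc h.
  by rewrite ler_wpM2r// ler_pM ?normc_ge0.
have E1 : e / (3 * B) * normc h * B = e * normc h / 3 by field; rewrite gt_eqF.
have E2 : A * (e / (3 * A) * normc h) = e * normc h / 3 by field; rewrite gt_eqF.
have E3 : L * (e / (3 * L)) * normc h = e * normc h / 3 by field; rewrite gt_eqF.
by move: h2 g2 h3; rewrite E1 E2 E3; lra.
Qed.

Lemma cderive_comp f g z l m : cderive f z l -> cderive g (f z) m ->
  cderive (fun w => g (f w)) z (m * l).
Proof.
move=> df dg e e0.
set M := normc m + 1; set L := normc l + 1.
have M0 : 0 < M by rewrite /M ltr_wpDl ?normc_ge0.
have L0 : 0 < L by rewrite /L ltr_wpDl ?normc_ge0.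
have e1 : 0 < Num.min 1 (e / (2 * M)) by rewrite lt_min ltr01 divr_gt0 ?mulr_gt0.
have e2 : 0 < e / (2 * L) by rewrite divr_gt0 ?mulr_gt0.
have [d1 d10 h1] := dg _ e2; have [d2 d20 h2] := df _ e1.
exists (Num.min (d1 / L) d2); first by rewrite lt_min d20 divr_gt0.
move=> h; rewrite lt_min => /andP[w1 w2].
have h0 := normc_ge0 h.
have {}h2 := h2 _ w2.
have h2a : normc (f (z + h) - f z - l * h) <= normc h.
  by apply: le_trans h2 _; rewrite ler_piMl// ge_min lexx.
have h2b : normc (f (z + h) - f z - l * h) <= e / (2 * M) * normc h.
  by apply: le_trans h2 _; rewrite ler_wpM2r// ge_min lexx orbT.
set k := f (z + h) - f z in h2 h2a h2b *.
have kL : normc k <= L * normc h.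
  by have := le_normc_diff k (l * h); rewrite normcM /L; lra.
have kd : normc k < d1.
  by apply: le_lt_trans kL _; rewrite mulrC -ltr_pdivlMr.
have -> : g (f (z + h)) - g (f z) - m * l * h =
  (g (f z + k) - g (f z) - m * k) + m * (k - l * h).
  by rewrite /k subrKC; ring.
have := le_normcD (g (f z + k) - g (f z) - m * k) (m * (k - l * h)).
rewrite normcM.
have {}h1 : normc (g (f z + k) - g (f z) - m * k) <= e / (2 * L) * (L * normc h).
  by apply: le_trans (h1 _ kd) _; rewrite ler_wpM2l// ltW.
have {}h2b : normc m * normc (k - l * h) <= M * (e / (2 * M) * normc h).
  by rewrite ler_pM ?normc_ge0// /M; lra.
have E1 : e / (2 * L) * (L * normc h) = e * normc h / 2 by field; rewrite gt_eqF.
have E2 : M * (e / (2 * M) * normc h) = e * normc h / 2 by field; rewrite gt_eqF.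
by move: h1 h2b; rewrite E1 E2; lra.
Qed.

Lemma cderive_sum n (F dF : nat -> R[i] -> R[i]) z :
  (forall k, cderive (F k) z (dF k z)) ->
  cderive (fun w => \sum_(k < n) F k w) z (\sum_(k < n) dF k z).
Proof.
move=> cF; elim: n => [|n IH].
  rewrite big_ord0; apply: cderive_eq (cderive_cst 0 z) => w.
  by rewrite big_ord0.
rewrite big_ord_recr; apply: cderive_eq (cderiveD IH (cF n)) => w.
by rewrite big_ord_recr.
Qed.

End pointwise_calculus.

Section complex_exponential.
Variable R : realType.
Implicit Types (z h : R[i]).

Definition cexp z : R[i] :=
  (expR (complex.Re z) * cos (complex.Im z)) +i* (expR (complex.Re z) * sin (complex.Im z)).

Lemma cexpD z h : cexp (z + h) = cexp z * cexp h.
Proof.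
case: z => a b; case: h => c d; apply: complex_eq; rewrite ?Re_mul ?Im_mul /=.
  by rewrite expRD cosD; ring.
by rewrite expRD sinD; ring.
Qed.

Lemma cexp0 : cexp 0 = 1.
Proof. by apply: complex_eq; rewrite /= expR0 ?cos0 ?sin0 mul1r. Qed.

Lemma normc_cexp z : normc (cexp z) = expR (complex.Re z).
Proof.
case: z => a b /=; rewrite !exprMn -mulrDr cos2Dsin2 mulr1.
by rewrite sqrtr_sqr ger0_norm// expR_ge0.
Qed.

Lemma is_derive_eps (f : R -> R) (x l : R) : is_derive x 1 f l ->
  forall e : R, 0 < e -> exists2 d : R, 0 < d &
  forall h : R, `|h| < d -> `|f (x + h) - f x - l * h| <= e * `|h|.
Proof.
move=> [df <-] e e0.
have := df; rewrite /derivable => /(@cvgr_dist_le _ _ _ _ _) /(_ _ e0).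
rewrite near_withinE => /nbhs_ballP[d /= d0 hd].
exists d => // h hd'; have [->|h0] := eqVneq h 0.
  by rewrite addr0 subrr mulr0 subrr normr0 mulr0.
have := hd h; rewrite -/(derive f x 1) /ball /= sub0r normrN => /(_ hd' h0).
rewrite [h *: 1]mulr1 [h + x]addrC.
have nh : 0 < `|h| by rewrite normr_gt0.
rewrite -(ler_pM2r nh) -normrM; apply: le_trans.
rewrite -normrN le_eqVlt; apply/orP; left; apply/eqP; congr `|_|.
by rewrite /GRing.scale/=; field.
Qed.

(** With h = x + iy, both parts of exp h - 1 - h split into the first-order errors
    of exp, cos and sin plus the product (exp x - 1) y, which is of second order. *)
Lemma cderive_cexp0 : cderive cexp 0 1.
Proof.
move=> e e0; set e' := Num.min 1 (e / 8).
have e'0 : 0 < e' by rewrite lt_min ltr01 divr_gt0.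
have e'1 : e' <= 1 by rewrite ge_min lexx.
have e'8 : e' <= e / 8 by rewrite ge_min lexx orbT.
have [d1 d10 h1] := is_derive_eps (is_derive_expR (0:R)) e'0.
have [d2 d20 h2] := is_derive_eps (is_derive_cos (0:R)) e'0.
have [d3 d30 h3] := is_derive_eps (is_derive_sin (0:R)) e'0.
exists (Num.min (Num.min d1 (e' / 2)) (Num.min d2 d3)).
  by rewrite !lt_min d10 d20 d30 divr_gt0.
move=> h; rewrite !lt_min => /andP[/andP[w1 w4] /andP[w2 w3]].
rewrite add0r cexp0 mul1r.
have hR := ler_norm_Re h; have hI := ler_norm_Im h.
case: h => x y in w1 w2 w3 w4 hR hI *.
set n := normc (x +i* y) in w1 w2 w3 w4 hR hI *.
rewrite /= in hR hI.
have {h1} := h1 x (le_lt_trans hR w1).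
have {h2} := h2 y (le_lt_trans hI w2).
have {h3} := h3 y (le_lt_trans hI w3).
rewrite !add0r expR0 cos0 sin0 mul1r subr0 mul1r oppr0 mul0r subr0.
move=> h3 h2 h1.
apply: le_trans (normc_le_ReIm _) _.
have x1 : `|expR x - 1| <= 2 * `|x|.
  have -> : expR x - 1 = (expR x - 1 - x) + x by ring.
  apply: le_trans (ler_normD _ _) _.
  have : e' * `|x| <= 1 * `|x| by rewrite ler_wpM2r.
  lra.
have x2 : expR x <= 2.
  have := ler_norm (expR x - 1); lra.
have e0x := expR_ge0 x.
have y1 : expR x * `|cos y - 1| <= 2 * (e' * `|y|) by rewrite ler_pM.
have y2 : expR x * `|sin y - y| <= 2 * (e' * `|y|) by rewrite ler_pM.
have y3 : `|expR x - 1| * `|y| <= e' * `|y|.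
  by rewrite ler_wpM2r//; lra.
have A1 : e' * `|x| <= e / 8 * n by rewrite ler_pM// ltW.
have A2 : e' * `|y| <= e / 8 * n by rewrite ler_pM// ltW.
rewrite [complex.Re _]/= [complex.Im _]/=.
have -> : expR x * cos y - 1 - x = (expR x - 1 - x) + expR x * (cos y - 1) by ring.
have -> : expR x * sin y - 0 - y = expR x * (sin y - y) + (expR x - 1) * y by ring.
have := ler_normD (expR x - 1 - x) (expR x * (cos y - 1)).
have := ler_normD (expR x * (sin y - y)) ((expR x - 1) * y).
have en : 0 <= e * n by rewrite mulr_ge0 ?normc_ge0 ?ltW.
rewrite !normrM (ger0_norm e0x); lra.
Qed.

Lemma cderive_cexp z : cderive cexp z (cexp z).
Proof.
move=> e e0; set A := expR (complex.Re z).
have A0 : 0 < A by exact: expR_gt0.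
have [d d0 hd] := cderive_cexp0 (divr_gt0 e0 A0).
exists d => // h hh; have := hd _ hh; rewrite add0r cexp0 mul1r => {}hd.
have -> : cexp (z + h) - cexp z - cexp z * h = cexp z * (cexp h - 1 - h).
  by rewrite cexpD; ring.
rewrite normcM normc_cexp -/A mulrC -ler_pdivlMr//.
by rewrite mulrAC.
Qed.

Lemma cderive_cexp_comp (p : R[i] -> R[i]) z l : cderive p z l ->
  cderive (fun w => cexp (p w)) z (cexp (p z) * l).
Proof. by move=> dp; apply: cderive_comp dp (cderive_cexp _). Qed.

End complex_exponential.

(** * Goursat's theorem on rectangles *)

Section segment_integral.
Variable R : realType.
Implicit Types (g : R -> R[i]) (a b : R).
Notation mu := (@lebesgue_measure R).

Definition cint a b g : R[i] :=
  (\int[mu]_(x in `[a, b]) complex.Re (g x)) +i*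
  (\int[mu]_(x in `[a, b]) complex.Im (g x)).

Definition cintegrable a b g :=
  mu.-integrable `[a, b] (EFin \o (fun x => complex.Re (g x))) /\
  mu.-integrable `[a, b] (EFin \o (fun x => complex.Im (g x))).

Definition line_cont a b g := forall s : R, a <= s <= b -> forall e : R, 0 < e ->
  exists2 d : R, 0 < d & forall h : R, `|h| < d -> normc (g (s + h) - g s) <= e.

Lemma line_cont_integrable a b g : line_cont a b g -> cintegrable a b g.
Proof.
move=> cg; split; apply: continuous_compact_integrable;
  try exact: segment_compact; apply: continuous_in_subspaceT => x;
  rewrite inE/= in_itv/= => xab; apply/cvgrPdist_le => /= e e0;
  have [d d0 hd] := cg _ xab _ e0; apply/nbhs_ballP; exists d => //= y;
  rewrite /ball/= => xy; have := hd (y - x); rewrite distrC subrKC => /(_ xy);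
  apply: le_trans; rewrite normcB.
- by rewrite -Re_sub ler_norm_Re.
- by rewrite -Im_sub ler_norm_Im.
Qed.

Lemma cintegrable_cst a b c : cintegrable a b (fun=> c).
Proof.
apply: line_cont_integrable => s _ e e0; exists 1 => // h _.
by rewrite subrr normc_zero ltW.
Qed.

Lemma cintB a b f g : cintegrable a b f -> cintegrable a b g ->
  cint a b (fun x => f x - g x) = cint a b f - cint a b g.
Proof.
move=> [f1 f2] [g1 g2]; rewrite /cint; apply: complex_eq => /=.
  by under eq_Rintegral do rewrite Re_sub; rewrite RintegralB.
by under eq_Rintegral do rewrite Im_sub; rewrite RintegralB.
Qed.

Lemma cintegrableB a b f g : cintegrable a b f -> cintegrable a b g ->
  cintegrable a b (fun x => f x - g x).
Proof.
move=> [f1 f2] [g1 g2]; split.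
  by under [X in integrable _ _ X]eq_fun do rewrite /= Re_sub EFinB; exact: integrableB.
by under [X in integrable _ _ X]eq_fun do rewrite /= Im_sub EFinB; exact: integrableB.
Qed.

Lemma cint_cst a b c : a <= b -> cint a b (fun=> c) = (b - a)%:C * c.
Proof.
move=> ab; apply: complex_eq; rewrite /= Rintegral_cst//= lebesgue_measure_itv/= lte_fin;
  move: ab; rewrite le_eqVlt => /predU1P[->|ab]; rewrite ?ltxx ?ab/= ?subrr ?Re_mul ?Im_mul;
  by case: c => u v /=; rewrite ?mulr0 ?mul0r ?subr0 ?addr0 // mulrC.
Qed.

Lemma cint_split a b c g : a <= c <= b -> cintegrable a b g ->
  cint a b g = cint a c g + cint c b g.
Proof.
move=> /andP[ac cb] [g1 g2]; rewrite /cint.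
have H (f : R -> R) : mu.-integrable `[a, b] (EFin \o f) ->
  \int[mu]_(x in `[a, b]) f x =
  \int[mu]_(x in `[a, c]) f x + \int[mu]_(x in `[c, b]) f x.
  move=> fi; apply/eqP; rewrite addrC -subr_eq; apply/eqP.
  rewrite Rintegral_itvB// Rintegral_itv_obnd_cbnd//.
  by apply: integrableS fi => // x /=; rewrite !in_itv/= => /andP[/ltW cx ->]; rewrite (le_trans ac).
by rewrite !H//; apply: complex_eq.
Qed.

(** The factor 2 comes from bounding the real and imaginary parts separately. *)
Lemma normc_cint_le a b g (M : R) : a <= b -> cintegrable a b g ->
  (forall s, a <= s <= b -> normc (g s) <= M) ->
  normc (cint a b g) <= 2 * (M * (b - a)).
Proof.
move=> ab [g1 g2] gM.
have H (f : R -> R) : mu.-integrable `[a, b] (EFin \o f) ->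
    (forall s, a <= s <= b -> `|f s| <= M) ->
    `|\int[mu]_(x in `[a, b]) f x| <= M * (b - a).
  move=> fi fM; apply: le_trans (le_normr_Rintegral _ fi) _ => //.
  have -> : M * (b - a) = \int[mu]_(x in `[a, b]) M.
    rewrite Rintegral_cst//= lebesgue_measure_itv/= lte_fin.
    by move: ab; rewrite le_eqVlt => /predU1P[->|->//]; rewrite ltxx subrr.
  apply: le_Rintegral => //.
  - have := integrable_norm fi; by apply: eq_integrable.
  - by have [] := cintegrable_cst a b (M%:C).
apply: le_trans (normc_le_ReIm _) _; rewrite mulr2n mulrDl mul1r lerD//=.
  by apply: H => // s /gM; apply: le_trans; rewrite ler_norm_Re.
by apply: H => // s /gM; apply: le_trans; rewrite ler_norm_Im.
Qed.

Lemma eq_cint a b f g : (forall s, a <= s <= b -> f s = g s) ->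
  cint a b f = cint a b g.
Proof.
move=> fg; rewrite /cint; congr (_ +i* _); apply: eq_Rintegral => x;
  by rewrite inE/= in_itv/= => /fg ->.
Qed.

End segment_integral.

Section goursat.
Variable R : realType.
Implicit Types (G : R[i] -> R[i]) (x y p q : R).

(** The contour integral along the boundary of [x, x + p] x [y, y + q]. Opposite
    sides are paired, so that an affine G gives constant integrands. *)
Definition boundary_int G x y p q : R[i] :=
  cint x (x + p) (fun s => G (s +i* y) - G (s +i* (y + q)))
  + 'i%C * cint y (y + q) (fun t => G ((x + p) +i* t) - G (x +i* t)).

Definition holo_rect G x y p q := forall s t : R,
  x <= s <= x + p -> y <= t <= y + q -> exists l, cderive G (s +i* t) l.

Lemma cderive_line_h G (s t : R) l : cderive G (s +i* t) l ->
  forall e : R, 0 < e -> exists2 d : R, 0 < d &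
  forall h : R, `|h| < d -> normc (G ((s + h) +i* t) - G (s +i* t)) <= e.
Proof.
move=> /(@cderive_cont _ setT) cG e e0; have [d d0 hd] := cG _ e0.
exists d => // h hh; apply: hd => //=.
by rewrite (_ : s + h - s = h) ?subrr ?expr0n ?addr0 ?sqrtr_sqr//; ring.
Qed.

Lemma cderive_line_v G (s t : R) l : cderive G (s +i* t) l ->
  forall e : R, 0 < e -> exists2 d : R, 0 < d &
  forall h : R, `|h| < d -> normc (G (s +i* (t + h)) - G (s +i* t)) <= e.
Proof.
move=> /(@cderive_cont _ setT) cG e e0; have [d d0 hd] := cG _ e0.
exists d => // h hh; apply: hd => //=.
by rewrite (_ : t + h - t = h) ?subrr ?expr0n ?add0r ?sqrtr_sqr//; ring.
Qed.

Lemma holo_rect_h G x y p q t : holo_rect G x y p q -> y <= t <= y + q ->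
  cintegrable x (x + p) (fun s => G (s +i* t)).
Proof.
move=> hG ht; apply: line_cont_integrable => s hs.
by have [l /cderive_line_h] := hG _ _ hs ht.
Qed.

Lemma holo_rect_v G x y p q s : holo_rect G x y p q -> x <= s <= x + p ->
  cintegrable y (y + q) (fun t => G (s +i* t)).
Proof.
move=> hG hs; apply: line_cont_integrable => t ht.
by have [l /cderive_line_v] := hG _ _ hs ht.
Qed.

Lemma boundary_intE G x y p q : 0 <= p -> 0 <= q -> holo_rect G x y p q ->
  boundary_int G x y p q =
  cint x (x + p) (fun s => G (s +i* y)) - cint x (x + p) (fun s => G (s +i* (y + q)))
  + 'i%C * (cint y (y + q) (fun t => G ((x + p) +i* t)) - cint y (y + q) (fun t => G (x +i* t))).
Proof.
move=> p0 q0 hG; rewrite /boundary_int !cintB//.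
- by apply: holo_rect_v hG _; lra.
- by apply: holo_rect_v hG _; lra.
- by apply: holo_rect_h hG _; lra.
- by apply: holo_rect_h hG _; lra.
Qed.

Lemma holo_rect_sub G x y p q x' y' p' q' : holo_rect G x y p q ->
  x <= x' -> x' + p' <= x + p -> y <= y' -> y' + q' <= y + q ->
  holo_rect G x' y' p' q'.
Proof. by move=> hG h1 h2 h3 h4 s t hs ht; apply: hG; lra. Qed.

Lemma boundary_int_quad G x y p q : 0 <= p -> 0 <= q ->
  holo_rect G x y (p + p) (q + q) ->
  boundary_int G x y (p + p) (q + q) =
  boundary_int G x y p q + boundary_int G (x + p) y p q +
  boundary_int G x (y + q) p q + boundary_int G (x + p) (y + q) p q.
Proof.
move=> p0 q0 hG.
have h1 : holo_rect G x y p q by apply: holo_rect_sub hG _ _ _ _; lra.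
have h2 : holo_rect G (x + p) y p q by apply: holo_rect_sub hG _ _ _ _; lra.
have h3 : holo_rect G x (y + q) p q by apply: holo_rect_sub hG _ _ _ _; lra.
have h4 : holo_rect G (x + p) (y + q) p q by apply: holo_rect_sub hG _ _ _ _; lra.
rewrite !boundary_intE//; [|lra..].
have H t : y <= t <= y + (q + q) -> cint x (x + (p + p)) (fun s => G (s +i* t)) =
  cint x (x + p) (fun s => G (s +i* t)) + cint (x + p) (x + p + p) (fun s => G (s +i* t)).
  move=> ht; rewrite -[x + p + p]addrA; apply: cint_split; first lra.
  by apply: holo_rect_h hG ht.
have V s : x <= s <= x + (p + p) -> cint y (y + (q + q)) (fun t => G (s +i* t)) =
  cint y (y + q) (fun t => G (s +i* t)) + cint (y + q) (y + q + q) (fun t => G (s +i* t)).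
  move=> hs; rewrite -[y + q + q]addrA; apply: cint_split; first lra.
  by apply: holo_rect_v hG hs.
rewrite !H; [|lra..].
rewrite !V; [|lra..].
rewrite !addrA; ring.
Qed.

(** An affine function contributes p * i (- B) q + i * q B p = 0, so only the
    deviation from it counts. *)
Lemma boundary_int_affine G x y p q (A B : R[i]) (eta : R) :
  0 <= p -> 0 <= q -> holo_rect G x y p q ->
  (forall s t, x <= s <= x + p -> y <= t <= y + q ->
     normc (G (s +i* t) - A - B * (s +i* t)) <= eta) ->
  normc (boundary_int G x y p q) <= 4 * (eta * (p + q)).
Proof.
move=> p0 q0 hG hA.
have E1 : cint x (x + p) (fun s => G (s +i* y) - G (s +i* (y + q))) =
  cint x (x + p) (fun s => G (s +i* y) - G (s +i* (y + q)) - 'i%C * (- B) * q%:C)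
  + p%:C * ('i%C * (- B) * q%:C).
  rewrite [X in _ = X + _]cintB; [| |exact: cintegrable_cst].
    rewrite cint_cst; last lra.
    by rewrite [x + p]addrC addrK subrK.
  by apply: cintegrableB; apply: holo_rect_h hG _; lra.
have E2 : cint y (y + q) (fun t => G ((x + p) +i* t) - G (x +i* t)) =
  cint y (y + q) (fun t => G ((x + p) +i* t) - G (x +i* t) - B * p%:C)
  + q%:C * (B * p%:C).
  rewrite [X in _ = X + _]cintB; [| |exact: cintegrable_cst].
    rewrite cint_cst; last lra.
    by rewrite [y + q]addrC addrK subrK.
  by apply: cintegrableB; apply: holo_rect_v hG _; lra.
rewrite /boundary_int E1 E2 {E1 E2}.
set I1 := cint x _ _; set I2 := cint y _ _.
have -> : I1 + p%:C * ('i%C * - B * q%:C) + 'i%C * (I2 + q%:C * (B * p%:C)) = I1 + 'i%C * I2.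
  by ring.
apply: le_trans (le_normcD _ _) _; rewrite normc_iM.
have B1 : normc I1 <= 2 * (2 * eta * (x + p - x)).
  apply: normc_cint_le; first lra.
    by apply: cintegrableB (cintegrable_cst _ _ _); apply: cintegrableB; apply: holo_rect_h hG _; lra.
  move=> s hs.
  have -> : G (s +i* y) - G (s +i* (y + q)) - 'i%C * - B * q%:C =
    (G (s +i* y) - A - B * (s +i* y)) - (G (s +i* (y + q)) - A - B * (s +i* (y + q))).
    rewrite (_ : s +i* (y + q) = s +i* y + 'i%C * q%:C); first by ring.
    by apply: complex_eq => /=; ring.
  have := le_normcB (G (s +i* y) - A - B * (s +i* y)) (G (s +i* (y + q)) - A - B * (s +i* (y + q))).
  have h1 := hA s y hs; have h2 := hA s (y + q) hs; lra.
have B2 : normc I2 <= 2 * (2 * eta * (y + q - y)).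
  apply: normc_cint_le; first lra.
    by apply: cintegrableB (cintegrable_cst _ _ _); apply: cintegrableB; apply: holo_rect_v hG _; lra.
  move=> t ht.
  have -> : G ((x + p) +i* t) - G (x +i* t) - B * p%:C =
    (G ((x + p) +i* t) - A - B * ((x + p) +i* t)) - (G (x +i* t) - A - B * (x +i* t)).
    rewrite (_ : (x + p) +i* t = x +i* t + p%:C); first by ring.
    by apply: complex_eq => /=; ring.
  have := le_normcB (G ((x + p) +i* t) - A - B * ((x + p) +i* t)) (G (x +i* t) - A - B * (x +i* t)).
  have h1 := hA (x + p) t; have h2 := hA x t; lra.
lra.
Qed.

End goursat.

Section goursat_bisection.
Variable R : realType.
Variables (G : R[i] -> R[i]) (x y p q : R).
Hypotheses (p0 : 0 <= p) (q0 : 0 <= q) (hG : holo_rect G x y p q).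

Let pn n : R := p / 2 ^+ n.
Let qn n : R := q / 2 ^+ n.
Let J n (u : R * R) : R := normc (boundary_int G u.1 u.2 (pn n) (qn n)).

(* Among the four quarters, at least one carries a quarter of the modulus of the
   integral. *)
Let step n (u : R * R) : R * R :=
  let a := u.1 + pn n.+1 in let b := u.2 + qn n.+1 in
  if J n u <= 4 * J n.+1 u then u
  else if J n u <= 4 * J n.+1 (a, u.2) then (a, u.2)
  else if J n u <= 4 * J n.+1 (u.1, b) then (u.1, b)
  else (a, b).

Let corner := fix F n : R * R := if n is m.+1 then step m (F m) else (x, y).

Let pn_ge0 n : 0 <= pn n. Proof. by rewrite divr_ge0// exprn_ge0. Qed.
Let qn_ge0 n : 0 <= qn n. Proof. by rewrite divr_ge0// exprn_ge0. Qed.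

Let pnS n : pn n = pn n.+1 + pn n.+1.
Proof. by rewrite /pn exprS; field; rewrite expf_neq0. Qed.
Let qnS n : qn n = qn n.+1 + qn n.+1.
Proof. by rewrite /qn exprS; field; rewrite expf_neq0. Qed.

Let step1 n u : (step n u).1 = u.1 \/ (step n u).1 = u.1 + pn n.+1.
Proof. by rewrite /step; do 3 (case: ifP => _; [by [left|right]|]); right. Qed.
Let step2 n u : (step n u).2 = u.2 \/ (step n u).2 = u.2 + qn n.+1.
Proof. by rewrite /step; do 3 (case: ifP => _; [by [left|right]|]); right. Qed.

Let corner_in n : [/\ x <= (corner n).1, (corner n).1 + pn n <= x + p,
  y <= (corner n).2 & (corner n).2 + qn n <= y + q].
Proof.
elim: n => [|n [h1 h2 h3 h4]]; first by rewrite /= /pn /qn expr0 !divr1.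
move: h2 h4; rewrite pnS qnS => h2 h4.
have := pn_ge0 n.+1; have := qn_ge0 n.+1 => hq hp.
rewrite [corner n.+1]/=.
have [-> |->] := step1 n (corner n); have [-> |->] := step2 n (corner n); split; lra.
Qed.

Let corner_J n : J n (corner n) <= 4 * J n.+1 (corner n.+1).
Proof.
rewrite [corner n.+1]/=; set u := corner n.
have [h1 h2 h3 h4] := corner_in n; rewrite -/u in h1 h2 h3 h4.
rewrite /step; case: ifPn => //; rewrite -ltNge => n1.
case: ifPn => //; rewrite -ltNge => n2.
case: ifPn => //; rewrite -ltNge => n3.
have : J n u <= J n.+1 u + J n.+1 (u.1 + pn n.+1, u.2) + J n.+1 (u.1, u.2 + qn n.+1)
    + J n.+1 (u.1 + pn n.+1, u.2 + qn n.+1).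
  rewrite /J pnS qnS boundary_int_quad//.
    do 3 (apply: le_trans (le_normcD _ _) _; rewrite lerD//).
  by rewrite -pnS -qnS; apply: holo_rect_sub hG _ _ _ _.
lra.
Qed.

Let corner_J0 n : J 0 (x, y) <= 4 ^+ n * J n (corner n).
Proof.
elim: n => [|n IH]; first by rewrite expr0 mul1r.
apply: le_trans IH _; rewrite exprSr -mulrA ler_wpM2l ?exprn_ge0//.
Qed.

Let corner_mono m n : (m <= n)%N ->
  (corner m).1 <= (corner n).1 /\ (corner n).1 + pn n <= (corner m).1 + pn m /\
  (corner m).2 <= (corner n).2 /\ (corner n).2 + qn n <= (corner m).2 + qn m.
Proof.
move=> /subnK <-; elim: (n - m)%N => [|k [h1 [h2 [h3 h4]]]] //.
rewrite addSn [corner (k + m).+1]/=.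
move: h2 h4; rewrite [pn (k + m)]pnS [qn (k + m)]qnS => h2 h4.
have := pn_ge0 (k + m).+1; have := qn_ge0 (k + m).+1 => hq hp.
have [-> |->] := step1 (k + m) (corner (k + m));
have [-> |->] := step2 (k + m) (corner (k + m)); (do ! split); lra.
Qed.

Let nested_limit (u v : nat -> R) :
  (forall m n, (m <= n)%N -> u m <= u n /\ u n + v n <= u m + v m) ->
  (forall n, 0 <= v n) ->
  exists s, forall n, u n <= s <= u n + v n.
Proof.
move=> mono v0; exists (sup (range u)) => n.
have ub m : u m <= u n + v n.
  have [mn|nm] := leqP m n.
    by have [h _] := mono _ _ mn; have := v0 n; lra.
  by have [_ h] := mono _ _ (ltnW nm); have := v0 m; lra.
apply/andP; split.
  apply: ub_le_sup; last by exists n.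
  by exists (u n + v n) => _ [m _ <-].
apply: ge_sup; first by exists (u n), n.
by move=> _ [m _ <-].
Qed.

Let geom_small (c d : R) : 0 < d -> exists n, c / 2 ^+ n < d.
Proof.
move=> d0; have [n hn] : exists n, (c / d < n%:R).
  exists (Num.truncn (Num.max 0 (c / d))).+1.
  have := @truncnS_gt R (Num.max 0 (c / d)); apply: le_lt_trans.
  by rewrite le_max lexx orbT.
exists n; rewrite ltr_pdivrMr ?exprn_gt0//.
rewrite ltr_pdivrMr// in hn; apply: lt_le_trans hn _.
by rewrite mulrC ler_pM2l// -natrX ler_nat ltnW// ltn_expl.
Qed.

(** The nested rectangles shrink to a point where G is differentiable. There the
    integral over the n-th one is o (4 ^ - n), by comparison with the affine
    approximation, while it is at least 4 ^ - n times the integral over the whole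
    rectangle. *)
Lemma goursat_rect : boundary_int G x y p q = 0.
Proof.
apply/eqP; rewrite -normc_eq0 eq_le normc_ge0 andbT.
have -> : normc (boundary_int G x y p q) = J 0 (x, y).
  by rewrite /J /pn /qn expr0 !divr1.
apply/ler_addgt0Pr => e e0; rewrite add0r.
have [s hs] := @nested_limit (fun n => (corner n).1) pn
  (fun m n mn => let: conj a (conj b _) := corner_mono mn in conj a b) pn_ge0.
have [t ht] := @nested_limit (fun n => (corner n).2) qn
  (fun m n mn => let: conj _ (conj _ c) := corner_mono mn in c) qn_ge0.
have hs0 : x <= s <= x + p by have := hs 0%N; rewrite /= /pn expr0 divr1.
have ht0 : y <= t <= y + q by have := ht 0%N; rewrite /= /qn expr0 divr1.
have [l dl] := hG hs0 ht0.
(* 4 (p + q)^2 is the constant of the estimate; the 1 makes K positive. *)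
set K := 4 * (p + q) ^+ 2 + 1.
have K0 : 0 < K by rewrite /K ltr_wpDl// mulr_ge0// exprn_ge0// addr_ge0.
have [d d0 hd] := dl _ (divr_gt0 e0 K0).
have [n hn] := geom_small (p + q) d0.
apply: le_trans (corner_J0 n) _.
have [c1 c2 c3 c4] := corner_in n.
set A := G (s +i* t) - l * (s +i* t).
have hJ : J n (corner n) <= 4 * (e / K * (pn n + qn n) * (pn n + qn n)).
  apply: (@boundary_int_affine _ G _ _ _ _ A l) => //.
    by apply: holo_rect_sub hG _ _ _ _.
  move=> s' t' hs' ht'.
  have nz : normc ((s' - s) +i* (t' - t)) <= pn n + qn n.
    apply: le_trans (normc_le_ReIm _) _ => /=.
    have := hs n; have := ht n => /andP[t1 t2] /andP[s1 s2].
    by apply: lerD; rewrite ler_norml; lra.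
  have pq : pn n + qn n < d by rewrite -mulrDl.
  have := hd _ (le_lt_trans nz pq).
  have -> : s +i* t + ((s' - s) +i* (t' - t)) = s' +i* t'.
    by apply: complex_eq => /=; ring.
  have -> : G (s' +i* t') - G (s +i* t) - l * ((s' - s) +i* (t' - t)) =
     G (s' +i* t') - A - l * (s' +i* t').
    rewrite (_ : ((s' - s) +i* (t' - t)) = s' +i* t' - s +i* t); first by rewrite /A; ring.
    by apply: complex_eq => /=; ring.
  move=> /le_trans; apply; rewrite ler_wpM2l// divr_ge0 ?ltW//.
have h4 : 0 <= 4 ^+ n :> R by rewrite exprn_ge0.
apply: le_trans (ler_wpM2l h4 hJ) _.
have -> : 4 ^+ n * (4 * (e / K * (pn n + qn n) * (pn n + qn n))) =
   (4 * (p + q) ^+ 2) * (e / K).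
  have -> : 4 ^+ n = 2 ^+ n * 2 ^+ n :> R by rewrite -exprMn; congr (_ ^+ n); ring.
  by rewrite /pn /qn; field; rewrite expf_neq0//= gt_eqF.
rewrite mulrA ler_pdivrMr// mulrC ler_wpM2l//; first exact: ltW.
by rewrite /K lerDl.
Qed.

End goursat_bisection.


(** * Cauchy estimates *)

Section cauchy_estimate.
Variable R : realType.
Implicit Types (f : R[i] -> R[i]) (z h l : R[i]) (r M : R).

(** Goursat on [s0, s1] x [0, 2 pi]: the horizontal sides cancel by periodicity. In
    the variable exp (s + it), this is the independence of circular means from the
    radius. *)
Lemma circle_mean_const (G : R[i] -> R[i]) (s0 s1 : R) : s0 <= s1 ->
  (forall s t : R, s <= s1 -> exists l, cderive G (s +i* t) l) ->
  (forall s : R, G (s +i* (pi *+ 2)) = G (s +i* 0)) ->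
  cint 0 (pi *+ 2) (fun t => G (s0 +i* t)) = cint 0 (pi *+ 2) (fun t => G (s1 +i* t)).
Proof.
move=> s01 hG per.
have p0 : 0 <= s1 - s0 by lra.
have q0 : 0 <= pi *+ 2 :> R by rewrite ltW// pi2_gt0.
have hr : holo_rect G s0 0 (s1 - s0) (pi *+ 2) by move=> s t hs _; apply: hG; lra.
have := goursat_rect p0 q0 hr; rewrite boundary_intE// !add0r subrKC.
under [X in X - _ + _]eq_cint do rewrite -per.
rewrite subrr add0r => /eqP; rewrite mulf_eq0 => /orP[/eqP[] /eqP|].
  by rewrite oner_eq0.
by rewrite subr_eq0 => /eqP ->.
Qed.

(** The function F (w) = (f (z + exp w) - f z) exp (- w) is periodic and tends to l
    as Re w goes to - oo; its mean over a vertical segment is constant, hence equal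
    to l, and is bounded by its values on the circle of radius r / 2. The constant
    8 includes a factor 2 from normc_cint_le. *)
Lemma cauchy_estimate f z r M l : 0 < r ->
  (forall w, normc (w - z) < r -> exists m, cderive f w m) ->
  (forall w, normc (w - z) < r -> normc (f w) <= M) ->
  cderive f z l -> normc l <= 8 * (M / r).
Proof.
move=> r0 hf hM dl.
have M0 : 0 <= M.
  by apply: le_trans (normc_ge0 (f z)) _; apply: hM; rewrite subrr normc_zero.
set F : R[i] -> R[i] := fun w => (f (z + cexp w) - f z) * cexp (- w).
set s1 := ln (r / 2).
have r2 : r / 2 \is Num.pos by rewrite posrE; lra.
have es1 : expR s1 = r / 2 by rewrite /s1 lnK.
have dF (s t : R) : s <= s1 -> exists m, cderive F (s +i* t) m.
  move=> ss1; have hr : normc (z + cexp (s +i* t) - z) < r.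
    rewrite (_ : z + _ - z = cexp (s +i* t)); last by ring.
    rewrite normc_cexp /=; have : expR s <= expR s1 by rewrite ler_expR.
    by rewrite es1; lra.
  have [m dm] := hf _ hr; eexists; apply: cderiveM.
    apply: cderiveD; last exact: cderive_cst.
    apply: (@cderive_comp _ (fun w => z + cexp w) f); last exact: dm.
    by apply: cderiveD; [exact: cderive_cst|exact: cderive_cexp].
  apply: (@cderive_comp _ (fun w => - w) (@cexp R)); last exact: cderive_cexp.
  apply: (@cderive_eq _ (fun w => (-1) * w)); first by move=> w; rewrite mulN1r.
  by apply: cderiveM; [exact: cderive_cst|exact: cderive_id].
have per (s : R) : F (s +i* (pi *+ 2)) = F (s +i* 0).
  have E (u : R) : cexp (u +i* (pi *+ 2)) = cexp (u +i* 0).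
    by rewrite /cexp /= cos2pi sin2pi cos0 sin0.
  have E' (u : R) : cexp (u +i* (- (pi *+ 2))) = cexp (u +i* 0).
    by rewrite /cexp /= cosN sinN cos2pi sin2pi cos0 sin0 oppr0.
  rewrite /F E.
  have -> : - (s +i* (pi *+ 2)) = (- s) +i* (- (pi *+ 2)) by [].
  have -> : - (s +i* 0) = (- s) +i* (- 0) by [].
  by rewrite E' oppr0.
apply/ler_addgt0Pr => e e0.
have [d d0 hd] := dl _ (divr_gt0 e0 (ltr0n R 2)).
set s0 := Num.min s1 (ln (d / 2)).
have s01 : s0 <= s1 by rewrite ge_min lexx.
have es0 : expR s0 < d.
  apply: (@le_lt_trans _ _ (d / 2)); last lra.
  have -> : d / 2 = expR (ln (d / 2)) by rewrite lnK// posrE; lra.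
  by rewrite ler_expR ge_min lexx orbT.
have A := circle_mean_const s01 dF per.
have q0 : 0 < pi *+ 2 :> R := pi2_gt0 R.
have intF s : s <= s1 -> cintegrable 0 (pi *+ 2) (fun t => F (s +i* t)).
  move=> ss; apply: line_cont_integrable => t _.
  by have [m /cderive_line_v] := dF s t ss.
have B1 : normc (cint 0 (pi *+ 2) (fun t => F (s1 +i* t))) <= 2 * (4 * (M / r) * (pi *+ 2 - 0)).
  apply: normc_cint_le; [lra|exact: intF|] => t _.
  rewrite /F normcM !normc_cexp /= expRN es1.
  have := le_normcB (f (z + cexp (s1 +i* t))) (f z).
  have h1 : normc (f (z + cexp (s1 +i* t))) <= M.
    apply: hM; rewrite (_ : z + _ - z = cexp (s1 +i* t)); last by ring.
    by rewrite normc_cexp /= es1; lra.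
  have h2 : normc (f z) <= M by apply: hM; rewrite subrr normc_zero.
  move=> h3.
  have -> : 4 * (M / r) = 2 * M * (r / 2)^-1 by field; rewrite gt_eqF.
  apply: ler_wpM2r; first by rewrite invr_ge0 ltW.
  lra.
have B2 : normc (cint 0 (pi *+ 2) (fun t => F (s0 +i* t) - l)) <= 2 * (e / 2 * (pi *+ 2 - 0)).
  apply: normc_cint_le; [lra|by apply: cintegrableB (cintegrable_cst _ _ _); exact: intF|] => t _.
  have hw : normc (cexp (s0 +i* t)) < d by rewrite normc_cexp.
  have -> : F (s0 +i* t) - l =
     (f (z + cexp (s0 +i* t)) - f z - l * cexp (s0 +i* t)) * cexp (- (s0 +i* t)).
    have E : cexp (s0 +i* t) * cexp (- (s0 +i* t)) = 1 by rewrite -cexpD subrr cexp0.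
    by rewrite /F [RHS]mulrBl -mulrA E mulr1.
  rewrite normcM [X in _ * X]normc_cexp [complex.Re (- _)]/=.
  have := hd _ hw; rewrite [X in _ <= _ * X]normc_cexp [complex.Re _]/= => h.
  apply: le_trans (ler_wpM2r (expR_ge0 (- s0)) h) _.
  by rewrite -mulrA -expRD subrr expR0 mulr1.
have := B2; rewrite cintB ?cint_cst ?subr0; [|lra|exact: intF|exact: cintegrable_cst].
rewrite A => B3.
have := le_normcBD ((pi *+ 2)%:C * l) (cint 0 (pi *+ 2) (fun t => F (s1 +i* t))) 0.
rewrite !subr0 in B1 *.
rewrite normcM normc_real (ger0_norm (ltW q0)) (normcB ((pi *+ 2)%:C * l)).
move=> B4.
have {B4}: (pi *+ 2) * normc l <= (pi *+ 2) * (8 * (M / r) + e).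
  apply: le_trans B4 _; apply: le_trans (lerD B3 B1) _.
  rewrite le_eqVlt; apply/orP; left; apply/eqP; field; rewrite gt_eqF//.
by rewrite ler_pM2l.
Qed.

(** Converse of is_derive_eps. *)
Lemma eps_is_derive (g : R -> R) (x l : R) :
  (forall e : R, 0 < e -> exists2 d : R, 0 < d &
   forall h : R, `|h| < d -> `|g (x + h) - g x - l * h| <= e * `|h|) ->
  is_derive x 1 g l.
Proof.
move=> H.
have C : (h^-1 *: (g (h *: 1 + x) - g x)) @[h --> 0^'] --> l.
  apply/cvgrPdist_le => e e0; have [d d0 hd] := H _ e0.
  rewrite near_withinE; apply/nbhs_ballP; exists d => //= h.
  rewrite /ball/= sub0r normrN => hh h0.
  have nh : 0 < `|h| by rewrite normr_gt0.
  rewrite -(ler_pM2r nh) -normrM.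
  apply: le_trans (hd _ hh); rewrite -normrN le_eqVlt; apply/orP; left; apply/eqP.
  by congr `|_|; rewrite [h *: 1]mulr1 [h + x]addrC /GRing.scale/=; field.
have D : derivable g x 1 by apply/cvg_ex; exists l.
by apply: DeriveDef => //; exact: cvg_lim C.
Qed.

(** Every point of the segment is the centre of a disc of radius r / 2 in which f is
    bounded by M: integrate the Cauchy estimate by the mean value theorem, applied
    to the real and imaginary parts. *)
Lemma holo_lipschitz f z r M h : 0 < r ->
  (forall w, normc (w - z) < r -> exists m, cderive f w m) ->
  (forall w, normc (w - z) < r -> normc (f w) <= M) ->
  normc h < r / 2 -> normc (f (z + h) - f z) <= 32 * (M / r) * normc h.
Proof.
move=> r0 hf hM hh.
pose phi (t : R) := f (z + t%:C * h).
have near_seg (t : R) : 0 <= t <= 1 -> normc (z + t%:C * h - z) < r / 2.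
  move=> t01; rewrite (_ : z + _ - z = t%:C * h); last by ring.
  rewrite normcM normc_real ger0_norm; last lra.
  apply: le_lt_trans hh; rewrite ler_piMl ?normc_ge0//; lra.
have df (t : R) : 0 <= t <= 1 ->
    exists2 m, cderive f (z + t%:C * h) m & normc m <= 16 * (M / r).
  move=> t01; have t0 := near_seg _ t01.
  have [m dm] : exists m, cderive f (z + t%:C * h) m by apply: hf; lra.
  exists m => //.
  have near2 w : normc (w - (z + t%:C * h)) < r / 2 -> normc (w - z) < r.
    move=> hw; have := le_normcBD w (z + t%:C * h) z; lra.
  have := @cauchy_estimate f (z + t%:C * h) (r / 2) M m _ _ _ dm.
  have -> : 8 * (M / (r / 2)) = 16 * (M / r) by field; rewrite gt_eqF.
  apply; first lra.
    by move=> w /near2; exact: hf.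
  by move=> w /near2; exact: hM.
have dphi (t : R) : 0 <= t <= 1 -> exists2 m, normc m <= 16 * (M / r) &
    forall e : R, 0 < e -> exists2 d : R, 0 < d &
    forall k : R, `|k| < d -> normc (phi (t + k) - phi t - m * h * k%:C) <= e * `|k|.
  move=> t01; have [m dm m16] := df _ t01; exists m => // e e0.
  set A := normc h + 1; have A0 : 0 < A by rewrite /A ltr_wpDl ?normc_ge0.
  have [d d0 hd] := dm _ (divr_gt0 e0 A0).
  exists (d / A); first exact: divr_gt0.
  move=> k; rewrite ltr_pdivlMr// => kd.
  have kA : normc (k%:C * h) <= `|k| * A.
    by rewrite normcM normc_real ler_wpM2l// /A lerDl.
  have := hd _ (le_lt_trans kA kd).
  have -> : z + t%:C * h + k%:C * h = z + (t + k)%:C * h by rewrite rmorphD; ring.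
  rewrite -/(phi t) -/(phi (t + k)) => H.
  have -> : m * h * k%:C = m * (k%:C * h) by ring.
  apply: le_trans H _; apply: le_trans (ler_wpM2l _ kA) _; first by rewrite divr_ge0// ltW.
  rewrite le_eqVlt; apply/orP; left; apply/eqP; field; rewrite gt_eqF//.
have M0 : 0 <= M.
  by apply: le_trans (normc_ge0 (f z)) _; apply: hM; rewrite subrr normc_zero.
have MVT1 (P : R[i] -> R) :
    (forall a b, P (a - b) = P a - P b) -> (forall a (k : R), P (a * k%:C) = P a * k) ->
    (forall a, `|P a| <= normc a) -> `|P (phi 1 - phi 0)| <= 16 * (M / r) * normc h.
  move=> PB PZ Pn.
  (* The derivative along the segment, with the value 0 outside [0, 1]. *)
  pose dd t := if pselect (exists2 m, normc m <= 16 * (M / r) &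
    forall e : R, 0 < e -> exists2 d : R, 0 < d &
    forall k : R, `|k| < d -> normc (phi (t + k) - phi t - m * h * k%:C) <= e * `|k|)
    is left E then s2val (cid2 E) else 0.
  have ddP (t : R) : 0 <= t <= 1 -> normc (dd t) <= 16 * (M / r) /\
      is_derive t 1 (fun u => P (phi u)) (P (dd t * h)).
    move=> /dphi E; rewrite /dd; case: pselect => [E'|//]; case: (cid2 E') => m m16 /= Hm.
    split=> //; apply: eps_is_derive => e e0; have [d d0 hd] := Hm _ e0.
    by exists d => // k kd; rewrite -PZ -!PB; apply: le_trans (Pn _) (hd _ kd).
  have [] := @MVT_segment R (fun u => P (phi u)) (fun t => P (dd t * h)) 0 1 ler01.
  - move=> t; rewrite in_itv/= => t01; have t01' : 0 <= t <= 1 by lra.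
    exact: (ddP t t01').2.
  - apply: derivable_within_continuous => t; rewrite in_itv/= => t01.
    by have [_ []] := ddP _ t01.
  move=> c; rewrite in_itv/= subr0 mulr1 => c01 E; rewrite PB E.
  apply: le_trans (Pn _) _; rewrite normcM ler_wpM2r ?normc_ge0//.
  exact: (ddP _ c01).1.
have -> : f (z + h) - f z = phi 1 - phi 0 by rewrite /phi mul1r mul0r addr0.
apply: le_trans (normc_le_ReIm _) _.
have h1 := MVT1 _ (@Re_sub R) _ (@ler_norm_Re R).
have h2 := MVT1 _ (@Im_sub R) _ (@ler_norm_Im R).
have {}h1 : `|complex.Re (phi 1 - phi 0)| <= 16 * (M / r) * normc h.
  by apply: h1 => a k; rewrite Re_mul/= mulr0 subr0.
have {}h2 : `|complex.Im (phi 1 - phi 0)| <= 16 * (M / r) * normc h.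
  by apply: h2 => a k; rewrite Im_mul/= mulr0 add0r.
lra.
Qed.

Lemma cauchy_remainder f z r M l h : 0 < r ->
  (forall w, normc (w - z) < r -> exists m, cderive f w m) ->
  (forall w, normc (w - z) < r -> normc (f w) <= M) ->
  cderive f z l -> normc h < r / 2 ->
  normc (f (z + h) - f z - l * h) <= 40 * (M / r) * normc h.
Proof.
move=> r0 hf hM dl hh.
have := le_normcB (f (z + h) - f z) (l * h).
have := holo_lipschitz r0 hf hM hh.
have := ler_wpM2r (normc_ge0 h) (cauchy_estimate r0 hf hM dl).
rewrite normcM; lra.
Qed.

End cauchy_estimate.

(** * Integration of complex functions *)

Section complex_integration.
Context d (T : measurableType d) (R : realType).
Variable m : {measure set T -> \bar R}.
Implicit Types (f g : T -> R[i]).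

Definition cmeasurable f :=
  measurable_fun setT (fun x => complex.Re (f x)) /\
  measurable_fun setT (fun x => complex.Im (f x)).

Lemma cmeasurable_cst c : cmeasurable (fun=> c).
Proof. by split; exact: measurable_cst. Qed.

Lemma cmeasurableM f g : cmeasurable f -> cmeasurable g ->
  cmeasurable (fun x => f x * g x).
Proof.
move=> [f1 f2] [g1 g2]; split.
  under eq_fun do rewrite Re_mul; apply: measurable_funB; exact: measurable_funM.
under eq_fun do rewrite Im_mul; apply: measurable_funD; exact: measurable_funM.
Qed.

Lemma measurable_normc f : cmeasurable f -> measurable_fun setT (fun x => normc (f x)).
Proof.
move=> [f1 f2].
under eq_fun => x.
  rewrite (_ : normc (f x) = Num.sqrt (complex.Re (f x) ^+ 2 + complex.Im (f x) ^+ 2));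
    last by case: (f x).
  over.
apply: (@measurableT_comp _ _ _ _ _ _ (@Num.sqrt R)).
  exact: continuous_measurable_fun (@sqrt_continuous R).
by apply: measurable_funD; exact: measurable_funX.
Qed.

Lemma integrableC_cmeasurable f : integrableC m f -> cmeasurable f.
Proof.
by move=> [/measurable_int/measurable_EFinP ? /measurable_int/measurable_EFinP].
Qed.

Lemma integrableC_norm f : integrableC m f -> m.-integrable setT (fun x => (normc (f x))%:E).
Proof.
move=> fi; have [f1 f2] := fi.
apply: (le_integrable _ _ _ (integrableD _ (integrable_abse f1) (integrable_abse f2))) => //.
  exact/measurable_EFinP/measurable_normc/integrableC_cmeasurable.
move=> x _; rewrite [leRHS]gee0_abs; last by apply: adde_ge0; exact: abse_ge0.
by rewrite /= lee_fin ger0_norm ?normc_ge0// normc_le_ReIm.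
Qed.

Lemma le_integrableC f (g : T -> R) : cmeasurable f ->
  m.-integrable setT (EFin \o g) -> (forall x, normc (f x) <= g x) -> integrableC m f.
Proof.
move=> [f1 f2] gi fg; split; apply: (le_integrable _ _ _ gi) => //;
  try exact/measurable_EFinP; move=> x _ /=; rewrite lee_fin.
- exact: le_trans (ler_norm_Re _) (le_trans (fg x) (ler_norm _)).
- exact: le_trans (ler_norm_Im _) (le_trans (fg x) (ler_norm _)).
Qed.

Lemma integrableC_bounded_mul f g (K : R) : integrableC m f -> cmeasurable g ->
  (forall x, normc (g x) <= K) -> integrableC m (fun x => f x * g x).
Proof.
move=> fi mg gK; apply: (@le_integrableC _ (fun x => K * normc (f x))).
- by apply: cmeasurableM => //; exact: integrableC_cmeasurable.
- have := integrableZl measurableT K (integrableC_norm fi).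
  by apply: eq_integrable.
- by move=> x; rewrite normcM mulrC ler_wpM2r// normc_ge0.
Qed.

Lemma integrableCD f g : integrableC m f -> integrableC m g ->
  integrableC m (fun x => f x + g x).
Proof.
move=> [f1 f2] [g1 g2]; split.
  by under eq_fun do rewrite Re_add EFinD; exact: integrableD.
by under eq_fun do rewrite Im_add EFinD; exact: integrableD.
Qed.

Lemma integrableCZ c f : integrableC m f -> integrableC m (fun x => c * f x).
Proof.
move=> fi; have := integrableC_bounded_mul (K := normc c) fi (cmeasurable_cst c).
move=> H; under [X in integrableC _ X]eq_fun do rewrite mulrC.
exact: H.
Qed.

Lemma integrableCB f g : integrableC m f -> integrableC m g ->
  integrableC m (fun x => f x - g x).
Proof.
move=> fi gi; under [X in integrableC _ X]eq_fun do rewrite -mulN1r.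
exact/integrableCD/integrableCZ.
Qed.

Lemma integrableC0 : integrableC m (fun=> 0).
Proof. by split; exact: integrable0. Qed.

Lemma integrableC_sum I (s : seq I) (F : I -> T -> R[i]) :
  (forall i, integrableC m (F i)) -> integrableC m (fun x => \sum_(i <- s) F i x).
Proof.
move=> Fi; elim: s => [|i s IH].
  by under [X in integrableC _ X]eq_fun do rewrite big_nil; exact: integrableC0.
by under [X in integrableC _ X]eq_fun do rewrite big_cons; exact: integrableCD.
Qed.

Lemma integralCD f g : integrableC m f -> integrableC m g ->
  integralC m (fun x => f x + g x) = integralC m f + integralC m g.
Proof.
move=> [f1 f2] [g1 g2]; rewrite /integralC; apply: complex_eq => /=.
  by under eq_Rintegral do rewrite Re_add; rewrite RintegralD.
by under eq_Rintegral do rewrite Im_add; rewrite RintegralD.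
Qed.

Lemma integralCZ c f : integrableC m f ->
  integralC m (fun x => c * f x) = c * integralC m f.
Proof.
move=> [f1 f2]; rewrite /integralC; apply: complex_eq; rewrite ?Re_mul ?Im_mul /=.
  under eq_Rintegral do rewrite Re_mul.
  rewrite RintegralB ?RintegralZl//.
    by have := integrableZl measurableT (complex.Re c) f1; apply: eq_integrable.
  by have := integrableZl measurableT (complex.Im c) f2; apply: eq_integrable.
under eq_Rintegral do rewrite Im_mul.
rewrite RintegralD ?RintegralZl//.
  by have := integrableZl measurableT (complex.Re c) f2; apply: eq_integrable.
by have := integrableZl measurableT (complex.Im c) f1; apply: eq_integrable.
Qed.

Lemma integralCB f g : integrableC m f -> integrableC m g ->
  integralC m (fun x => f x - g x) = integralC m f - integralC m g.
Proof.
move=> fi gi; under [X in integralC _ X]eq_fun do rewrite -mulN1r.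
by rewrite integralCD ?integralCZ ?mulN1r//; exact: integrableCZ.
Qed.

Lemma integralC0 : integralC m (fun=> 0) = 0.
Proof. by apply: complex_eq; rewrite /= Rintegral_cst// mul0r. Qed.

Lemma integralC_sum I (s : seq I) (F : I -> T -> R[i]) :
  (forall i, integrableC m (F i)) ->
  integralC m (fun x => \sum_(i <- s) F i x) = \sum_(i <- s) integralC m (F i).
Proof.
move=> Fi; elim: s => [|i s IH].
  by under [X in integralC _ X]eq_fun do rewrite big_nil; rewrite big_nil integralC0.
under [X in integralC _ X]eq_fun do rewrite big_cons.
by rewrite big_cons integralCD ?IH//; exact: integrableC_sum.
Qed.

Lemma eq_integralC f g : f =1 g -> integralC m f = integralC m g.
Proof. by move=> /funext ->. Qed.

(** Pairing with the conjugate direction of the value of the integral turns the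
    modulus into the integral of a real function. *)
Lemma normc_integralC_le f : integrableC m f ->
  normc (integralC m f) <= \int[m]_x normc (f x).
Proof.
move=> fi; have [f1 f2] := fi; set I := integralC m f.
have [->|I0] := eqVneq I 0.
  by rewrite normc_zero Rintegral_ge0// => x _; exact: normc_ge0.
have nI : 0 < normc I by rewrite normc_gt0.
rewrite -(ler_pM2l nI) -expr2 sqr_normcE -RintegralZl//; last exact: integrableC_norm.
have e1 : complex.Re I = \int[m]_x complex.Re (f x) by [].
have e2 : complex.Im I = \int[m]_x complex.Im (f x) by [].
have i1 := integrableZl measurableT (complex.Re I) f1.
have i2 := integrableZl measurableT (complex.Im I) f2.
rewrite !expr2 {2}e1 {2}e2 -!RintegralZl// -RintegralD//.
apply: le_Rintegral => //.
- by have := integrableD measurableT i1 i2; apply: eq_integrable.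
- by have := integrableZl measurableT (normc I) (integrableC_norm fi); apply: eq_integrable.
move=> x _; rewrite -normcM.
have -> : normc (I * f x) = normc (conjc I * f x).
  by rewrite !normcM; congr (_ * _); case: (I) => a b /=; rewrite sqrrN.
apply: le_trans (ler_norm _) _; apply: le_trans _ (ler_norm_Re _).
by rewrite Re_mul; case: (I) (f x) => a b [u v] /=; rewrite mulNr opprK.
Qed.

Lemma Rintegral_normcD f g : integrableC m f -> integrableC m g ->
  \int[m]_x normc (f x + g x) <= \int[m]_x normc (f x) + \int[m]_x normc (g x).
Proof.
move=> fi gi; rewrite -RintegralD//; try exact: integrableC_norm.
apply: le_Rintegral => //.
- exact/integrableC_norm/integrableCD.
- have := integrableD measurableT (integrableC_norm fi) (integrableC_norm gi).
  by apply: eq_integrable.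
- by move=> x _; exact: le_normcD.
Qed.

Lemma Rintegral_normcZ c f : integrableC m f ->
  \int[m]_x normc (c * f x) = normc c * \int[m]_x normc (f x).
Proof.
move=> fi; under eq_Rintegral do rewrite normcM.
by rewrite RintegralZl//; exact: integrableC_norm.
Qed.

Lemma Rintegral_normc_ge0 f : 0 <= \int[m]_x normc (f x).
Proof. by apply: Rintegral_ge0 => x _; exact: normc_ge0. Qed.

End complex_integration.

Section finite_measure_integration.
Context d (T : measurableType d) (R : realType).
Variable m : {finite_measure set T -> \bar R}.
Implicit Types (f g : T -> R[i]).

Lemma integrableC_bounded g (K : R) : cmeasurable g ->
  (forall x, normc (g x) <= K) -> integrableC m g.
Proof.
move=> mg gK; apply: (le_integrableC (g := fun=> K)) => //.
exact: finite_measure_integrable_cst.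
Qed.

Lemma integralC_cst c : integralC m (fun=> c) = c * (fine (m setT))%:C.
Proof.
apply: complex_eq; rewrite /= Rintegral_cst//= ?mulr0 ?subr0 ?add0r; case: c => a b //=.
by rewrite mulr0 subr0.
by rewrite mulr0 add0r.
Qed.

End finite_measure_integration.

Section L1_completeness.
Context d (T : measurableType d) (R : realType).
Variable m : {measure set T -> \bar R}.

(** The sum g of the absolute values has finite integral, so the series converges
    where g is finite, that is almost everywhere, and g dominates its partial
    sums. *)
Lemma L1_series_real (v : nat -> T -> R) (B : R) :
  (forall k, m.-integrable setT (EFin \o v k)) ->
  (forall n, \sum_(k < n) \int[m]_x `|v k x| <= B) ->
  exists2 f : T -> R, m.-integrable setT (EFin \o f) &
    \int[m]_x `|f x - \sum_(k < n) v k x| @[n --> \oo] --> (0 : R).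
Proof.
move=> vi vB.
pose g x := (\sum_(0 <= k <oo) `|v k x|%:E)%E.
have mv k : measurable_fun setT (fun x => `|v k x|%:E).
  by have := integrable_abse (vi k) => /measurable_int.
have g0 x : (0 <= g x)%E by apply: nneseries_ge0.
have mg : measurable_fun setT g by apply: ge0_emeasurable_sum.
have intg : (\int[m]_x g x <= B%:E)%E.
  rewrite integral_nneseries//; apply: lime_le.
    by apply: is_cvg_nneseries => n _ _; apply: integral_ge0.
  apply: nearW => n; rewrite big_mkord.
  have -> : (\sum_(k < n) \int[m]_x `|v k x|%:E)%E = (\sum_(k < n) \int[m]_x `|v k x|)%:E.
    rewrite -sumEFin; apply: eq_bigr => k _; rewrite fineK//.
    by apply: integrable_fin_num => //; exact: integrable_abse (vi k).
  by rewrite lee_fin.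
have gi : m.-integrable setT g.
  apply/integrableP; split => //.
  under eq_integral do rewrite gee0_abs//.
  by apply: le_lt_trans intg _; rewrite ltry.
pose A := [set x | (g x < +oo)%E].
have mA : measurable A.
  by rewrite -[A]setTI; exact: emeasurable_fun_infty_o.
have cvgA x : A x -> cvgn (fun n => \sum_(k < n) v k x).
  move=> Ax; have : cvgn [normed series (fun k => v k x)].
    apply: nondecreasing_is_cvgn.
      by apply: nondecreasing_series => n _ _; exact: normr_ge0.
    exists (fine (g x)) => _ [n _ <-].
    rewrite -lee_fin fineK; last by rewrite ge0_fin_numE.
    rewrite /series/= -sumEFin; apply: nneseries_lim_ge => // k _.
  move/normed_cvg; rewrite /series/=.
  by under eq_fun do rewrite big_mkord.
(* Cutting off by A makes the sequence converge everywhere, which gives the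
   measurability of the limit. *)
pose f x := lim ((\1_A x * \sum_(k < n) v k x) @[n --> \oo]).
have cvf x : (\1_A x * \sum_(k < n) v k x) @[n --> \oo] --> f x.
  rewrite /f; have [Ax|nAx] := pselect (A x).
    by apply: is_cvgMr; exact: cvgA.
  have -> : (fun n => \1_A x * \sum_(k < n) v k x) = fun=> 0.
    by apply: funext => n; rewrite indicE memNset// mul0r.
  exact: is_cvg_cst.
have mS n : measurable_fun setT (fun x => \sum_(k < n) v k x).
  apply: measurable_sum => k; exact/measurable_EFinP/(measurable_int m (vi k)).
have mf : measurable_fun setT f.
  apply: (measurable_fun_cvg (h := fun n x => \1_A x * \sum_(k < n) v k x)) => // n.
  apply: measurable_funM => //; exact: measurable_indic.
have aeA : {ae m, forall x, A x}.
  have := integrable_ae measurableT gi.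
  by apply: filterS => x /(_ I); rewrite ge0_fin_numE.
have [] := @dominated_convergence _ _ _ m setT measurableT
  (fun n x => (\sum_(k < n) v k x)%:E) (EFin \o f) g.
- by move=> n; exact/measurable_EFinP.
- exact/measurable_EFinP.
- apply: filterS aeA => x Ax _; apply: cvg_EFin; first exact: nearW.
  have := cvf x; apply: cvg_trans; apply: near_eq_cvg; apply: nearW => n /=.
  by rewrite indicE mem_set// mul1r.
- exact: gi.
- apply: filterS aeA => x Ax n _; rewrite abse_EFin.
  apply: (@le_trans _ _ (\sum_(0 <= k < n) `|v k x|%:E)%E).
    by rewrite sumEFin lee_fin big_mkord ler_norm_sum.
  by apply: nneseries_lim_ge.
move=> fi cv _; exists f => //.
have := fine_cvg (f := fun n => (\int[m]_x `|(\sum_(k < n) v k x)%:E - (EFin \o f) x|)%E) (a := 0).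
move=> /(_ _ _ cv); apply: cvg_trans; apply: near_eq_cvg; apply: nearW => n /=.
rewrite /Rintegral; congr fine; apply: eq_integral => x _ /=.
by rewrite distrC.
Qed.

Lemma L1_series (u : nat -> T -> R[i]) (B : R) :
  (forall k, integrableC m (u k)) ->
  (forall n, \sum_(k < n) \int[m]_x normc (u k x) <= B) ->
  exists2 f, integrableC m f & forall e : R, 0 < e ->
    exists N, forall n, (N <= n)%N ->
      \int[m]_x normc (f x - \sum_(k < n) u k x) <= e.
Proof.
move=> ui uB.
have [] := @L1_series_real (fun k x => complex.Re (u k x)) B.
- by move=> k; exact: (ui k).1.
- move=> n; apply: le_trans (uB n); apply: ler_sum => k _; apply: le_Rintegral => //.
  + have := integrable_norm (ui k).1; by apply: eq_integrable.
  + exact: integrableC_norm.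
  + by move=> x _; exact: ler_norm_Re.
move=> f1 if1 cf1.
have [] := @L1_series_real (fun k x => complex.Im (u k x)) B.
- by move=> k; exact: (ui k).2.
- move=> n; apply: le_trans (uB n); apply: ler_sum => k _; apply: le_Rintegral => //.
  + have := integrable_norm (ui k).2; by apply: eq_integrable.
  + exact: integrableC_norm.
  + by move=> x _; exact: ler_norm_Im.
move=> f2 if2 cf2.
have fi : integrableC m (fun x => f1 x +i* f2 x) by split.
exists (fun x => f1 x +i* f2 x) => // e e0.
have e2 : 0 < e / 2 by lra.
have /cvgr0_norm_le /(_ _ e2) [N1 _ h1] := cf1.
have /cvgr0_norm_le /(_ _ e2) [N2 _ h2] := cf2.
exists (maxn N1 N2) => n; rewrite geq_max => /andP[n1 n2].
have Si : integrableC m (fun x => \sum_(k < n) u k x) by exact: integrableC_sum.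
have di := integrableCB fi Si.
have {}h1 := h1 n n1; have {}h2 := h2 n n2.
have a1 : m.-integrable setT (EFin \o (fun x => `|f1 x - \sum_(k < n) complex.Re (u k x)|)).
  have := integrable_norm di.1; apply: eq_integrable => // x _ /=.
  by rewrite Re_sub Re_sum.
have a2 : m.-integrable setT (EFin \o (fun x => `|f2 x - \sum_(k < n) complex.Im (u k x)|)).
  have := integrable_norm di.2; apply: eq_integrable => // x _ /=.
  by rewrite Im_sub Im_sum.
apply: (@le_trans _ _ (\int[m]_x (`|f1 x - \sum_(k < n) complex.Re (u k x)| +
    `|f2 x - \sum_(k < n) complex.Im (u k x)|))).
  apply: le_Rintegral => //; first exact: integrableC_norm.
    by have := integrableD measurableT a1 a2; apply: eq_integrable.
  by move=> x _; rewrite -Re_sum -Im_sum; apply: le_trans (normc_le_ReIm _) _; rewrite Re_sub Im_sub.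
rewrite RintegralD//.
have := ler_norm (\int[m]_x `|f1 x - \sum_(k < n) complex.Re (u k x)|).
have := ler_norm (\int[m]_x `|f2 x - \sum_(k < n) complex.Im (u k x)|).
lra.
Qed.

End L1_completeness.

(** * Complex measures and their total variation *)

Section complex_charge_of_real_charges.
Context d (T : measurableType d) (R : realType).
Variables nu1 nu2 : {charge set T -> \bar R}.

Definition charge_pair (A : set T) : \bar R[i] :=
  (fine (nu1 A) +i* fine (nu2 A))%:E.

Let charge_pair_sum (F : (set T)^nat) n :
  (\sum_(i < n) charge_pair (F i))%E =
  ((\sum_(i < n) fine (nu1 (F i))) +i* (\sum_(i < n) fine (nu2 (F i))))%:E.
Proof.
rewrite sumEFin; congr EFin; apply: complex_eq; rewrite /= ?Re_sum ?Im_sum//.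
Qed.

Let charge_pair_fin : fin_num_fun charge_pair.
Proof. by []. Qed.

HB.instance Definition _ := isFinite.Build _ _ _ charge_pair charge_pair_fin.

Let charge_pair_semi_additive : measure_function.semi_additive charge_pair.
Proof.
move=> F n mF tF mUF.
have E (nu : {charge set T -> \bar R}) :
    fine (nu (\big[setU/set0]_(i < n) F i)) = \sum_(i < n) fine (nu (F i)).
  by rewrite charge_semi_additive// sum_fine// => i _; exact: fin_num_measure.
by rewrite charge_pair_sum /charge_pair !E.
Qed.

HB.instance Definition _ :=
  isAdditiveCharge.Build _ _ _ charge_pair charge_pair_semi_additive.

Let charge_pair_sigma_additive : semi_sigma_additive charge_pair.
Proof.
move=> F mF tF mUF.
have fc (nu : {charge set T -> \bar R}) :
    (\sum_(i < n) fine (nu (F i))) @[n --> \oo] --> fine (nu (\bigcup_n F n)).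
  have := @charge_semi_sigma_additive _ _ _ nu F mF tF mUF.
  rewrite -[X in _ --> X -> _]fineK; last exact: fin_num_measure.
  move=> /fine_cvg; apply: cvg_trans; apply: near_eq_cvg.
  near=> n => /=; rewrite big_mkord sum_fine// => i _; exact: fin_num_measure.
apply: cvg_EFin.
  by apply: nearW => n; rewrite big_mkord charge_pair_sum.
under eq_fun do rewrite /= big_mkord charge_pair_sum /=.
apply/(@cvgrPdist_lt _ R[i]) => -[e e'] ee0.
have [e'0 e0] : e' = 0 /\ 0 < e.
  by move: ee0; rewrite ltcE/= => /andP[/eqP].
rewrite {}e'0 {e' ee0}; near=> n; rewrite norm_complexE ltcR.
apply: le_lt_trans (normc_le_ReIm _) _; rewrite Re_sub Im_sub /=.
rewrite (splitr e) ltrD//; near: n; apply: cvgr_dist_lt; rewrite ?divr_gt0//; exact: fc.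
Unshelve. all: by end_near. Qed.

HB.instance Definition _ :=
  isSemiSigmaAdditive.Build _ _ _ charge_pair charge_pair_sigma_additive.

End complex_charge_of_real_charges.

(** A finite tagged partition is a measurable classifier r with values below N,
    with a tag y i for each class; classes may be empty. *)
Section riemann_sums.
Context d (T : measurableType d) (R : realType).
Implicit Types (phi : T -> R[i]) (r : T -> nat) (y : nat -> T) (N : nat).

Definition cell r (i : nat) : set T := [set z | r z = i].

Definition classifier N r := (forall i, measurable (cell r i)) /\ forall z, (r z < N)%N.

Definition osc_le phi r y (eta : R) := forall z, normc (phi z - phi (y (r z))) <= eta.

Definition step_fun phi r y N : T -> R[i] :=
  fun z => \sum_(i < N) phi (y i) * (\1_(cell r i) z)%:C.

Lemma step_funE phi r y N z : classifier N r -> step_fun phi r y N z = phi (y (r z)).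
Proof.
move=> [_ rN]; rewrite /step_fun (bigD1 (Ordinal (rN z)))//= big1 ?addr0.
  by rewrite indicE mem_set// mulr1.
by move=> i /eqP ir; rewrite indicE memNset ?mulr0// => h; apply: ir; exact: val_inj.
Qed.

Variable m : {finite_measure set T -> \bar R}.

Lemma integrableC_indic (A : set T) : measurable A -> integrableC m (fun z => (\1_A z)%:C).
Proof.
move=> mA; split; first by apply: integrable_indic.
exact: finite_measure_integrable_cst.
Qed.

Lemma integralC_indic (A : set T) : measurable A ->
  integralC m (fun z => (\1_A z)%:C) = (fine (m A))%:C.
Proof.
move=> mA; apply: complex_eq => /=; last by rewrite Rintegral_cst// mul0r.
by rewrite /Rintegral integral_indic// setIT.
Qed.

Lemma integrableC_step phi r y N : classifier N r -> integrableC m (step_fun phi r y N).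
Proof.
move=> [mr _]; apply: integrableC_sum => i; apply: integrableCZ.
exact: integrableC_indic.
Qed.

Lemma integralC_step phi r y N : classifier N r ->
  integralC m (step_fun phi r y N) = \sum_(i < N) phi (y i) * (fine (m (cell r i)))%:C.
Proof.
move=> [mr rN]; rewrite integralC_sum; last first.
  by move=> i; apply: integrableCZ; exact: integrableC_indic.
apply: eq_bigr => i _; rewrite integralCZ ?integralC_indic//.
exact: integrableC_indic.
Qed.

Lemma osc_le_integrable phi r y N eta : cmeasurable phi -> classifier N r ->
  osc_le phi r y eta -> integrableC m phi.
Proof.
move=> mphi cr osc.
apply: (@integrableC_bounded _ _ _ m _ (eta + \sum_(i < N) normc (phi (y i)))) => // z.
have := le_normc_diff (phi z) (phi (y (r z))).
have h : normc (phi (y (r z))) <= \sum_(i < N) normc (phi (y i)).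
  have [_ rN] := cr; rewrite (bigD1 (Ordinal (rN z)))//= lerDl sumr_ge0// => i _.
  exact: normc_ge0.
have := osc z; lra.
Qed.

Lemma riemann_sum_measure phi r y N eta : cmeasurable phi -> classifier N r ->
  osc_le phi r y eta ->
  normc (integralC m phi - \sum_(i < N) phi (y i) * (fine (m (cell r i)))%:C)
    <= eta * fine (m setT).
Proof.
move=> mphi cr osc; have iphi := osc_le_integrable mphi cr osc.
have istep := integrableC_step phi y cr.
rewrite -(integralC_step phi y cr) -integralCB//.
apply: le_trans (normc_integralC_le _) _; first exact: integrableCB.
rewrite -Rintegral_cst//; apply: le_Rintegral => //.
- exact/integrableC_norm/integrableCB.
- exact: finite_measure_integrable_cst.
- by move=> z _; rewrite (step_funE phi y z cr).
Qed.

End riemann_sums.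

Section complex_measure_riemann.
Context d (T : measurableType d) (R : realType).
Implicit Types (mu : {charge set T -> \bar R[i]}) (nu : {charge set T -> \bar R}).
Implicit Types (phi : T -> R[i]) (r : T -> nat) (y : nat -> T) (N : nat).

(** The integral against a signed measure is the difference of two integrals
    against finite measures whose difference is that signed measure. *)
Lemma integral_charge_jordan nu : exists m1 m2 : {finite_measure set T -> \bar R},
  (forall A, measurable A -> fine (nu A) = fine (m1 A) - fine (m2 A)) /\
  (forall phi, integral_charge nu phi = integralC m1 phi - integralC m2 phi).
Proof.
pose nuPN := projT2 (cid (projT2 (cid (Hahn_decomposition nu)))).
exists (jordan_pos nuPN), (jordan_neg nuPN); split => // A mA.
rewrite {1}(jordan_decomp nuPN mA) /cadd/= /cscale fineD//; last 2 first.
- exact: (fin_num_measure (jordan_pos nuPN)).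
- by rewrite mulN1e fin_numN; exact: (fin_num_measure (jordan_neg nuPN)).
by rewrite mulN1e fineN.
Qed.

(** C is the total mass of the four positive measures of the Jordan decompositions
    of the real and imaginary parts. *)
Lemma complex_measure_masses mu : exists2 C : R, 0 <= C &
  (forall N r y phi eta, cmeasurable phi -> classifier N r -> osc_le phi r y eta ->
   normc (integral_complex_measure mu phi -
     \sum_(i < N) phi (y i) * fine (mu (cell r i))) <= C * eta) /\
  (forall F : (set T)^nat, (forall i, measurable (F i)) -> trivIset setT F ->
   forall n, \sum_(i < n) normc (fine (mu (F i))) <= C).
Proof.
have [a1 [a2 [aE aI]]] := integral_charge_jordan (charge_Re mu).
have [b1 [b2 [bE bI]]] := integral_charge_jordan (charge_Im mu).
have m0 (m : {finite_measure set T -> \bar R}) A : 0 <= fine (m A) by rewrite fine_ge0.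
exists (fine (a1 setT) + fine (a2 setT) + fine (b1 setT) + fine (b2 setT)).
  by rewrite !addr_ge0.
have muE A : measurable A -> fine (mu A) =
    (fine (a1 A))%:C - (fine (a2 A))%:C + 'i%C * ((fine (b1 A))%:C - (fine (b2 A))%:C).
  move=> mA; have := aE _ mA; have := bE _ mA; rewrite /charge_Re /charge_Im /=.
  by move=> h1 h2; apply: complex_eq; rewrite /= ?h1 ?h2; ring.
split=> [N r y phi eta mphi cr osc|F mF tF n].
  rewrite /integral_complex_measure aI bI.
  have A1 := riemann_sum_measure a1 mphi cr osc.
  have A2 := riemann_sum_measure a2 mphi cr osc.
  have B1 := riemann_sum_measure b1 mphi cr osc.
  have B2 := riemann_sum_measure b2 mphi cr osc.
  have -> : \sum_(i < N) phi (y i) * fine (mu (cell r i)) =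
      \sum_(i < N) phi (y i) * (fine (a1 (cell r i)))%:C
    - \sum_(i < N) phi (y i) * (fine (a2 (cell r i)))%:C
    + 'i%C * (\sum_(i < N) phi (y i) * (fine (b1 (cell r i)))%:C
    - \sum_(i < N) phi (y i) * (fine (b2 (cell r i)))%:C).
    rewrite -!sumrB mulr_sumr -big_split/=; apply: eq_bigr => i _.
    by rewrite muE; [ring|exact: cr.1].
  move: A1 A2 B1 B2.
  set I1 := integralC a1 phi; set I2 := integralC a2 phi.
  set I3 := integralC b1 phi; set I4 := integralC b2 phi.
  set S1 := \sum_(i < N) _; set S2 := \sum_(i < N) _.
  set S3 := \sum_(i < N) _; set S4 := \sum_(i < N) _ => A1 A2 B1 B2.
  have -> : I1 - I2 + 'i%C * (I3 - I4) - (S1 - S2 + 'i%C * (S3 - S4)) =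
    ((I1 - S1) - (I2 - S2)) + 'i%C * ((I3 - S3) - (I4 - S4)) by ring.
  apply: le_trans (le_normcD _ _) _; rewrite normc_iM.
  have := le_normcB (I1 - S1) (I2 - S2).
  have := le_normcB (I3 - S3) (I4 - S4).
  lra.
have massE (m : {finite_measure set T -> \bar R}) : \sum_(i < n) fine (m (F i)) <= fine (m setT).
  rewrite -lee_fin fineK; last exact: fin_num_measure.
  rewrite -sumEFin; under eq_bigr => i _ do rewrite fineK ?fin_num_measure//.
  rewrite -(@measure_bigsetU _ _ _ m)//.
  by apply: le_measure; rewrite ?inE//; exact: bigsetU_measurable.
apply: (@le_trans _ _ (\sum_(i < n) (fine (a1 (F i)) + fine (a2 (F i)) + fine (b1 (F i)) + fine (b2 (F i))))).
  apply: ler_sum => i _; rewrite muE//.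
  apply: le_trans (le_normcD _ _) _; rewrite normc_iM.
  have := le_normcB (fine (a1 (F i)))%:C (fine (a2 (F i)))%:C.
  have := le_normcB (fine (b1 (F i)))%:C (fine (b2 (F i)))%:C.
  by rewrite !normc_real !ger0_norm//; lra.
by rewrite !big_split/=; do ! apply: lerD.
Qed.

Lemma total_variation_fin mu : Defs.total_variation mu \is a fin_num.
Proof.
have [C C0 [_ hC]] := complex_measure_masses mu.
rewrite ge0_fin_numE.
  apply: (@le_lt_trans _ _ C%:E); last by rewrite ltry.
  apply: ge_ereal_sup => _ [F [mF tF _]] <-.
  apply: lime_le; first by apply: is_cvg_nneseries => n _ _; rewrite lee_fin normc_ge0.
  by apply: nearW => n; rewrite sumEFin lee_fin big_mkord hC.
apply: (@le_trans _ _ (\sum_(0 <= i <oo) (normc (fine (mu (if i is 0%N then setT else set0))))%:E)%E).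
  by apply: nneseries_ge0 => n _ _; rewrite lee_fin normc_ge0.
apply: ereal_sup_ubound; exists (fun i => if i is 0%N then setT else set0) => //; split.
- by case.
- by apply/trivIsetP => -[|i] [|j] _ _ //= _; rewrite ?setI0 ?set0I.
- by apply/seteqP; split => // z _; exists 0%N.
Qed.

Definition var_norm mu : R := fine (Defs.total_variation mu).

Lemma var_norm_le mu (C : R) :
  (forall F : (set T)^nat, (forall i, measurable (F i)) -> trivIset setT F ->
   forall n, \sum_(i < n) normc (fine (mu (F i))) <= C) -> var_norm mu <= C.
Proof.
move=> hC; rewrite -lee_fin fineK ?total_variation_fin//.
apply: ge_ereal_sup => _ [F [mF tF _]] <-.
apply: lime_le; first by apply: is_cvg_nneseries => n _ _; rewrite lee_fin normc_ge0.
by apply: nearW => n; rewrite sumEFin lee_fin big_mkord hC.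
Qed.

(** A disjoint family becomes a partition by adding its complement. *)
Lemma var_norm_sum_le mu (F : (set T)^nat) n : (forall i, measurable (F i)) ->
  trivIset setT F -> \sum_(i < n) normc (fine (mu (F i))) <= var_norm mu.
Proof.
move=> mF tF; pose G i := if i is k.+1 then F k else ~` \bigcup_k F k.
have mG i : measurable (G i) by case: i => [|i] //=; apply: measurableC; exact: bigcup_measurable.
have tG : trivIset setT G.
  apply/trivIsetP => -[|i] [|j] _ _ //= ij.
  - by apply/seteqP; split => // z [/= nz Fz]; apply: nz; exists j.
  - by apply/seteqP; split => // z [/= Fz nz]; apply: nz; exists i.
  - by move/trivIsetP: tF; apply.
rewrite -lee_fin fineK ?total_variation_fin//.
apply: (@le_trans _ _ (\sum_(0 <= i <oo) (normc (fine (mu (G i))))%:E)%E).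
  apply: (@le_trans _ _ (\sum_(0 <= i < n.+1) (normc (fine (mu (G i))))%:E)%E).
    by rewrite big_nat_recl//= big_mkord sumEFin -EFinD lee_fin lerDr normc_ge0.
  by apply: nneseries_lim_ge => k _ _; rewrite lee_fin normc_ge0.
apply: ereal_sup_ubound; exists G => //; split => //.
apply/seteqP; split => // z _; have [[k _ Fz]|nF] := pselect ((\bigcup_k F k) z).
  by exists k.+1.
by exists 0%N.
Qed.

Lemma var_norm_partition mu N r : classifier N r ->
  \sum_(i < N) normc (fine (mu (cell r i))) <= var_norm mu.
Proof.
move=> [mr _]; apply: var_norm_sum_le => //.
by apply/trivIsetP => i j _ _ ij; apply/seteqP; split => // z [e1 e2]; move: ij; rewrite -e1 -e2 eqxx.
Qed.

Lemma var_norm_ge0 mu : 0 <= var_norm mu.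
Proof.
apply: le_trans (@var_norm_sum_le mu (fun=> set0) 0 _ _) => //; first by rewrite big_ord0.
by apply/trivIsetP => i j _ _ _; rewrite set0I.
Qed.

End complex_measure_riemann.

(** * Characters of the circle *)

Section circle_functions.
Variable R : realType.
Implicit Types (z : circle R) (n j : int).

Lemma normc_circle_val z : normc (circle_val z) = 1.
Proof. by have := set_valP (z : circle_top R); rewrite /unit_circle/= => -[]. Qed.

Lemma circle_val_neq0 z : circle_val z != 0.
Proof. by rewrite -normc_gt0 normc_circle_val. Qed.

Lemma normc_circle_pow n z : normc (circle_pow n z) = 1.
Proof.
rewrite /circle_pow; case: n => n; rewrite ?NegzE ?exprnN /exprz ?normcV normcX normc_circle_val expr1n//.
by rewrite invr1.
Qed.

Lemma circle_powD n j z : circle_pow (n + j) z = circle_pow n z * circle_pow j z.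
Proof. by rewrite /circle_pow expfzDr// circle_val_neq0. Qed.

Lemma circle_pow0 z : circle_pow 0 z = 1.
Proof. by []. Qed.

Lemma conjc_unit (x : R[i]) : normc x = 1 -> conjc x = x^-1.
Proof.
case: x => a b h; have := congr1 (fun u => u ^+ 2) h; rewrite sqr_normcE/= expr1n => {}h.
have x0 : (a +i* b) != 0 by apply/eqP => -[a0 b0]; move: h; rewrite a0 b0 !expr0n addr0 => /eqP; rewrite eq_sym oner_eq0.
apply: (mulfI x0); rewrite divff//; apply: complex_eq => /=; last by ring.
by rewrite -h; ring.
Qed.

Lemma conjc_circle_pow n z : conjc (circle_pow n z) = circle_pow (- n) z.
Proof. by rewrite conjc_unit ?normc_circle_pow// /circle_pow invr_expz. Qed.

Lemma measurable_circle_real (g : R[i] -> R) : continuous g ->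
  measurable_fun setT (fun z : circle R => g (circle_val z)).
Proof.
move=> cg; apply: (measurability _ (RGenOpens.measurableE R)) => _ [_ [x [y ->]] <-].
rewrite setTI; apply: sub_sigma_algebra.
rewrite -/(open _).
have oV : open (g @^-1` `]x, y[%classic).
  by apply: (continuousP g).1 => //; exact: interval_open.
by exists (g @^-1` `]x, y[%classic).
Qed.

Lemma cmeasurable_circle_val : cmeasurable (@circle_val R).
Proof.
by split; apply: measurable_circle_real; [exact: continuous_Re|exact: continuous_Im].
Qed.

Lemma Re_conjc (x : R[i]) : complex.Re (conjc x) = complex.Re x.
Proof. by case: x. Qed.

Lemma Im_conjc (x : R[i]) : complex.Im (conjc x) = - complex.Im x.
Proof. by case: x. Qed.

Lemma cmeasurable_conj d (T : measurableType d) (f : T -> R[i]) : cmeasurable f ->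
  cmeasurable (fun x => conjc (f x)).
Proof.
move=> [f1 f2]; split; first by under eq_fun do rewrite Re_conjc.
by under eq_fun do rewrite Im_conjc; exact: measurable_funN.
Qed.

Lemma cmeasurable_circle_pow n : cmeasurable (@circle_pow R n).
Proof.
have H (k : nat) : cmeasurable (@circle_pow R k).
  elim: k => [|k IH]; first exact: cmeasurable_cst.
  rewrite (_ : circle_pow _ = fun z => circle_val z * circle_pow k z).
    by apply: cmeasurableM => //; exact: cmeasurable_circle_val.
  by apply: funext => z; rewrite /circle_pow /exprz exprS.
case: n => n; first exact: H.
rewrite (_ : circle_pow _ = fun z => conjc (circle_pow n.+1%:Z z)).
  exact/cmeasurable_conj/H.
by apply: funext => z; rewrite conjc_circle_pow NegzE.
Qed.

Lemma integrableC_circle_pow (m : {finite_measure set (circle R) -> \bar R}) n :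
  integrableC m (@circle_pow R n).
Proof.
apply: (@integrableC_bounded _ _ _ m _ 1); first exact: cmeasurable_circle_pow.
by move=> z; rewrite normc_circle_pow.
Qed.

Lemma circle_pow_cis n (t : R) : circle_pow n (cis t) = cexp (0 +i* (n%:~R * t)).
Proof.
have H (k : nat) : circle_pow k (cis t) = cexp (0 +i* (k%:~R * t)).
  elim: k => [|k IH].
    by rewrite mul0r (_ : 0 +i* 0 = 0)// cexp0.
  rewrite /circle_pow /exprz exprS -/(exprz _ k) -/(circle_pow k _) IH.
  rewrite (_ : circle_val (cis t) = cexp (0 +i* t)); last first.
    by rewrite /cexp /= expR0 !mul1r.
  rewrite -cexpD; congr cexp; apply: complex_eq => /=; first by ring.
  by rewrite -addn1 PoszD intrD; ring.
case: n => n; first exact: H.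
rewrite NegzE -conjc_circle_pow H.
by rewrite /cexp /= !expR0 !mul1r mulrNz mulNr cosN sinN.
Qed.

(** The uniform law on [0, 2 pi] is pushed to the circle by cis; the fundamental
    theorem of calculus evaluates the integral of f from its primitive F. *)
Lemma integral_haar_trig (f F : R -> R) (g : circle R -> R) :
  measurable_fun setT g -> (forall t, g (cis t) = f t) ->
  (forall t, `|f t| <= 1) -> (forall t : R, is_derive t 1 F (f t)) ->
  continuous f ->
  \int[@haar R]_z g z = (pi *+ 2)^-1 * (F (pi *+ 2) - F 0).
Proof.
move=> mg gf f1 dF cf.
have p0 := pi2_gt0 R.
have mf : measurable_fun setT f by exact: continuous_measurable_fun.
have fi : (uniform_prob p0).-integrable setT (EFin \o f).
  apply: measurable_bounded_integrable => //.
    by apply: le_lt_trans (probability_le1 _ measurableT) _; rewrite ltry.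
  by exists 1; split; [exact: num_real|move=> x x1 z _; exact: le_trans (f1 z) (ltW x1)].
have -> : \int[@haar R]_z g z = \int[uniform_prob p0]_t f t.
  rewrite /Rintegral /haar integral_distribution//.
  - by congr fine; apply: eq_integral => t _ /=; rewrite gf.
  - exact/measurable_EFinP.
  - by apply: eq_integrable fi => // t _ /=; rewrite gf.
(* Adding 1 makes the integrand nonnegative. *)
have -> : \int[uniform_prob p0]_t f t = \int[uniform_prob p0]_t (f t + 1) - 1.
  rewrite RintegralD//; last exact: finite_measure_integrable_cst.
  rewrite Rintegral_cst// [X in 1 * X](_ : _ = 1); first by rewrite mulr1 addrK.
  exact: (congr1 fine (@probability_setT _ _ _ (uniform_prob p0))).
have -> : \int[uniform_prob p0]_t (f t + 1) = (pi *+ 2)^-1 * (F (pi *+ 2) + pi *+ 2 - (F 0 + 0)).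
  rewrite /Rintegral integral_uniform; last 2 first.
  - by apply/measurable_EFinP; apply: measurable_funD.
  - by move=> t; rewrite lee_fin; have := f1 t; rewrite ler_norml; lra.
  have D (t : R) : is_derive t 1 (fun u => F u + u) (f t + 1) by have := dF t; move=> ?; apply: is_deriveD.
  have C : continuous (fun u => F u + u).
    move=> t; apply: differentiable_continuous; apply/derivable1_diffP.
    by have [] := D t.
  rewrite (@continuous_FTC2 _ (fun t => f t + 1) (fun u => F u + u))//=.
  - by rewrite subr0.
  - by apply: continuous_subspaceT => t; apply: cvgD; [exact: cf|exact: cvg_cst].
  - split => [t _| |]; first by have [] := D t.
      by apply: cvg_at_right_filter; exact: C.
    by apply: cvg_at_left_filter; exact: C.
  - by move=> t _; rewrite derive1E; have [_ ->] := D t.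
move: (lt0r_neq0 p0); move: (pi *+ 2 : R) => q q0; field; exact: q0.
Qed.

Lemma integral_circle_pow n : integralC (@haar R) (circle_pow n) = (n == 0)%:R.
Proof.
have [->|n0] := eqVneq n 0.
  rewrite (_ : circle_pow 0 = fun=> 1); last by apply: funext => z.
  rewrite (integralC_cst (@haar R)) mul1r.
  exact: (congr1 (fun x => (fine x)%:C) (@probability_setT _ _ _ (@haar R))).
have nR : n%:~R != 0 :> R by rewrite intr_eq0.
have [mRe mIm] := cmeasurable_circle_pow n.
have per : sin (n%:~R * (pi *+ 2)) = 0 :> R /\ cos (n%:~R * (pi *+ 2)) = 1 :> R.
  have H (k : nat) : cexp (0 +i* (k%:~R * (pi *+ 2))) = 1 :> R[i].
    rewrite -circle_pow_cis /circle_pow /exprz (_ : circle_val _ = 1) ?expr1n//.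
    by apply: complex_eq; rewrite /= ?cos2pi ?sin2pi.
  have H' (k : nat) : sin (k%:~R * (pi *+ 2)) = 0 :> R /\ cos (k%:~R * (pi *+ 2)) = 1 :> R.
    by have := H k; rewrite /cexp/= expR0 !mul1r => -[-> ->].
  case: n {n0 nR mRe mIm} => n; first exact: H'.
  by rewrite NegzE mulrNz mulNr sinN cosN; have [-> ->] := H' n.+1; rewrite oppr0.
have D (t : R) : is_derive t 1 (fun u : R => n%:~R * u) n%:~R.
  apply: eps_is_derive => e e0; exists 1 => // h _.
  have -> : n%:~R * (t + h) - n%:~R * t - n%:~R * h = 0 by ring.
  by rewrite normr0 mulr_ge0// ltW.
have L : continuous (fun u : R => n%:~R * u) by exact: mulrl_continuous.
have E (t : R) : circle_pow n (cis t) = cos (n%:~R * t) +i* sin (n%:~R * t).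
  by rewrite circle_pow_cis /cexp /= expR0 !mul1r.
apply: complex_eq => /=.
  have dF (t : R) : is_derive t 1 (fun t => n%:~R^-1 * sin (n%:~R * t)) (cos (n%:~R * t)).
    apply: is_derive_eq. by rewrite /GRing.scale/=; field.
  rewrite (integral_haar_trig mRe _ _ dF).
  - by rewrite /= per.1 !mulr0 sin0 mulr0 subrr mulr0.
  - by move=> t; rewrite E.
  - by move=> t; rewrite ler_norml cos_geN1 cos_le1.
  - move=> t; apply: (continuous_comp (L t)); exact: continuous_cos.
have dF (t : R) : is_derive t 1 (fun t => - (n%:~R^-1 * cos (n%:~R * t))) (sin (n%:~R * t)).
  apply: is_derive_eq. by rewrite /GRing.scale/=; field.
rewrite (integral_haar_trig mIm _ _ dF).
- by rewrite /= per.2 !mulr0 cos0 subrr mulr0.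
- by move=> t; rewrite E.
- by move=> t; rewrite ler_norml sin_geN1 sin_le1.
- move=> t; apply: (continuous_comp (L t)); exact: continuous_sin.
Qed.

End circle_functions.

(** * Fine partitions of the circle *)

Section circle_partition.
Variable R : realType.

Let grid (K : nat) (x : R) : nat := Num.truncn (K%:R * (x + 1)).

Let grid_itv K (x : R) : -1 <= x -> (grid K x)%:R <= K%:R * (x + 1) < (grid K x).+1%:R.
Proof. by move=> x1; apply: truncn_itv; rewrite mulr_ge0//; lra. Qed.

Let grid_le K (x : R) : -1 <= x <= 1 -> (grid K x <= 2 * K)%N.
Proof.
move=> /andP[x1 x2]; rewrite -(ler_nat R); have /andP[h _] := grid_itv K x1.
apply: le_trans h _; rewrite natrM mulrC ler_wpM2r//; lra.
Qed.

Let grid_eq K (x y : R) : (0 < K)%N -> -1 <= x -> -1 <= y -> grid K x = grid K y ->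
  `|x - y| <= K%:R^-1.
Proof.
move=> K0 x1 y1 e; have := grid_itv K x1; have := grid_itv K y1.
rewrite -e -natr1 => /andP[a1 a2] /andP[b1 b2].
have K0' : 0 < K%:R :> R by rewrite ltr0n.
rewrite -[X in _ <= X]mul1r ler_pdivlMr//.
have -> : `|x - y| * K%:R = `|K%:R * (x + 1) - K%:R * (y + 1)|.
  by rewrite -mulrBr normrM (ger0_norm (ltW K0')) mulrC; congr (_ * `|_|); ring.
by rewrite ler_norml; lra.
Qed.

Let measurable_grid K k (g : circle R -> R) : (0 < K)%N -> measurable_fun setT g ->
  (forall z, -1 <= g z) -> measurable [set z | grid K (g z) = k].
Proof.
move=> K0 mg g1; have K0' : 0 < K%:R :> R by rewrite ltr0n.
rewrite (_ : [set z | _] = g @^-1` `[k%:R / K%:R - 1, k.+1%:R / K%:R - 1[%classic).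
  by rewrite -[X in measurable X]setTI; apply: mg.
apply/seteqP; split => z /=; rewrite in_itv/=.
  move=> <-; have /andP[a1 a2] := grid_itv K (g1 z).
  by rewrite lerBlDr ler_pdivrMr// ltrBrDr ltr_pdivlMr// [_ * K%:R]mulrC a1.
rewrite lerBlDr ler_pdivrMr// ltrBrDr ltr_pdivlMr// [_ * K%:R]mulrC => h.
by apply/eqP; rewrite truncn_eq//; have /andP[h1 _] := h; apply: le_trans h1.
Qed.

Let circle_range (z : circle R) : -1 <= complex.Re (circle_val z) <= 1 /\
  -1 <= complex.Im (circle_val z) <= 1.
Proof.
have := ler_norm_Re (circle_val z); have := ler_norm_Im (circle_val z).
by rewrite normc_circle_val !ler_norml.
Qed.

(** The classes are the traces on the circle of the squares of side 1 / K, numbered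
    row by row; the tag of an empty class is arbitrary. *)
Lemma circle_partition (eta : R) : 0 < eta -> exists N r y,
  classifier N r /\
  forall z : circle R, normc (circle_val z - circle_val (y (r z))) <= eta.
Proof.
move=> eta0; pose K := (Num.truncn (2 / eta)).+1.
have K0 : (0 < K)%N by [].
have K0' : 0 < K%:R :> R by rewrite ltr0n.
have hK : 2 * K%:R^-1 <= eta.
  rewrite ler_pdivrMr// mulrC -ler_pdivrMr//; apply/ltW/truncnS_gt.
pose B := (2 * K).+1.
pose c1 (z : circle R) := grid K (complex.Re (circle_val z)).
pose c2 (z : circle R) := grid K (complex.Im (circle_val z)).
have c1B z : (c1 z < B)%N by rewrite ltnS grid_le//; have [] := circle_range z.
have c2B z : (c2 z < B)%N by rewrite ltnS grid_le//; have [] := circle_range z.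
pose r z := (c1 z * B + c2 z)%N.
have rE z i : r z = i <-> c1 z = (i %/ B)%N /\ c2 z = (i %% B)%N.
  split=> [<-|[h1 h2]]; last by rewrite /r h1 h2 -divn_eq.
  by rewrite /r divnMDl// modnMDl divn_small// modn_small// addn0.
pose y i : circle R := if pselect (exists z, r z = i) is left h then projT1 (cid h) else point.
exists (B * B)%N, r, y; split.
  split=> [i|z]; last first.
    by rewrite /r (leq_trans (n := (c1 z * B + B)%N)) ?ltn_add2l// -mulSnr leq_mul2r c1B orbT.
  rewrite (_ : cell r i = [set z | c1 z = (i %/ B)%N] `&` [set z | c2 z = (i %% B)%N]).
    have [m1 m2] := cmeasurable_circle_val R.
    apply: measurableI; apply: measurable_grid => // z.
      by have [/andP[]] := circle_range z.
    by have [_ /andP[]] := circle_range z.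
  by apply/seteqP; split => z /rE.
move=> z; rewrite /y; case: pselect => [h|]; last by case; exists z.
case: (cid h) => w /= /rE [w1 w2].
have [e1 e2] : c1 z = c1 w /\ c2 z = c2 w by have [-> ->] := (rE z (r z)).1 erefl.
apply: le_trans (normc_le_ReIm _) _; rewrite Re_sub Im_sub.
have [/andP[z1 _] /andP[z2 _]] := circle_range z.
have [/andP[w3 _] /andP[w4 _]] := circle_range w.
have := grid_eq K0 z1 w3 e1; have := grid_eq K0 z2 w4 e2; lra.
Qed.

Lemma circle_pow_lipschitz (n : int) (z w : circle R) :
  normc (circle_pow n z - circle_pow n w) <= `|n|%:R * normc (circle_val z - circle_val w).
Proof.
have H (k : nat) : normc (circle_pow k z - circle_pow k w) <= k%:R * normc (circle_val z - circle_val w).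
  elim: k => [|k IH]; first by rewrite subrr normc_zero mul0r.
  have E u : circle_pow k.+1%:Z u = circle_val u * circle_pow k u :> R[i].
    by rewrite /circle_pow /exprz exprS.
  rewrite !E.
  have -> : circle_val z * circle_pow k z - circle_val w * circle_pow k w =
    circle_val z * (circle_pow k z - circle_pow k w) + (circle_val z - circle_val w) * circle_pow k w by ring.
  apply: le_trans (le_normcD _ _) _.
  rewrite !normcM normc_circle_val normc_circle_pow mul1r mulr1 -natr1 mulrDl mul1r lerD2r.
  exact: IH.
case: n => n; first exact: H.
rewrite NegzE -!conjc_circle_pow -rmorphB abszN.
have -> : forall u : R[i], normc (conjc u) = normc u by case=> a b /=; rewrite sqrrN.
exact: H.
Qed.

Lemma circle_pow_osc r y (eta : R) (n : int) (M : nat) :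
  (forall z : circle R, normc (circle_val z - circle_val (y (r z))) <= eta) ->
  (`|n| <= M)%N -> osc_le (circle_pow n) r y (M%:R * eta).
Proof.
move=> h nM z; apply: le_trans (circle_pow_lipschitz _ _ _) _.
by rewrite ler_pM ?normc_ge0// ler_nat.
Qed.

End circle_partition.

(** * Fourier coefficients and Fejer sums *)

Section fourier_coefficients.
Variable R : realType.
Implicit Types (f g : circle R -> R[i]) (j n : int).
Notation haar := (@haar R).

Lemma integrableC_mul_pow f n : integrableC haar f ->
  integrableC haar (fun z => f z * circle_pow n z).
Proof.
move=> fi; apply: (@integrableC_bounded_mul _ _ _ haar _ _ 1) => //.
  exact: cmeasurable_circle_pow.
by move=> z; rewrite normc_circle_pow.
Qed.

Lemma fourier_funD f g j : integrableC haar f -> integrableC haar g ->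
  fourier_fun (fun z => f z + g z) j = fourier_fun f j + fourier_fun g j.
Proof.
move=> fi gi; rewrite /fourier_fun -integralCD; try exact: integrableC_mul_pow.
by apply: eq_integralC => z; rewrite mulrDl.
Qed.

Lemma fourier_funZ c f j : integrableC haar f ->
  fourier_fun (fun z => c * f z) j = c * fourier_fun f j.
Proof.
move=> fi; rewrite /fourier_fun -integralCZ; last exact: integrableC_mul_pow.
by apply: eq_integralC => z; rewrite mulrA.
Qed.

Lemma fourier_funB f g j : integrableC haar f -> integrableC haar g ->
  fourier_fun (fun z => f z - g z) j = fourier_fun f j - fourier_fun g j.
Proof.
move=> fi gi; rewrite /fourier_fun -integralCB; try exact: integrableC_mul_pow.
by apply: eq_integralC => z; rewrite mulrBl.
Qed.

Lemma fourier_fun_sum I (s : seq I) (F : I -> circle R -> R[i]) j :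
  (forall i, integrableC haar (F i)) ->
  fourier_fun (fun z => \sum_(i <- s) F i z) j = \sum_(i <- s) fourier_fun (F i) j.
Proof.
move=> Fi; rewrite /fourier_fun -integralC_sum; last by move=> i; exact: integrableC_mul_pow.
by apply: eq_integralC => z; rewrite mulr_suml.
Qed.

Lemma fourier_circle_pow n j : fourier_fun (@circle_pow R n) j = (n == j)%:R.
Proof.
rewrite /fourier_fun (_ : (fun z => _) = circle_pow (n - j)).
  by rewrite integral_circle_pow subr_eq0.
by apply: funext => z; rewrite circle_powD.
Qed.

Lemma normc_fourier_fun_le f j : integrableC haar f ->
  normc (fourier_fun f j) <= \int[haar]_z normc (f z).
Proof.
move=> fi; apply: le_trans (normc_integralC_le (integrableC_mul_pow _ fi)) _.
rewrite le_eqVlt; apply/orP; left; apply/eqP; apply: eq_Rintegral => z _.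
by rewrite normcM normc_circle_pow mulr1.
Qed.

Lemma haar_setT : fine (haar setT) = 1.
Proof. exact: (congr1 fine (@probability_setT _ _ _ haar)). Qed.

End fourier_coefficients.

Section fejer_kernel.
Variable R : realType.
Implicit Types (j n : int) (M N s : nat) (x : int -> R[i]).
Notation haar := (@haar R).

Definition fejer M j : R := (M - `|j|)%N%:R / M%:R.

(** For j >= 0 each a >= j occurs with exactly one b; negative j follow by exchanging
    a and b. *)
Lemma fejer_count M j :
  \sum_(a < M) \sum_(b < M) (a%:Z - b%:Z == j)%:R = (M - `|j|)%N%:R :> R.
Proof.
have H (k : nat) : \sum_(a < M) \sum_(b < M) (a%:Z - b%:Z == k)%:R = (M - k)%N%:R :> R.
  have E (a : 'I_M) : \sum_(b < M) (a%:Z - b%:Z == k)%:R = (k <= a)%N%:R :> R.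
    have [ka|ak] := leqP k a.
      have h : (a - k < M)%N by rewrite (leq_ltn_trans (leq_subr _ _)).
      rewrite (bigD1 (Ordinal h))//= big1 ?addr0.
        by rewrite subr_eq addrC -PoszD subnK// eqxx.
      move=> b /eqP bh; case: eqP => // e; exfalso; apply: bh; apply: val_inj => /=.
      by move/eqP: e; rewrite subr_eq -PoszD => /eqP [->]; rewrite addKn.
    rewrite big1// => b _; case: eqP => // /eqP; rewrite subr_eq -PoszD => /eqP[e].
    by move: ak; rewrite e ltnNge leq_addr.
  under eq_bigr do rewrite E.
  elim: (M) => [|m IH]; first by rewrite big_ord0.
  rewrite big_ord_recr/= IH -natrD; congr (_%:R).
  by case: leqP => km; lia.
case: j => k; first exact: H.
rewrite exchange_big/= -(H k.+1); apply: eq_bigr => a _; apply: eq_bigr => b _.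
by rewrite NegzE -[in RHS]eqr_opp opprB.
Qed.

(** The M-th Fejer sum of the Fourier series with coefficients x. The double sum
    displays the kernel as a product of two conjugate geometric sums. *)
Definition fejer_poly M x (z : circle R) : R[i] :=
  (M%:R^-1)%:C * \sum_(a < M) \sum_(b < M) x (a%:Z - b%:Z) * circle_pow (a%:Z - b%:Z) z.

Let fejer_term_integrable M x (a b : 'I_M) :
  integrableC haar (fun z => x (a%:Z - b%:Z) * circle_pow (a%:Z - b%:Z) z).
Proof. by apply: integrableCZ; exact: integrableC_circle_pow. Qed.

Lemma fejer_poly_integrable M x : integrableC haar (fejer_poly M x).
Proof.
apply: integrableCZ; apply: integrableC_sum => a; apply: integrableC_sum => b.
exact: fejer_term_integrable.
Qed.

Lemma fourier_fejer_poly M x j :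
  fourier_fun (fejer_poly M x) j = (fejer M j)%:C * x j.
Proof.
rewrite fourier_funZ; last first.
  apply: integrableC_sum => a; apply: integrableC_sum => b; exact: fejer_term_integrable.
rewrite fourier_fun_sum; last first.
  move=> a; apply: integrableC_sum => b; exact: fejer_term_integrable.
rewrite /fejer mulrC rmorphM/= mulrAC; congr (_ * _).
rewrite -fejer_count rmorph_sum mulr_suml; apply: eq_bigr => a _.
rewrite fourier_fun_sum; last by move=> b; exact: fejer_term_integrable.
rewrite rmorph_sum mulr_suml; apply: eq_bigr => b _.
rewrite fourier_funZ ?fourier_circle_pow; last exact: integrableC_circle_pow.
have [->|_] := eqVneq; first by rewrite mulr1 rmorph1 mul1r.
by rewrite mulr0 rmorph0 mul0r.
Qed.

(** The kernel is the squared modulus of a geometric sum divided by M, so its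
    L1 norm is its mean value. *)
Lemma fejer_kernel_norm M (w : circle R) :
  \int[haar]_z normc (fejer_poly M (fun n => circle_pow (- n) w) z) <= 1.
Proof.
have [->|M0] := posnP M.
  rewrite (_ : (fun z => _) = fun=> 0) ?Rintegral_cst// ?mul0r ?ler01//.
  by apply: funext => z; rewrite /fejer_poly big_ord0 mulr0 normc_zero.
have M0' : 0 < M%:R :> R by rewrite ltr0n.
set P := fejer_poly M _.
have Pge0 z : normc (P z) = complex.Re (P z).
  pose S := \sum_(a < M) circle_pow a%:Z z * circle_pow (- a%:Z) w.
  have -> : P z = (M%:R^-1 * normc S ^+ 2)%:C.
    rewrite /P /fejer_poly rmorphM/=; congr (_ * _).
    have -> : (normc S ^+ 2)%:C = S * conjc S :> R[i].
      by apply: complex_eq; rewrite ?sqr_normcE; case: (S) => u v /=; ring.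
    have -> : conjc S = \sum_(b < M) circle_pow (- b%:Z) z * circle_pow b%:Z w.
      rewrite /S rmorph_sum; apply: eq_bigr => b _.
      have h1 := conjc_circle_pow b z; have h2 := conjc_circle_pow (- b%:Z) w.
      by rewrite opprK in h2; rewrite -h1 -h2; exact: rmorphM.
    rewrite /S mulr_suml; apply: eq_bigr => a _.
    rewrite mulr_sumr; apply: eq_bigr => b _.
    by rewrite !opprD !opprK !circle_powD; ring.
  by rewrite normc_real ger0_norm//= mulr_ge0 ?invr_ge0 ?exprn_ge0 ?normc_ge0// ltW.
rewrite (eq_Rintegral _ _ (g := fun z => complex.Re (P z))); last by move=> z _; rewrite Pge0.
have -> : \int[haar]_z complex.Re (P z) = complex.Re (fourier_fun P 0).
  rewrite /fourier_fun /integralC /=; apply: eq_Rintegral => z _.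
  by rewrite oppr0 circle_pow0 mulr1.
rewrite fourier_fejer_poly /fejer absz0 subn0 divff ?gt_eqF// mul1r.
by rewrite oppr0 circle_pow0.
Qed.

Lemma fejer_poly_bound M x (e : R) :
  (forall n, (`|n| <= M)%N -> normc (x n) <= e) ->
  \int[haar]_z normc (fejer_poly M x z) <= M%:R * e.
Proof.
move=> xe.
have e0 : 0 <= e by apply: le_trans (normc_ge0 _) (xe 0 _).
have -> : M%:R * e = \int[haar]_z (M%:R * e) by rewrite Rintegral_cst// haar_setT mulr1.
apply: le_Rintegral => //.
- exact/integrableC_norm/fejer_poly_integrable.
- exact: finite_measure_integrable_cst.
move=> z _; have [->|M0] := posnP M; first by rewrite /fejer_poly big_ord0 mulr0 normc_zero mul0r.
have M0' : 0 < M%:R :> R by rewrite ltr0n.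
rewrite normcM normc_real ger0_norm; last by rewrite invr_ge0 ltW.
rewrite [leLHS]mulrC ler_pdivrMr//.
apply: le_trans (le_normc_sum _ _ _) _.
have -> : M%:R * e * M%:R = \sum_(a < M) \sum_(b < M) e.
  by rewrite mulrC !sumr_const !card_ord !mulr_natl.
apply: ler_sum => a _; apply: le_trans (le_normc_sum _ _ _) _; apply: ler_sum => b _.
rewrite normcM normc_circle_pow mulr1 xe//.
have := ltn_ord a; have := ltn_ord b; lia.
Qed.

Lemma fejer_polyD M x x' z : fejer_poly M (fun n => x n + x' n) z =
  fejer_poly M x z + fejer_poly M x' z.
Proof.
rewrite /fejer_poly -mulrDr -big_split/=; congr (_ * _); apply: eq_bigr => a _.
by rewrite -big_split/=; apply: eq_bigr => b _; rewrite mulrDl.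
Qed.

(** Replacing the measure by a discrete one carried by the tags of a fine
    partition turns the Fejer sum into a combination of translated kernels. *)
Lemma fejer_poly_measure_norm M (mu : {charge set (circle R) -> \bar R[i]}) :
  \int[haar]_z normc (fejer_poly M (fourier_measure mu) z) <= var_norm mu.
Proof.
apply/ler_addgt0Pr => e e0.
have [C C0 [hC _]] := complex_measure_masses mu.
pose D := C * M%:R * M%:R + 1.
have D0 : 0 < D by rewrite /D ltr_wpDl// !mulr_ge0.
have [N [r [y [cr osc]]]] := circle_partition (divr_gt0 e0 D0).
pose c i := fine (mu (cell r i)).
pose x' (n : int) := \sum_(i < N) circle_pow (- n) (y i) * c i.
have xx' (n : int) : (`|n| <= M)%N -> normc (fourier_measure mu n - x' n) <= C * (M%:R * (e / D)).
  move=> nM; apply: hC => //; first exact: cmeasurable_circle_pow.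
  by apply: circle_pow_osc => //; rewrite abszN.
have E z : fejer_poly M (fourier_measure mu) z = fejer_poly M x' z +
   fejer_poly M (fun n => fourier_measure mu n - x' n) z.
  by rewrite -fejer_polyD; congr (fejer_poly _ _ _); apply: funext => n; ring.
rewrite (eq_Rintegral _ _ (g := fun z => normc (fejer_poly M x' z +
   fejer_poly M (fun n => fourier_measure mu n - x' n) z))); last by move=> z _; rewrite E.
apply: le_trans (Rintegral_normcD (fejer_poly_integrable _ _) (fejer_poly_integrable _ _)) _.
apply: lerD; last first.
  apply: le_trans (fejer_poly_bound xx') _.
  have -> : M%:R * (C * (M%:R * (e / D))) = (C * M%:R * M%:R) * e / D by ring.
  rewrite ler_pdivrMr// mulrC ler_wpM2l//; first exact: ltW.
  by rewrite /D lerDl.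
apply: le_trans (var_norm_partition mu cr).
have E' z : fejer_poly M x' z = \sum_(i < N) c i * fejer_poly M (fun n => circle_pow (- n) (y i)) z.
  rewrite /fejer_poly; under [RHS]eq_bigr do rewrite mulrCA; rewrite -mulr_sumr; congr (_ * _).
  under [RHS]eq_bigr do rewrite mulr_sumr; rewrite [RHS]exchange_big; apply: eq_bigr => a _ /=.
  under [RHS]eq_bigr do rewrite mulr_sumr; rewrite [RHS]exchange_big; apply: eq_bigr => b _ /=.
  by rewrite mulr_suml; apply: eq_bigr => i _; ring.
have ki i : integrableC haar (fun z => c i * fejer_poly M (fun n => circle_pow (- n) (y i)) z).
  by apply: integrableCZ; exact: fejer_poly_integrable.
rewrite (eq_Rintegral _ _ (g := fun z => normc (\sum_(i < N) c i * fejer_poly M (fun n => circle_pow (- n) (y i)) z))); last by move=> z _; rewrite E'.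
elim: (N) => [|n IH].
  rewrite big_ord0 (_ : (fun z => _) = fun=> 0) ?Rintegral_cst ?mul0r//.
  by apply: funext => z; rewrite big_ord0 normc_zero.
rewrite big_ord_recr/= (_ : (fun z => _) = (fun z => normc (
  \sum_(i < n) c i * fejer_poly M (fun n => circle_pow (- n) (y i)) z +
  c n * fejer_poly M (fun k => circle_pow (- k) (y n)) z))); last first.
  by apply: funext => z; rewrite big_ord_recr.
apply: le_trans (Rintegral_normcD (integrableC_sum _ _) (ki _)) _; first by move=> i; exact: ki.
apply: lerD => //; rewrite Rintegral_normcZ; last exact: fejer_poly_integrable.
by rewrite ler_piMr ?normc_ge0// fejer_kernel_norm.
Qed.

End fejer_kernel.

(** * De la Vallee Poussin means *)

Section vallee_poussin.
Variable R : realType.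
Implicit Types (j : int) (N s : nat).
Notation haar := (@haar R).

(** The combination of two Fejer multipliers that cancels the slopes on |j| <= N. A
    large s brings the sum of the absolute values of its weights, (s + 2) / s, close
    to 1. *)
Definition vallee_poussin s N j : R :=
  (s.+1%:R * fejer R (s.+1 * N) j - fejer R N j) / s%:R.

Lemma vallee_poussin_low s N j : (0 < s)%N -> (0 < N)%N -> (`|j| <= N)%N ->
  vallee_poussin s N j = 1.
Proof.
move=> s0 N0 jN; have s0' : s%:R != 0 :> R by rewrite pnatr_eq0 -lt0n.
have N0' : N%:R != 0 :> R by rewrite pnatr_eq0 -lt0n.
rewrite /vallee_poussin /fejer !natrB//; last by rewrite (leq_trans jN)// leq_pmull.
rewrite natrM -natr1; field; rewrite s0' N0'/=.
by rewrite natr1 pnatr_eq0.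
Qed.

Lemma vallee_poussin_high s N j : (s.+1 * N <= `|j|)%N -> vallee_poussin s N j = 0.
Proof.
move=> h; rewrite /vallee_poussin /fejer.
have -> : (s.+1 * N - `|j| = 0)%N by apply/eqP; rewrite subn_eq0.
have -> : (N - `|j| = 0)%N by apply/eqP; rewrite subn_eq0 (leq_trans _ h)// leq_pmull.
by rewrite !mul0r mulr0 subrr mul0r.
Qed.

Lemma fejer_01 N j : 0 <= fejer R N j <= 1.
Proof.
rewrite /fejer; have [->|N0] := posnP N; first by rewrite sub0n mul0r lexx ler01.
have N0' : 0 < N%:R :> R by rewrite ltr0n.
by rewrite divr_ge0//= ler_pdivrMr// mul1r ler_nat leq_subr.
Qed.

Lemma vallee_poussin_bound s N j : (0 < s)%N ->
  `|vallee_poussin s N j| <= 1 + 2 / s%:R.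
Proof.
move=> s0; have s0' : 0 < s%:R :> R by rewrite ltr0n.
have /andP[a0 a1] := fejer_01 (s.+1 * N) j; have /andP[b0 b1] := fejer_01 N j.
rewrite /vallee_poussin normrM [X in _ * X]gtr0_norm ?invr_gt0// ler_pdivrMr//.
have -> : (1 + 2 / s%:R) * s%:R = s.+1%:R + 1 :> R by rewrite -natr1; field; rewrite gt_eqF.
apply: le_trans (ler_normB _ _) _; rewrite !ger0_norm ?mulr_ge0//.
by apply: lerD => //; rewrite ler_piMr.
Qed.

Lemma vallee_poussin_smoothing s N (mu : {charge set (circle R) -> \bar R[i]}) :
  (0 < s)%N -> exists h, [/\ integrableC haar h,
    (forall j, fourier_fun h j = (vallee_poussin s N j)%:C * fourier_measure mu j) &
    \int[haar]_z normc (h z) <= (1 + 2 / s%:R) * var_norm mu].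
Proof.
move=> s0; have s0' : 0 < s%:R :> R by rewrite ltr0n.
pose x := fourier_measure mu.
pose h z := (s.+1%:R / s%:R)%:C * fejer_poly (s.+1 * N) x z +
  (- s%:R^-1)%:C * fejer_poly N x z.
have i1 := fejer_poly_integrable (s.+1 * N) x.
have i2 := fejer_poly_integrable N x.
exists h; split.
- by apply: integrableCD; exact: integrableCZ.
- move=> j; rewrite fourier_funD; try exact: integrableCZ.
  rewrite (fourier_funZ _ _ i1) (fourier_funZ _ _ i2) !fourier_fejer_poly.
  rewrite !mulrA -!rmorphM -mulrDl -rmorphD.
  by congr (_%:C * _); rewrite /vallee_poussin; field; rewrite gt_eqF.
- apply: le_trans (Rintegral_normcD (integrableCZ _ i1) (integrableCZ _ i2)) _.
  rewrite (Rintegral_normcZ _ i1) (Rintegral_normcZ _ i2) !normc_real normrN.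
  have g1 : 0 <= s.+1%:R / s%:R :> R by rewrite divr_ge0.
  have g2 : 0 <= s%:R^-1 :> R by rewrite invr_ge0.
  rewrite (ger0_norm g1) (ger0_norm g2).
  have h1 := fejer_poly_measure_norm (s.+1 * N) mu.
  have h2 := fejer_poly_measure_norm N mu.
  have -> : (1 + 2 / s%:R) * var_norm mu = s.+1%:R / s%:R * var_norm mu + s%:R^-1 * var_norm mu.
    by rewrite -natr1; field; rewrite gt_eqF.
  by apply: lerD; apply: ler_wpM2l.
Qed.

End vallee_poussin.

(** * Fourier coefficients of complex measures *)

Section charge_operations.
Variable R : realType.
Notation haar := (@haar R).
Implicit Types (mu : {charge set (circle R) -> \bar R[i]}).

Lemma mul_div_succ_le (C e : R) : 0 <= C -> 0 < e -> C * (e / (C + 1)) <= e.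
Proof.
move=> C0 e0; have C1 : 0 < C + 1 by rewrite ltr_wpDl.
by rewrite mulrA ler_pdivrMr// mulrC ler_pM2l// lerDl.
Qed.

Lemma eq_of_small (a b : R[i]) (C : R) : 0 <= C ->
  (forall e : R, 0 < e -> normc (a - b) <= C * e) -> a = b.
Proof.
move=> C0 h; apply/eqP; rewrite -subr_eq0 -normc_eq0 eq_le normc_ge0 andbT.
apply/ler_addgt0Pr => e e0; rewrite add0r.
have C1 : 0 < C + 1 by rewrite ltr_wpDl.
by apply: le_trans (h _ (divr_gt0 e0 C1)) _; exact: mul_div_succ_le.
Qed.

(** The Fourier coefficients of a complex measure only depend on its values on
    sets, as limits of Riemann sums along fine partitions. *)
Lemma fourier_measure_riemann mu (n : int) : exists2 C : R, 0 <= C &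
  forall N r y (eta : R), classifier N r ->
   (forall z : circle R, normc (circle_val z - circle_val (y (r z))) <= eta) ->
   normc (fourier_measure mu n - \sum_(i < N) circle_pow (- n) (y i) * fine (mu (cell r i)))
     <= C * eta.
Proof.
have [C C0 [hC _]] := complex_measure_masses mu.
exists (C * `|n|%:R); first by rewrite mulr_ge0.
move=> N r y eta cr osc; rewrite -mulrA; apply: hC => //.
  exact: cmeasurable_circle_pow.
by apply: circle_pow_osc => //; rewrite abszN.
Qed.

(** The sum mu + c mu', assembled from real and imaginary parts. *)
Definition charge_lin mu (c : R) mu' : {charge set (circle R) -> \bar R[i]} :=
  charge_pair (cadd (charge_Re mu) (cscale c (charge_Re mu')))
              (cadd (charge_Im mu) (cscale c (charge_Im mu'))).

Lemma charge_linE mu c mu' A :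
  fine (charge_lin mu c mu' A) = fine (mu A) + c%:C * fine (mu' A).
Proof.
rewrite /charge_lin /= /charge_pair /cadd /cscale /charge_Re /charge_Im /=.
by apply: complex_eq; rewrite /= ?mul0r ?subr0 ?addr0; case: (fine (mu A)) (fine (mu' A)) => a b [u v] /=; ring.
Qed.

(** Jordan decompositions are not additive, but Riemann sums are. *)
Lemma fourier_measure_lin mu c mu' n :
  fourier_measure (charge_lin mu c mu') n = fourier_measure mu n + c%:C * fourier_measure mu' n.
Proof.
have [C1 C10 h1] := fourier_measure_riemann mu n.
have [C2 C20 h2] := fourier_measure_riemann mu' n.
have [C3 C30 h3] := fourier_measure_riemann (charge_lin mu c mu') n.
apply: (@eq_of_small _ _ (C3 + (C1 + `|c| * C2))).
  by rewrite !addr_ge0// mulr_ge0.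
move=> e e0; have [N [r [y [cr osc]]]] := circle_partition e0.
have {}h1 := h1 _ _ _ _ cr osc; have {}h2 := h2 _ _ _ _ cr osc; have {}h3 := h3 _ _ _ _ cr osc.
have E : \sum_(i < N) circle_pow (- n) (y i) * fine (charge_lin mu c mu' (cell r i)) =
    \sum_(i < N) circle_pow (- n) (y i) * fine (mu (cell r i)) +
    c%:C * \sum_(i < N) circle_pow (- n) (y i) * fine (mu' (cell r i)).
  by rewrite mulr_sumr -big_split; apply: eq_bigr => i _; rewrite charge_linE/=; ring.
rewrite E in h3; move: h1 h2 h3.
move: (fourier_measure mu n) (fourier_measure mu' n) (fourier_measure (charge_lin mu c mu') n).
move: (\sum_(i < N) _ * fine (mu _)) (\sum_(i < N) _ * fine (mu' _)) => S1 S2 f1 f2 f3 h1 h2 h3.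
have -> : f3 - (f1 + c%:C * f2) = (f3 - (S1 + c%:C * S2)) - ((f1 - S1) + c%:C * (f2 - S2)) by ring.
apply: le_trans (le_normcB _ _) _; rewrite mulrDl; apply: lerD => //.
apply: le_trans (le_normcD _ _) _; rewrite mulrDl; apply: lerD => //.
by rewrite normcM normc_real -mulrA ler_wpM2l.
Qed.

Lemma var_norm_lin mu c mu' :
  var_norm (charge_lin mu c mu') <= var_norm mu + `|c| * var_norm mu'.
Proof.
apply: var_norm_le => F mF tF n.
apply: (@le_trans _ _ (\sum_(i < n) (normc (fine (mu (F i))) + `|c| * normc (fine (mu' (F i)))))).
  apply: ler_sum => i _; rewrite charge_linE; apply: le_trans (le_normcD _ _) _.
  by rewrite normcM normc_real.
rewrite big_split/= -mulr_sumr; apply: lerD; first exact: var_norm_sum_le.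
by apply: ler_wpM2l => //; exact: var_norm_sum_le.
Qed.

(** In a Riemann sum the characters have modulus 1. *)
Lemma normc_fourier_measure_le mu n : normc (fourier_measure mu n) <= var_norm mu.
Proof.
have [C C0 h] := fourier_measure_riemann mu n.
apply/ler_addgt0Pr => e e0; have C1 : 0 < C + 1 by rewrite ltr_wpDl.
have [N [r [y [cr osc]]]] := circle_partition (divr_gt0 e0 C1).
have {}h := h _ _ _ _ cr osc.
set S := \sum_(i < N) _ in h.
apply: le_trans (le_normc_diff _ S) _; apply: lerD.
  apply: le_trans (le_normc_sum _ _ _) _; apply: le_trans (var_norm_partition mu cr).
  by apply: ler_sum => i _; rewrite normcM normc_circle_pow mul1r.
by apply: le_trans h _; exact: mul_div_succ_le.
Qed.

Section density.
Variable f : circle R -> R[i].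
Hypothesis fi : integrableC haar f.

Definition density_charge : {charge set (circle R) -> \bar R[i]} :=
  charge_pair (induced_charge fi.1) (induced_charge fi.2).

Lemma integrableC_indic_mul (A : set (circle R)) : measurable A ->
  integrableC haar (fun z => f z * (\1_A z)%:C).
Proof.
move=> mA; apply: (@integrableC_bounded_mul _ _ _ haar _ _ 1) => //.
  by split; [exact: measurable_indic|exact: measurable_cst].
by move=> z; rewrite normc_real indicE; case: (_ \in _); rewrite ?normr1 ?normr0.
Qed.

Lemma density_chargeE A : measurable A ->
  fine (density_charge A) = integralC haar (fun z => f z * (\1_A z)%:C).
Proof.
move=> mA; rewrite /density_charge /= /charge_pair /induced_charge /integralC.
apply: complex_eq; rewrite /=.
  rewrite -/(Rintegral _ _ _) Rintegral_mkcond; apply: eq_Rintegral => z _.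
  rewrite Re_mul/= mulr0 subr0 patchE indicE; case: (_ \in _); by rewrite ?mulr1 ?mulr0.
rewrite -/(Rintegral _ _ _) Rintegral_mkcond; apply: eq_Rintegral => z _.
rewrite Im_mul/= mulr0 add0r patchE indicE; case: (_ \in _); by rewrite ?mulr1 ?mulr0.
Qed.

(** Replacing the character by a step function on the cells changes the integral
    against f by at most the oscillation times the L1 norm of f, and turns it into
    a Riemann sum of the density measure. *)
Lemma fourier_density n : fourier_measure density_charge n = fourier_fun f n.
Proof.
have [C C0 h] := fourier_measure_riemann density_charge n.
pose I := \int[haar]_z normc (f z).
have I0 : 0 <= I by exact: Rintegral_normc_ge0.
apply: (@eq_of_small _ _ (C + `|n|%:R * I)); first by rewrite addr_ge0// mulr_ge0.
move=> e e0; have [N [r [y [cr osc]]]] := circle_partition e0.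
have {}h := h _ _ _ _ cr osc.
move: h; set S := \sum_(i < N) _ => h.
apply: le_trans (le_normcBD _ S _) _; rewrite mulrDl; apply: lerD => //.
have si i : integrableC haar (fun z => circle_pow (- n) (y i) * (f z * (\1_(cell r i) z)%:C)).
  by apply: integrableCZ; apply: integrableC_indic_mul; exact: cr.1.
have -> : S = integralC haar (fun z => \sum_(i < N) circle_pow (- n) (y i) * (f z * (\1_(cell r i) z)%:C)).
  rewrite integralC_sum//; apply: eq_bigr => i _.
  rewrite density_chargeE; last exact: cr.1.
  by rewrite integralCZ//; apply: integrableC_indic_mul; exact: cr.1.
rewrite normcB /fourier_fun -integralCB; last 2 first.
- exact: integrableC_mul_pow.
- exact: integrableC_sum.
rewrite (eq_integralC _ (g := fun z => f z * (circle_pow (- n) z - step_fun (circle_pow (- n)) r y N z))); last first.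
  move=> z; rewrite mulrBr; congr (_ - _); rewrite mulr_sumr; apply: eq_bigr => i _; ring.
have osc' := circle_pow_osc osc (leqnn `|- n|%N).
have di : integrableC haar (fun z => f z * (circle_pow (- n) z - step_fun (circle_pow (- n)) r y N z)).
  apply: (@integrableC_bounded_mul _ _ _ haar _ _ (`|- n|%:R * e)) => //.
    apply: (@integrableC_cmeasurable _ _ _ haar); apply: integrableCB.
      exact: integrableC_circle_pow.
    exact: integrableC_step.
  by move=> z; rewrite (step_funE _ _ _ cr).
apply: le_trans (normc_integralC_le di) _.
have -> : `|n|%:R * I * e = \int[haar]_z (`|n|%:R * e * normc (f z)).
  by rewrite RintegralZl//; [rewrite mulrAC|exact: integrableC_norm].
apply: le_Rintegral => //; first exact: integrableC_norm.
  by have := integrableZl measurableT (`|n|%:R * e) (integrableC_norm fi); apply: eq_integrable.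
move=> z _; rewrite normcM mulrC ler_wpM2r ?normc_ge0//.
by rewrite (step_funE _ _ _ cr) -(abszN n).
Qed.

Lemma sum_indic_le1 (F : (set (circle R))^nat) n z : trivIset setT F ->
  \sum_(i < n) (\1_(F i) z) <= 1 :> R.
Proof.
move=> tF; have [/existsP[k kz]|/existsPn nz] := boolP [exists k : 'I_n, z \in F k].
  rewrite (bigD1 k)//= big1 ?addr0; first by rewrite indicE kz.
  move=> i ik; rewrite indicE; case: (boolP (z \in F i)) => // iz; exfalso.
  move/trivIsetP : tF => /(_ i k I I) /(_ ik).
  by apply/eqP/set0P; exists z; split; apply/set_mem.
by rewrite big1// => i _; rewrite indicE (negbTE (nz i)).
Qed.

Lemma var_norm_density : var_norm density_charge <= \int[haar]_z normc (f z).
Proof.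
apply: var_norm_le => F mF tF n.
have ii i := integrableC_norm (integrableC_indic_mul (mF i)).
apply: (@le_trans _ _ (\sum_(i < n) \int[haar]_z normc (f z * (\1_(F i) z)%:C))).
  apply: ler_sum => i _; rewrite density_chargeE//; apply: normc_integralC_le.
  exact: integrableC_indic_mul.
have -> : \sum_(i < n) \int[haar]_z normc (f z * (\1_(F i) z)%:C) =
   \int[haar]_z (\sum_(i < n) normc (f z * (\1_(F i) z)%:C)).
  elim: n => [|k IH].
    rewrite big_ord0 (_ : (fun z => _) = fun=> 0) ?Rintegral_cst ?mul0r//.
    by apply: funext => z; rewrite big_ord0.
  have Si : haar.-integrable setT (EFin \o (fun z => \sum_(i < k) normc (f z * (\1_(F i) z)%:C))).
    have := @integrable_sum _ _ _ haar setT measurableT _ (index_enum 'I_k) xpredT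
      (fun i z => (normc (f z * (\1_(F i) z)%:C))%:E) (fun i _ => ii i).
    by apply: eq_integrable => // z _; rewrite /= sumEFin.
  rewrite big_ord_recr/= IH -RintegralD//; last exact: ii.
  by apply: eq_Rintegral => z _; rewrite big_ord_recr.
apply: le_Rintegral => //.
- have := @integrable_sum _ _ _ haar setT measurableT _ (index_enum 'I_n) xpredT
    (fun i z => (normc (f z * (\1_(F i) z)%:C))%:E) (fun i _ => ii i).
  by apply: eq_integrable => // z _; rewrite /= sumEFin.
- exact: integrableC_norm.
move=> z _; under eq_bigr do rewrite normcM normc_real ger0_norm//.
by rewrite -mulr_sumr ler_piMr ?normc_ge0// sum_indic_le1.
Qed.

End density.

End charge_operations.

(** * The Riemann-Lebesgue lemma *)

Section riemann_lebesgue.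
Variable R : realType.
Implicit Types (f : circle R -> R[i]) (x : int -> R[i]).
Notation haar := (@haar R).

Definition small_tails x := forall e : R, 0 < e ->
  exists N : nat, forall j : int, (N <= `|j|)%N -> normc (x j) <= e.

Lemma cvg0_normc (u : nat -> R[i]) : (u n @[n --> \oo] --> (0 : R[i])) <->
  (forall e : R, 0 < e -> exists N, forall n, (N <= n)%N -> normc (u n) <= e).
Proof.
split=> [cu e e0|H].
  have e0C : 0 < e%:C by rewrite ltcR.
  have /cvgr0_norm_le /(_ _ e0C) [N _ h] := cu.
  by exists N => n Nn; have := h n Nn; rewrite norm_complexE lecR.
apply/cvgr0Pnorm_lt => -[e e'] ee0.
have [e'0 e0] : e' = 0 /\ 0 < e by move: ee0; rewrite ltcE/= => /andP[/eqP].
have [N hN] := H (e / 2) ltac:(lra).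
rewrite e'0; exists N => // n /= Nn; rewrite norm_complexE ltcR.
by apply: le_lt_trans (hN _ Nn) _; lra.
Qed.

Lemma vanishes_tails x : vanishes_at_infinity x <-> small_tails x.
Proof.
rewrite /vanishes_at_infinity !cvg0_normc; split=> [[h1 h2] e e0|h].
  have [N1 k1] := h1 _ e0; have [N2 k2] := h2 _ e0.
  exists (maxn N1 N2) => -[n|n]; rewrite geq_max => /andP[n1 n2]; first exact: k1.
  by rewrite NegzE; apply: k2.
by split=> e e0; have [N hN] := h _ e0; exists N => n Nn; apply: hN; rewrite ?abszN.
Qed.

(** For the partial Fourier sum P of f along e, integrate the pointwise
    inequality Re ((2 f - P) conj P) <= |f|^2. *)
Lemma bessel_inequality f (K : R) (e : nat -> int) n : cmeasurable f ->
  (forall z, normc (f z) <= K) -> injective e ->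
  \sum_(k < n) normc (fourier_fun f (e k)) ^+ 2 <= K ^+ 2.
Proof.
move=> mf fK einj.
have fi : integrableC haar f by exact: (@integrableC_bounded _ _ _ haar _ K).
pose c (k : 'I_n) := fourier_fun f (e k).
pose P z := \sum_(k < n) c k * circle_pow (e k) z.
have Pi : integrableC haar P.
  by apply: integrableC_sum => k; apply: integrableCZ; exact: integrableC_circle_pow.
have FP (k : 'I_n) : fourier_fun P (e k) = c k.
  rewrite fourier_fun_sum; last by move=> l; apply: integrableCZ; exact: integrableC_circle_pow.
  rewrite (bigD1 k)//= big1 ?addr0.
    by rewrite (fourier_funZ _ _ (integrableC_circle_pow _ _)) fourier_circle_pow eqxx mulr1.
  move=> l lk; rewrite (fourier_funZ _ _ (integrableC_circle_pow _ _)) fourier_circle_pow.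
  by rewrite (inj_eq einj) -[(l == k :> nat)]/(l == k) (negbTE lk) mulr0.
pose g z := 2 * f z - P z.
have gi : integrableC haar g by apply: integrableCB => //; exact: integrableCZ.
have Fg (k : 'I_n) : fourier_fun g (e k) = c k.
  rewrite (fourier_funB _ (integrableCZ 2 fi) Pi) (fourier_funZ _ _ fi) FP -/(c k).
  by ring.
pose h z := \sum_(k < n) conjc (c k) * (g z * circle_pow (- e k) z).
have hk (k : 'I_n) : integrableC haar (fun z => conjc (c k) * (g z * circle_pow (- e k) z)).
  by apply: integrableCZ; exact: integrableC_mul_pow.
have hi : integrableC haar h by exact: integrableC_sum.
have hE z : h z = g z * conjc (P z).
  rewrite /P rmorph_sum mulr_sumr; apply: eq_bigr => k _.
  by rewrite -conjc_circle_pow mulrCA; congr (_ * _); symmetry; exact: rmorphM.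
have Ih : integralC haar h = (\sum_(k < n) normc (c k) ^+ 2)%:C.
  rewrite integralC_sum// rmorph_sum; apply: eq_bigr => k _.
  rewrite integralCZ; last exact: integrableC_mul_pow.
  rewrite -/(fourier_fun g (e k)) Fg; apply: complex_eq; rewrite ?sqr_normcE;
    by case: (c k) => u v /=; ring.
have -> : \sum_(k < n) normc (fourier_fun f (e k)) ^+ 2 = complex.Re (integralC haar h) by rewrite Ih.
have -> : K ^+ 2 = \int[haar]_z (K ^+ 2) by rewrite Rintegral_cst// haar_setT mulr1.
apply: le_Rintegral => //; first exact: hi.1.
  exact: finite_measure_integrable_cst.
move=> z _; apply: (@le_trans _ _ (normc (f z) ^+ 2)).
  rewrite hE /g Re_mul Re_sub Im_sub Re_conjc Im_conjc sqr_normcE.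
  case: (f z) (P z) => a b [u v]; rewrite mulr_natl mulr2n /=.
  have := sqr_ge0 (a - u); have := sqr_ge0 (b - v); nra.
by rewrite ler_pXn2r ?nnegrE ?normc_ge0 ?(le_trans (normc_ge0 (f z)) (fK z)).
Qed.

Lemma bounded_sum_small (a : nat -> R) (B : R) : (forall k, 0 <= a k) ->
  (forall n, \sum_(k < n) a k <= B) ->
  forall e : R, 0 < e -> exists N, forall k, (N <= k)%N -> a k <= e.
Proof.
move=> a0 aB e e0.
have cs : cvgn (series a).
  apply: nondecreasing_is_cvgn; first by apply: nondecreasing_series => k _ _; exact: a0.
  by exists B => _ [n _ <-]; rewrite /series/= big_mkord.
have /cvgr0_norm_le /(_ _ e0) [N _ h] := cvg_series_cvg_0 cs.
by exists N => k Nk; apply: le_trans (ler_norm _) (h k Nk).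
Qed.

Lemma riemann_lebesgue_bounded f (K : R) : cmeasurable f ->
  (forall z, normc (f z) <= K) -> small_tails (fourier_fun f).
Proof.
move=> mf fK; apply/vanishes_tails; rewrite /vanishes_at_infinity !cvg0_normc.
have H (e : nat -> int) : injective e -> forall d : R, 0 < d -> exists N, forall k, (N <= k)%N ->
    normc (fourier_fun f (e k)) <= d.
  move=> einj d d0.
  have [] := @bounded_sum_small (fun k => normc (fourier_fun f (e k)) ^+ 2) (K ^+ 2) _ _ (d ^+ 2).
  - by move=> k; exact: exprn_ge0 (normc_ge0 _).
  - by move=> n; exact: bessel_inequality.
  - by rewrite exprn_gt0.
  move=> N hN; exists N => k /hN.
  by rewrite ler_pXn2r// nnegrE ?normc_ge0// ltW.
by split; apply: H => a b; [case|move/oppr_inj; case].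
Qed.

(** The coefficients of f differ from those of its truncation at height n by at most
    the L1 norm of the difference, which tends to 0; the truncation is bounded, and
    Bessel's inequality applies to it. *)
Lemma riemann_lebesgue f : integrableC haar f -> small_tails (fourier_fun f).
Proof.
move=> fi e e0; have e2 : 0 < e / 2 by lra.
have mf := integrableC_cmeasurable fi.
have mn := measurable_normc mf.
pose A (n : nat) := [set z | normc (f z) <= n%:R].
have mA n : measurable (A n).
  rewrite (_ : A n = (fun z => normc (f z)) @^-1` `]-oo, n%:R]%classic).
    by rewrite -[X in measurable X]setTI; apply: mn.
  by apply/seteqP; split => z; rewrite /A /= in_itv.
pose ft n z := f z * (\1_(A n) z)%:C.
have fti n : integrableC haar (ft n) by exact: integrableC_indic_mul.
have tE n z : normc (f z - ft n z) = normc (f z) * \1_(~` A n) z.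
  rewrite /ft !indicE in_setC; case: (z \in A n) => /=; rewrite ?mulr1 ?subrr ?normc_zero ?mulr0//.
  by rewrite subr0.
have small : \int[haar]_z normc (f z - ft n z) @[n --> \oo] --> (0 : R).
  have [] := @dominated_convergence _ _ _ haar setT measurableT
    (fun n z => (normc (f z - ft n z))%:E) (fun=> 0%E) (fun z => (normc (f z))%:E).
  - by move=> n; have /measurable_int := integrableC_norm (integrableCB fi (fti n)).
  - exact: measurable_cst.
  - apply: aeW => z _; apply: cvg_near_cst.
    exists (Num.truncn (normc (f z))).+1 => // n /= hn; rewrite tE indicE in_setC mem_set ?mulr0//.
    by rewrite /A/=; apply/ltW/(lt_le_trans (truncnS_gt _)); rewrite ler_nat.
  - exact: integrableC_norm.
  - apply: aeW => z n _; rewrite tE /= lee_fin ger0_norm ?mulr_ge0 ?normc_ge0//.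
    by rewrite ler_piMr ?normc_ge0// indicE; case: (_ \in _).
  move=> _ _ cv.
  have := fine_cvg (f := fun n => (\int[haar]_z (normc (f z - ft n z))%:E)%E) (a := 0).
  by move=> /(_ _ _); apply; rewrite integral0 in cv.
have /cvgr0_norm_le /(_ _ e2) [n _ /(_ n (leqnn n)) hn] := small.
have ftn z : normc (ft n z) <= n%:R.
  rewrite normcM normc_real indicE; case: (boolP (z \in A n)) => [/set_mem h|_].
    by rewrite normr1 mulr1.
  by rewrite normr0 mulr0.
have [N hN] := riemann_lebesgue_bounded (integrableC_cmeasurable (fti n)) ftn e2.
exists N => j Nj; have := le_normc_diff (fourier_fun f j) (fourier_fun (ft n) j).
rewrite -(fourier_funB _ fi (fti n)).
have h1 : normc (fourier_fun (fun z => f z - ft n z) j) <= e / 2.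
  apply: le_trans (normc_fourier_fun_le j (integrableCB fi (fti n))) _.
  exact: le_trans (ler_norm _) hn.
by move/le_trans; apply; rewrite [e]splitr; apply: lerD (hN j Nj) h1.
Qed.

End riemann_lebesgue.

(** * The sequence spaces *)

Section null_sequences.
Variable R : realType.
Implicit Types (x y : int -> R[i]) (j : int).

Lemma small_tails_bounded x : small_tails x -> exists B : R, forall j, normc (x j) <= B.
Proof.
move=> tx; have [N hN] := tx 1 ltr01.
exists (1 + \sum_(k < N) (normc (x k%:Z) + normc (x (- k%:Z)))) => j.
have S0 : 0 <= \sum_(k < N) (normc (x k%:Z) + normc (x (- k%:Z))).
  by apply: sumr_ge0 => k _; rewrite addr_ge0 ?normc_ge0.
have [Nj|jN] := leqP N `|j|; first by have := hN _ Nj; lra.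
apply: (@le_trans _ _ (\sum_(k < N) (normc (x k%:Z) + normc (x (- k%:Z))))); last by rewrite lerDr.
rewrite (bigD1 (Ordinal jN))//=; apply: (@le_trans _ _ (normc (x `|j|%:Z) + normc (x (- `|j|%:Z)))).
  case: (j) => k /=; first by rewrite lerDl normc_ge0.
  by rewrite NegzE lerDr normc_ge0.
by rewrite lerDl sumr_ge0// => k _; rewrite addr_ge0 ?normc_ge0.
Qed.

Lemma c0_carrierE x : carrier (c0Z R) x <-> small_tails x.
Proof. exact: vanishes_tails. Qed.

Lemma c0_norm_ge x j : small_tails x -> normc (x j) <= normS (c0Z R) x.
Proof.
move=> /small_tails_bounded[B hB]; apply: ub_le_sup; last by exists j.
by exists B => _ [k _ <-].
Qed.

Lemma c0_norm_le x (B : R) : (forall j, normc (x j) <= B) -> normS (c0Z R) x <= B.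
Proof.
by move=> hB; apply: ge_sup; [exists (normc (x 0)), 0|move=> _ [k _ <-]].
Qed.

Lemma c0_norm_ge0 x : 0 <= normS (c0Z R) x.
Proof.
rewrite /normS/=; have [[_ B]|] := pselect (has_sup (range (fun n => normc (x n)))).
  by apply: le_trans (normc_ge0 (x 0)) _; apply: ub_le_sup => //; exists 0.
by move=> ns; rewrite sup_out.
Qed.

Lemma small_tails_sub x y : small_tails x -> small_tails y -> small_tails (x - y).
Proof.
move=> tx ty e e0; have e2 : 0 < e / 2 by lra.
have [N1 h1] := tx _ e2; have [N2 h2] := ty _ e2; exists (maxn N1 N2) => j.
rewrite geq_max => /andP[/h1 a1 /h2 a2]; have := le_normcB (x j) (y j).
have -> : (x - y) j = x j - y j by [].
lra.
Qed.

Lemma small_tails_add x y : small_tails x -> small_tails y -> small_tails (x + y).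
Proof.
move=> tx ty; rewrite -[y]opprK; apply: small_tails_sub => // e e0.
have [N h] := ty _ e0; exists N => j /h; rewrite -(normcN (y j)); apply.
Qed.

Lemma small_tails0 : small_tails (0 : int -> R[i]).
Proof. by move=> e e0; exists 0%N => j _; rewrite normc_zero ltW. Qed.

End null_sequences.

Section embedded_spaces.
Variables (R : realType) (V : Type) (j : V -> (int -> R[i])) (A : set V) (N : V -> R).
Hypothesis N0 : forall v, A v -> 0 <= N v.

Lemma embedded_norm_le v : A v -> normS (embedded j A N) (j v) <= N v.
Proof.
move=> Av; apply: ge_inf; last by exists v.
by exists 0 => _ [w [Aw _] <-]; exact: N0.
Qed.

Lemma embedded_norm_approx x (e : R) : carrier (embedded j A N) x -> 0 < e ->
  exists2 v, A v /\ j v = x & N v < normS (embedded j A N) x + e.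
Proof.
move=> [v Av jv] e0.
have hi : has_inf [set N v | v in A `&` j @^-1` [set x]].
  by split; [exists (N v), v|exists 0 => _ [w [Aw _] <-]; exact: N0].
by have [_ [w [Aw jw] <-] h] := inf_adherent e0 hi; exists w.
Qed.

Lemma embedded_norm_ge0 x : 0 <= normS (embedded j A N) x.
Proof.
rewrite /normS/=; set S := [set N v | v in _].
have [[y Sy]|/set0P/negP/negPn/eqP ->] := pselect (S !=set0); last by rewrite inf0.
by apply: lb_le_inf; [exists y|move=> _ [w [Aw _] <-]; exact: N0].
Qed.

End embedded_spaces.

(** What the argument uses of a space of sequences embedded in c0: a subgroup on
    which the norm is a group norm dominating the supremum norm. *)
Section subordinate_spaces.
Variable R : realType.

Record subordinate (A : normed_sub (int -> R[i])) : Prop := Subordinate {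
  sub_carrier0 : carrier A 0;
  sub_norm0 : normS A 0 = 0;
  sub_norm_ge0 : forall x, 0 <= normS A x;
  sub_carrierB : forall x y, carrier A x -> carrier A y -> carrier A (x - y);
  sub_norm_triangle : forall x y, carrier A x -> carrier A y ->
    normS A x <= normS A y + normS A (x - y);
  sub_tails : forall x, carrier A x -> small_tails x;
  sub_norm_sup : forall x n, carrier A x -> normc (x n) <= normS A x }.

Lemma sub_norm_add A x y : subordinate A -> carrier A x -> carrier A y ->
  normS A (x + y) <= normS A x + normS A y.
Proof.
move=> sA Ax Ay; have Axy : carrier A (x + y).
  rewrite -[y]opprK -[- y]sub0r; do ! apply: (sub_carrierB sA) => //; exact: sub_carrier0 sA.
have := sub_norm_triangle sA Axy Ax.
by rewrite (_ : x + y - x = y)// addrAC subrr add0r.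
Qed.

Lemma c0_subordinate : subordinate (c0Z R).
Proof.
split.
- exact/c0_carrierE/small_tails0.
- by apply/eqP; rewrite eq_le c0_norm_ge0 andbT; apply: c0_norm_le => j; rewrite normc_zero.
- exact: c0_norm_ge0.
- by move=> x y /c0_carrierE tx /c0_carrierE ty; exact/c0_carrierE/small_tails_sub.
- move=> x y /c0_carrierE tx /c0_carrierE ty; apply: c0_norm_le => j.
  apply: le_trans (le_normc_diff (x j) (y j)) _; apply: lerD; first exact: c0_norm_ge.
  exact: (@c0_norm_ge _ (x - y) j (small_tails_sub tx ty)).
- by move=> x /c0_carrierE.
- by move=> x n /c0_carrierE; exact: c0_norm_ge.
Qed.

Notation haar := (@haar R).
Lemma L1_norm_le (f : circle R -> R[i]) : integrableC haar f ->
  normS (L1T R) (fourier_fun f) <= \int[haar]_z normc (f z).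
Proof. by apply: embedded_norm_le => v _; exact: Rintegral_normc_ge0. Qed.

Lemma L1_norm_approx x (e : R) : carrier (L1T R) x -> 0 < e ->
  exists2 f, integrableC haar f /\ fourier_fun f = x &
    \int[haar]_z normc (f z) < normS (L1T R) x + e.
Proof. by apply: embedded_norm_approx => v _; exact: Rintegral_normc_ge0. Qed.

Lemma E_norm_le (mu : {charge set (circle R) -> \bar R[i]}) :
  small_tails (fourier_measure mu) ->
  normS (E_space R) (fourier_measure mu) <= var_norm mu.
Proof.
move=> /vanishes_tails vmu; apply: (@embedded_norm_le _ _ _ _ (@var_norm _ _ R)) vmu.
by move=> v _; exact: var_norm_ge0.
Qed.

Lemma E_norm_approx x (e : R) : carrier (E_space R) x -> 0 < e ->
  exists2 mu, fourier_measure mu = x & var_norm mu < normS (E_space R) x + e.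
Proof.
move=> Ex e0.
have [] := @embedded_norm_approx _ _ (@fourier_measure R)
  [set mu | vanishes_at_infinity (fourier_measure mu)] (@var_norm _ _ R) _ x e Ex e0.
  by move=> v _; exact: var_norm_ge0.
by move=> mu [_ <-] h; exists mu.
Qed.

Lemma E_carrier mu : small_tails (fourier_measure mu) -> carrier (E_space R) (fourier_measure mu).
Proof. by move=> /vanishes_tails h; exists mu. Qed.

Lemma E_tails x : carrier (E_space R) x -> small_tails x.
Proof. by move=> [mu /vanishes_tails h <-]. Qed.

Lemma L1_tails x : carrier (L1T R) x -> small_tails x.
Proof. by move=> [f fi <-]; exact: riemann_lebesgue. Qed.

Lemma L1_subordinate : subordinate (L1T R).
Proof.
have B x y : carrier (L1T R) x -> carrier (L1T R) y -> carrier (L1T R) (x - y).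
  move=> [f fi <-] [g gi <-]; exists (fun z => f z - g z); first exact: integrableCB.
  by apply: funext => n; rewrite fourier_funB.
have z0 : fourier_fun (fun=> 0) = 0 :> (int -> R[i]).
  apply: funext => n; rewrite /fourier_fun (_ : (fun z => _) = fun=> 0) ?integralC0//.
  by apply: funext => z; rewrite mul0r.
split => //.
- by exists (fun=> 0) => //; exact: integrableC0.
- apply/eqP; rewrite eq_le; apply/andP; split; last first.
    by apply: embedded_norm_ge0 => v _; exact: Rintegral_normc_ge0.
  rewrite -z0; apply: le_trans (L1_norm_le (integrableC0 _)) _.
  by under eq_Rintegral do rewrite normc_zero; rewrite Rintegral_cst// mul0r.
- by move=> x; apply: embedded_norm_ge0 => v _; exact: Rintegral_normc_ge0.
- move=> x y Lx Ly; apply/ler_addgt0Pr => e e0; have e2 : 0 < e / 2 by lra.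
  have [f [fi fE] hf] := L1_norm_approx Ly e2.
  have [g [gi gE] hg] := L1_norm_approx (B _ _ Lx Ly) e2.
  have xE : fourier_fun (fun z => f z + g z) = x.
    by apply: funext => n; rewrite fourier_funD// fE gE addrC subrK.
  rewrite -[in leLHS]xE; apply: le_trans (L1_norm_le (integrableCD fi gi)) _.
  apply: le_trans (Rintegral_normcD fi gi) _.
  apply: le_trans (ltW (ltrD hf hg)) _.
  by rewrite addrACA -splitr.
- exact: L1_tails.
- move=> x n Lx; apply/ler_addgt0Pr => e e0.
  have [f [fi <-] hf] := L1_norm_approx Lx e0.
  exact: le_trans (normc_fourier_fun_le _ fi) (ltW hf).
Qed.

Lemma E_subordinate : subordinate (E_space R).
Proof.
have B x y : carrier (E_space R) x -> carrier (E_space R) y -> carrier (E_space R) (x - y).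
  move=> Ex Ey; have tx := E_tails Ex; have ty := E_tails Ey.
  move: Ex Ey => [mu _ mE] [nu _ nE].
  have e : fourier_measure (charge_lin mu (-1) nu) = x - y.
    by apply: funext => n; rewrite fourier_measure_lin mE nE rmorphN rmorph1 mulN1r.
  by rewrite -e; apply: E_carrier; rewrite e; exact: small_tails_sub.
pose zero : {charge set (circle R) -> \bar R[i]} := charge_pair (@czero _ (circle R) R) (@czero _ (circle R) R).
have v0 : var_norm zero <= 0.
  apply: var_norm_le => F mF tF n; rewrite big1// => i _.
  by rewrite /zero /= /charge_pair /czero /=; exact: normc_zero.
have z0 : fourier_measure zero = 0.
  apply: funext => n; apply/eqP; rewrite -normc_eq0 eq_le normc_ge0 andbT.
  exact: le_trans (normc_fourier_measure_le zero n) v0.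
have t0 : small_tails (fourier_measure zero) by rewrite z0; exact: small_tails0.
split => //.
- by rewrite -z0; exact: E_carrier.
- apply/eqP; rewrite eq_le; apply/andP; split.
    by rewrite -z0; exact: le_trans (E_norm_le t0) v0.
  by apply: embedded_norm_ge0 => v _; exact: var_norm_ge0.
- by move=> x; apply: embedded_norm_ge0 => v _; exact: var_norm_ge0.
- move=> x y Ex Ey; apply/ler_addgt0Pr => e e0; have e2 : 0 < e / 2 by lra.
  have [mu mE hm] := E_norm_approx Ey e2.
  have [nu nE hn] := E_norm_approx (B _ _ Ex Ey) e2.
  have sE : fourier_measure (charge_lin mu 1 nu) = x.
    by apply: funext => n; rewrite fourier_measure_lin mE nE rmorph1 mul1r addrC subrK.
  rewrite -[in leLHS]sE; apply: le_trans (E_norm_le _) _; first by rewrite sE; exact: E_tails.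
  apply: le_trans (var_norm_lin mu 1 nu) _; rewrite normr1 mul1r.
  by apply: le_trans (ltW (ltrD hm hn)) _; rewrite addrACA -splitr.
- exact: E_tails.
- move=> x n Ex; apply/ler_addgt0Pr => e e0.
  have [mu <- hm] := E_norm_approx Ex e0.
  exact: le_trans (normc_fourier_measure_le _ _) (ltW hm).
Qed.

(** The density measure has the same Fourier coefficients and a total variation at
    most the L1 norm. *)
Lemma L1_sub_E x : carrier (L1T R) x ->
  carrier (E_space R) x /\ normS (E_space R) x <= normS (L1T R) x.
Proof.
move=> Lx.
have H f (fi : integrableC haar f) : fourier_measure (density_charge fi) = fourier_fun f.
  by apply: funext => n; exact: fourier_density.
split.
  have [f fi fE] := Lx; rewrite -fE -(H f fi); apply: E_carrier.
  by rewrite H; exact: riemann_lebesgue.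
apply/ler_addgt0Pr => e e0; have [f [fi fE] hf] := L1_norm_approx Lx e0.
rewrite -[in leLHS]fE -(H f fi); apply: le_trans (E_norm_le _) _.
  by rewrite H; exact: riemann_lebesgue.
exact: le_trans (var_norm_density fi) (ltW hf).
Qed.

End subordinate_spaces.

Section convolution_multipliers.
Variable R : realType.
Notation haar := (@haar R).

(** Convolution by Q maps measures to integrable functions with norm at most q. *)
Definition smoothing (Q : int -> R) (q : R) :=
  forall mu : {charge set (circle R) -> \bar R[i]}, exists h, [/\ integrableC haar h,
    (forall j, fourier_fun h j = (Q j)%:C * fourier_measure mu j) &
    \int[haar]_z normc (h z) <= q * var_norm mu].

Lemma smoothingB Q q Q' q' : smoothing Q q -> smoothing Q' q' ->
  smoothing (fun j => Q j - Q' j) (q + q').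
Proof.
move=> sQ sQ' mu; have [h [hi hE hn]] := sQ mu; have [h' [hi' hE' hn']] := sQ' mu.
exists (fun z => h z + (-1) * h' z); split.
- by apply: integrableCD => //; exact: integrableCZ.
- move=> j; rewrite (fourier_funD _ hi (integrableCZ _ hi')) (fourier_funZ _ _ hi').
  by rewrite hE hE' rmorphB/=; ring.
- apply: le_trans (Rintegral_normcD hi (integrableCZ _ hi')) _.
  rewrite (Rintegral_normcZ _ hi') normcN normc_one mul1r mulrDl; exact: lerD.
Qed.

Variables (Q : nat -> int -> R) (q : nat -> R).
Hypothesis Qsmooth : forall k, smoothing (Q k) (q k).
Hypothesis Qfinite : forall k j, (`|j| < k)%N -> Q k j = 0.

(** The multiplier sum_k c k * Q k; by Qfinite the terms beyond |j| vanish at j. *)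
Definition multiplier (c : nat -> R[i]) (j : int) : R[i] :=
  \sum_(k < `|j|.+1) c k * (Q k j)%:C.

Lemma multiplierE (c : nat -> R[i]) (j : int) n : (`|j| < n)%N ->
  \sum_(k < n) c k * (Q k j)%:C = multiplier c j.
Proof.
move=> jn; rewrite /multiplier -(big_mkord xpredT (fun k => c k * (Q k j)%:C)).
rewrite (big_cat_nat (n := `|j|.+1))//= big_mkord.
have -> : \sum_(`|j|.+1 <= k < n) c k * (Q k j)%:C = 0; last by rewrite addr0.
rewrite big_nat_cond big1// => k; rewrite andbT => /andP[jk _].
by rewrite Qfinite// mulr0.
Qed.

(** The series sum_k c k * Q k * mu converges absolutely in L1. Its Fourier
    coefficients are the limits of those of its partial sums, which are eventually
    constant in each coordinate. *)
Lemma multiplier_E_L1 (c : nat -> R[i]) (B : R) x :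
  (forall n, \sum_(k < n) normc (c k) * q k <= B) -> carrier (E_space R) x ->
  carrier (L1T R) (fun j => multiplier c j * x j) /\
  normS (L1T R) (fun j => multiplier c j * x j) <= B * normS (E_space R) x.
Proof.
move=> cB Ex.
have B0 : 0 <= B by have := cB 0%N; rewrite big_ord0.
have key (mu : {charge set (circle R) -> \bar R[i]}) : fourier_measure mu = x ->
    exists h, [/\ integrableC haar h, fourier_fun h = (fun j => multiplier c j * x j) &
    \int[haar]_z normc (h z) <= B * var_norm mu].
  move=> mE.
  pose h k := projT1 (cid (Qsmooth k mu)).
  have hP k : [/\ integrableC haar (h k),
    (forall j, fourier_fun (h k) j = (Q k j)%:C * fourier_measure mu j) &
    \int[haar]_z normc (h k z) <= q k * var_norm mu] by exact: projT2 (cid (Qsmooth k mu)).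
  have hi k : integrableC haar (h k) by have [] := hP k.
  pose u k z := c k * h k z.
  have ui k : integrableC haar (u k) by exact: integrableCZ.
  have uB n : \sum_(k < n) \int[haar]_z normc (u k z) <= B * var_norm mu.
    apply: (@le_trans _ _ ((\sum_(k < n) normc (c k) * q k) * var_norm mu)); last first.
      by apply: ler_wpM2r; [exact: var_norm_ge0|exact: cB].
    rewrite mulr_suml; apply: ler_sum => k _; rewrite (Rintegral_normcZ _ (hi k)) -mulrA.
    by apply: ler_wpM2l; [exact: normc_ge0|have [] := hP k].
  have [g gi gS] := L1_series ui uB.
  have Si n : integrableC haar (fun z => \sum_(k < n) u k z) by exact: integrableC_sum.
  have FS n j : (`|j| < n)%N -> fourier_fun (fun z => \sum_(k < n) u k z) j = multiplier c j * x j.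
    move=> jn; rewrite fourier_fun_sum// -(multiplierE c jn) mulr_suml; apply: eq_bigr => k _.
    by rewrite (fourier_funZ _ _ (hi k)); have [_ -> _] := hP k; rewrite mE mulrA.
  exists g; split => //.
    apply: funext => j; apply: (@eq_of_small _ _ _ 1) => // e e0; rewrite mul1r.
    have [N hN] := gS _ e0; rewrite -(FS (maxn N `|j|.+1) j); last by rewrite leq_max ltnSn orbT.
    rewrite -(fourier_funB _ gi (Si _)).
    apply: le_trans (normc_fourier_fun_le _ (integrableCB gi (Si _))) _.
    by apply: hN; rewrite leq_maxl.
  apply/ler_addgt0Pr => e e0; have [N hN] := gS _ e0.
  have E z : g z = \sum_(k < N) u k z + (g z - \sum_(k < N) u k z) by ring.
  rewrite (eq_Rintegral _ _ (g := fun z => normc (\sum_(k < N) u k z + (g z - \sum_(k < N) u k z)))); last by move=> z _; rewrite -E.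
  apply: le_trans (Rintegral_normcD (Si N) (integrableCB gi (Si N))) _.
  apply: lerD; last exact: hN.
  apply: le_trans (uB N); elim: (N) => [|n IH].
    under eq_Rintegral do rewrite big_ord0 normc_zero.
    by rewrite Rintegral_cst// mul0r big_ord0.
  under eq_Rintegral do rewrite big_ord_recr/=.
  apply: le_trans (Rintegral_normcD (Si n) (ui n)) _.
  by rewrite big_ord_recr/= lerD2r.
split.
  have [mu _ mE] := Ex; have [h [hi hE _]] := key mu mE.
  by exists h.
apply/ler_addgt0Pr => e e0.
have B1 : 0 < B + 1 by rewrite ltr_wpDl.
have [mu mE hm] := E_norm_approx Ex (divr_gt0 e0 B1).
have [h [hi hE hn]] := key mu mE.
rewrite -[in leLHS]hE; apply: le_trans (L1_norm_le hi) _; apply: le_trans hn _.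
apply: le_trans (ler_wpM2l B0 (ltW hm)) _; rewrite mulrDr lerD2l.
exact: mul_div_succ_le.
Qed.

End convolution_multipliers.

(** * Calderon couples with c0 as second space *)

Section epsilon_delta.
Variable R : realType.

Lemma nbhs_normcP (P : R[i] -> Prop) (z : R[i]) :
  nbhs z P <-> exists2 d : R, 0 < d & forall w, normc (w - z) < d -> P w.
Proof.
split.
  move=> /(@nbhs_ballP R[i] R[i]) [[d d'] /= dd' hd].
  have [d'0 d0] : d' = 0 /\ 0 < d by move: dd'; rewrite ltcE/= => /andP[/eqP].
  exists d => // w wz; apply: hd; rewrite /ball/= d'0 norm_complexE ltcR normcB //.
move=> [d d0 hd]; apply/(@nbhs_ballP R[i] R[i]); exists d%:C; first by rewrite /= ltcR.
by move=> w; rewrite /ball/= norm_complexE ltcR normcB; exact: hd.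
Qed.

Lemma cvg0_ge0P {T} {F : set_system T} {FF : Filter F} (u : T -> R) :
  (forall t, 0 <= u t) ->
  (u @ F --> (0 : R)) <-> (forall e : R, 0 < e -> \forall t \near F, u t <= e).
Proof.
move=> u0; rewrite cvgr0Pnorm_le; split=> h e e0; have := h _ e0;
  by apply: filterS => t; rewrite ger0_norm.
Qed.

Lemma cvg_withinP (D : set R[i]) z (u : R[i] -> R) : (forall w, 0 <= u w) ->
  (u w @[w --> within D (nbhs z)] --> (0 : R)) <->
  (forall e : R, 0 < e -> exists2 d : R, 0 < d &
    forall w, D w -> normc (w - z) < d -> u w <= e).
Proof.
move=> u0; rewrite (cvg0_ge0P u0); split=> h e e0.
  have := h _ e0; rewrite near_withinE => /nbhs_normcP[d d0 hd].
  by exists d => // w Dw wd; exact: hd.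
have [d d0 hd] := h _ e0; rewrite near_withinE; apply/nbhs_normcP.
by exists d => // w wd Dw; exact: hd.
Qed.

Lemma cvg_dnbhs0P (u : R[i] -> R) : (forall w, 0 <= u w) ->
  (u h @[h --> (0 : R[i])^'] --> (0 : R)) <->
  (forall e : R, 0 < e -> exists2 d : R, 0 < d &
    forall h, h != 0 -> normc h < d -> u h <= e).
Proof.
move=> u0; rewrite /dnbhs (cvg_withinP _ _ u0); split=> h e e0;
  have [d d0 hd] := h _ e0; exists d => // w w0.
  by move=> wd; apply: hd => //; rewrite subr0.
by rewrite subr0; exact: hd.
Qed.

End epsilon_delta.

Section calderon_couples.
Variable R : realType.
Implicit Types (A : normed_sub (int -> R[i])) (f : R[i] -> int -> R[i]).
Notation c0 := (c0Z R).

Lemma sum_c0_carrier A x : subordinate A -> carrier (sum_sub A c0) x <-> small_tails x.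
Proof.
move=> sA; split=> [[a0 [a1 [/(sub_tails sA) t0 /c0_carrierE t1 ->]]]|tx].
  exact: small_tails_add.
exists 0, x; split; [exact: sub_carrier0|exact/c0_carrierE|by rewrite add0r].
Qed.

(** Since the norm of A dominates the supremum norm, nothing is gained by
    splitting an element of c0. *)
Lemma sum_c0_norm A x : subordinate A -> small_tails x ->
  normS (sum_sub A c0) x = normS c0 x.
Proof.
move=> sA tx; apply/eqP; rewrite eq_le; apply/andP; split.
  apply: ge_inf.
    exists 0 => _ [a0 [a1 [A0 _ _ ->]]]; apply: addr_ge0; first exact: sub_norm_ge0.
    exact: c0_norm_ge0.
  exists 0, x; split; [exact: sub_carrier0|exact/c0_carrierE|by rewrite add0r|].
  by rewrite (sub_norm0 sA) add0r.
apply: lb_le_inf.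
  exists (normS A 0 + normS c0 x), 0, x.
  by split; [exact: sub_carrier0|exact/c0_carrierE|rewrite add0r|].
move=> _ [a0 [a1 [A0 /c0_carrierE A1 -> ->]]]; apply: c0_norm_le => j.
apply: le_trans (le_normcD (a0 j) (a1 j)) _; apply: lerD; first exact: sub_norm_sup.
exact: c0_norm_ge.
Qed.

Lemma sum_norm_ge0 A x : subordinate A -> 0 <= normS (sum_sub A c0) x.
Proof.
move=> sA; rewrite /normS/=; set S := [set r | _].
have [[r Sr]|/set0P/negP/negPn/eqP ->] := pselect (S !=set0); last by rewrite inf0.
apply: lb_le_inf; first by exists r.
move=> _ [a0 [a1 [_ _ _ ->]]]; apply: addr_ge0; first exact: sub_norm_ge0.
exact: c0_norm_ge0.
Qed.

(** The conditions on the strip, which are the same for all the couples (A, c0). *)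
Definition strip_regular f := [/\
  forall z, closed_strip z -> small_tails (f z),
  exists M : R, forall z, closed_strip z -> normS c0 (f z) <= M,
  forall z0, closed_strip z0 -> forall e : R, 0 < e -> exists2 d : R, 0 < d &
    forall z, closed_strip z -> normc (z - z0) < d -> normS c0 (f z - f z0) <= e &
  forall z0, open_strip z0 -> exists2 l, small_tails l &
    forall e : R, 0 < e -> exists2 d : R, 0 < d &
    forall h, h != 0 -> normc h < d ->
      normS c0 (h^-1 *: (f (z0 + h) - f z0) - l) <= e].

Definition boundary_regular A (g : R -> int -> R[i]) := [/\
  forall t, carrier A (g t),
  forall t0 (e : R), 0 < e -> exists2 d : R, 0 < d &
    forall t, `|t - t0| < d -> normS A (g t - g t0) <= e &
  forall e : R, 0 < e -> exists T : R, forall t, T < `|t| -> normS A (g t) <= e].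

Lemma boundary_regularP A g : subordinate A -> C0_boundary A g <-> boundary_regular A g.
Proof.
move=> sA; have n0 x := sub_norm_ge0 sA x.
split=> -[h1 h2 h3]; last first.
  split => //.
  - move=> t0; apply/(cvg0_ge0P (u := fun t => normS A (g t - g t0))) => // e e0.
    have [d d0 hd] := h2 t0 _ e0; apply/nbhs_ballP; exists d => // t.
    by rewrite /ball/= distrC; exact: hd.
  - apply/(cvg0_ge0P (u := fun t => normS A (g t))) => // e e0; have [T hT] := h3 _ e0.
    exists T; split; [exact: num_real|move=> t Tt; apply: hT].
    exact: lt_le_trans Tt (ler_norm _).
  - apply/(cvg0_ge0P (u := fun t => normS A (g t))) => // e e0; have [T hT] := h3 _ e0.
    exists (- T); split; [exact: num_real|move=> t Tt; apply: hT].
    by rewrite -normrN; apply: lt_le_trans (ler_norm _); lra.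
move=> h4; split => //.
- move=> t0 e e0; have /(cvg0_ge0P (u := fun t => normS A (g t - g t0))) := h2 t0.
  move=> /(_ (fun _ => n0 _) _ e0) /nbhs_ballP[d d0 hd]; exists d => // t td; apply: hd.
  by rewrite /ball/= distrC.
- move=> e e0.
  have /(cvg0_ge0P (u := fun t => normS A (g t))) := h3.
  move=> /(_ (fun _ => n0 _) _ e0) [T1 [_ hT1]].
  have /(cvg0_ge0P (u := fun t => normS A (g t))) := h4.
  move=> /(_ (fun _ => n0 _) _ e0) [T2 [_ hT2]].
  exists (Num.max T1 (- T2)) => t; rewrite gt_max => /andP[t1 t2].
  have [t0|t0] := leP 0 t; first by apply: hT1; rewrite -(ger0_norm t0).
  by apply: hT2; rewrite (ltr0_norm t0) ltrN2 in t2.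
Qed.

Lemma open_strip_near (z0 : R[i]) : open_strip z0 -> exists2 d : R, 0 < d &
  forall w, normc (w - z0) < d -> open_strip w.
Proof.
rewrite /open_strip/= => /andP[z0l z0r].
exists (Num.min (complex.Re z0) (1 - complex.Re z0)).
  by rewrite lt_min z0l subr_gt0.
move=> w; rewrite lt_min => /andP[w1 w2].
have := ler_norm_Re (w - z0); rewrite Re_sub ler_norml => /andP[a1 a2].
by apply/andP; split; lra.
Qed.

Lemma open_closed_strip (z : R[i]) : open_strip z -> closed_strip z.
Proof. by rewrite /open_strip /closed_strip/= => /andP[/ltW -> /ltW ->]. Qed.

Lemma small_tails_scale (c : R[i]) (x : int -> R[i]) : small_tails x -> small_tails (c *: x).
Proof.
move=> tx e e0; have c1 : 0 < normc c + 1 by rewrite ltr_wpDl ?normc_ge0.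
have [N hN] := tx _ (divr_gt0 e0 c1); exists N => j /hN h.
have -> : (c *: x) j = c * x j by [].
rewrite normcM; apply: le_trans (ler_wpM2l (normc_ge0 c) h) _.
exact: mul_div_succ_le (normc_ge0 c) e0.
Qed.

Lemma calderonP A f : subordinate A ->
  calderon A c0 f <-> [/\ strip_regular f, boundary_regular A (fun t => f (0 +i* t)) &
    boundary_regular c0 (fun t => f (1 +i* t))].
Proof.
move=> sA; have s0 := c0_subordinate R.
have n0 x := sum_norm_ge0 x sA.
have cN x : small_tails x -> normS (sum_sub A c0) x = normS c0 x := sum_c0_norm sA.
split=> [[h1 h2 h3 h4 [b1 b2]]|[[h1 h2 h3 h4] b1 b2]].
  have t1 z : closed_strip z -> small_tails (f z) by move=> /h1 /(sum_c0_carrier _ sA).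
  split; [|exact/boundary_regularP|exact/boundary_regularP].
  split => //.
  - have [M hM] := h2; exists M => z cz; rewrite -cN; [exact: hM|exact: t1].
  - move=> z0 cz0 e e0; have /(cvg_withinP _ _ (u := fun z => normS (sum_sub A c0) (f z - f z0))) := h3 z0 cz0.
    move=> /(_ (fun _ => n0 _) _ e0) [d d0 hd]; exists d => // z cz zd.
    by rewrite -cN; [exact: hd|apply: small_tails_sub; exact: t1].
  - move=> z0 oz0; have [l /(sum_c0_carrier _ sA) tl hl] := h4 z0 oz0; exists l => // e e0.
    have [d1 d10 hd1] := open_strip_near oz0.
    have /(cvg_dnbhs0P (u := fun h => normS (sum_sub A c0) (h^-1 *: (f (z0 + h) - f z0) - l))) := hl.
    move=> /(_ (fun _ => n0 _) _ e0) [d d0 hd]; exists (Num.min d d1); first by rewrite lt_min d0.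
    move=> h hn0; rewrite lt_min => /andP[hd2 hd3]; rewrite -cN; first exact: hd.
    apply: small_tails_sub => //; apply: small_tails_scale; apply: small_tails_sub; apply: t1.
      by apply/open_closed_strip/hd1; rewrite (_ : z0 + h - z0 = h)//; ring.
    exact: open_closed_strip.
split.
- by move=> z cz; apply/(sum_c0_carrier _ sA); exact: h1.
- have [M hM] := h2; exists M => z cz; rewrite cN; [exact: hM|exact: h1].
- move=> z0 cz0; apply/(cvg_withinP _ _ (u := fun z => normS (sum_sub A c0) (f z - f z0))) => // e e0.
  have [d d0 hd] := h3 _ cz0 _ e0; exists d => // z cz zd.
  by rewrite cN; [exact: hd|apply: small_tails_sub; exact: h1].
- move=> z0 oz0; have [l tl hl] := h4 z0 oz0; exists l; first exact/(sum_c0_carrier _ sA).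
  apply/(cvg_dnbhs0P (u := fun h => normS (sum_sub A c0) (h^-1 *: (f (z0 + h) - f z0) - l))) => // e e0.
  have [d1 d10 hd1] := open_strip_near oz0.
  have [d d0 hd] := hl _ e0; exists (Num.min d d1); first by rewrite lt_min d0.
  move=> h hn0; rewrite lt_min => /andP[hd2 hd3]; rewrite cN; first exact: hd.
  apply: small_tails_sub => //; apply: small_tails_scale; apply: small_tails_sub; apply: h1.
    by apply/open_closed_strip/hd1; rewrite (_ : z0 + h - z0 = h)//; ring.
  exact: open_closed_strip.
- by split; exact/boundary_regularP.
Qed.

(** The norm is locally bounded by the triangle inequality, hence bounded on compact
    intervals, and it is small outside of one. *)
Lemma boundary_regular_bounded A g : subordinate A -> boundary_regular A g ->
  has_ubound (range (fun t : R => normS A (g t))).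
Proof.
move=> sA [h1 h2 h3]; have [T hT] := h3 1 ltr01.
have := @segment_compact R (- T) T; rewrite compact_near_coveringP => cK.
have [N _ hN] : \forall n \near \oo, `[- T, T] `<=` (fun t => normS A (g t) <= n%:R).
  apply: cK => t0 _; have [d d0 hd] := h2 t0 1 ltr01.
  exists (ball t0 d, [set n | normS A (g t0) + 1 <= n%:R]).
    split; first exact: nbhsx_ballx.
    exists (Num.truncn (normS A (g t0) + 1)).+1 => // n /= hn.
    by apply/ltW/(lt_le_trans (truncnS_gt _)); rewrite ler_nat.
  move=> [t n] [/= td hn]; apply: le_trans (sub_norm_triangle sA (h1 t) (h1 t0)) _.
  by apply: le_trans hn; rewrite lerD2l; apply: hd; rewrite distrC.
exists (Num.max 1 N%:R) => _ [t _ <-]; rewrite le_max.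
have [tT|tT] := ltP T `|t|; first by rewrite hT.
have := hN N (leqnn N) t; move=> -> //; rewrite ?orbT//.
by rewrite /= in_itv/= -ler_norml.
Qed.

Lemma calderon_norm_le A f (B : R) :
  (forall t : R, normS A (f (0 +i* t)) <= B) -> (forall t : R, normS c0 (f (1 +i* t)) <= B) ->
  calderon_norm A c0 f <= B.
Proof.
move=> h1 h2; rewrite /calderon_norm ge_max; apply/andP; split; apply: ge_sup.
- by exists (normS A (f (0 +i* 0))), 0.
- by move=> _ [t _ <-].
- by exists (normS c0 (f (1 +i* 0))), 0.
- by move=> _ [t _ <-].
Qed.

Lemma calderon_norm_ge0line A f t : subordinate A -> calderon A c0 f ->
  normS A (f (0 +i* t)) <= calderon_norm A c0 f.
Proof.
move=> sA /(calderonP _ sA) [_ b1 _]; rewrite /calderon_norm le_max; apply/orP; left.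
by apply: ub_le_sup; [exact: boundary_regular_bounded|exists t].
Qed.

Lemma calderon_norm_ge1line A f t : subordinate A -> calderon A c0 f ->
  normS c0 (f (1 +i* t)) <= calderon_norm A c0 f.
Proof.
move=> sA /(calderonP _ sA) [_ _ b2]; rewrite /calderon_norm le_max; apply/orP; right.
by apply: ub_le_sup; [exact: (boundary_regular_bounded (c0_subordinate R))|exists t].
Qed.

Lemma calderon_norm_ge0 A f : subordinate A -> calderon A c0 f -> 0 <= calderon_norm A c0 f.
Proof.
by move=> sA cf; apply: le_trans (calderon_norm_ge0line 0 sA cf); exact: sub_norm_ge0.
Qed.

(** A loss of an arbitrary e disappears in the infimum defining the norm. *)
Lemma interpolation_norm_le A A' theta x : subordinate A' ->
  (forall f, calderon A c0 f -> f theta%:C = x -> forall e : R, 0 < e ->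
    exists g, [/\ calderon A' c0 g, g theta%:C = x &
      calderon_norm A' c0 g <= calderon_norm A c0 f + e]) ->
  carrier (complex_interpolation A c0 theta) x ->
  carrier (complex_interpolation A' c0 theta) x /\
  normS (complex_interpolation A' c0 theta) x <= normS (complex_interpolation A c0 theta) x.
Proof.
move=> sA' H [f cf fx]; split.
  by have [g [cg gx _]] := H f cf fx 1 ltr01; exists g.
apply: lb_le_inf; first by exists (calderon_norm A c0 f), f.
move=> _ [k [ck kx] <-]; apply/ler_addgt0Pr => e e0.
have [g [cg gx gn]] := H k ck kx e e0; apply: le_trans gn.
apply: ge_inf; last by exists g.
by exists 0 => _ [g' [cg' _] <-]; exact: calderon_norm_ge0.
Qed.

End calderon_couples.

(** * Functions on the strip with values in c0 *)

Section strip_criterion.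
Variable R : realType.
Implicit Types (f G : R[i] -> int -> R[i]) (z : R[i]) (j : int).

(** Here m a b improves on both a and b, like the minimum of two radii. *)
Lemma finite_uniform (C : R -> Prop) (m : R -> R -> R) (P : R -> int -> Prop) :
  (forall a b, C a -> C b -> C (m a b)) ->
  (forall a b j, P a j -> P (m a b) j) -> (forall a b j, P b j -> P (m a b) j) ->
  (forall j, exists2 a, C a & P a j) ->
  forall N : nat, exists2 a, C a & forall j, (`|j| < N)%N -> P a j.
Proof.
move=> hC hL hR H; elim=> [|N [a Ca Pa]]; first by have [a Ca _] := H 0; exists a.
have [b Cb Pb] := H N%:Z; have [c Cc Pc] := H (- N%:Z).
exists (m a (m b c)).
  have Cbc := hC _ _ Cb Cc.
  exact: hC.
move=> j; rewrite ltnS leq_eqVlt => /predU1P[jN|jN]; last exact: hL (Pa _ jN).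
have [->|->] : j = N%:Z \/ j = - N%:Z by lia.
  exact: hR (hL _ _ _ Pb).
exact: hR (hR _ _ _ Pc).
Qed.

Lemma finite_uniform_min (P : R -> int -> Prop) :
  (forall a b j, b <= a -> P a j -> P b j) ->
  (forall j, exists2 a, 0 < a & P a j) ->
  forall N : nat, exists2 a, 0 < a & forall j, (`|j| < N)%N -> P a j.
Proof.
move=> Pm; apply: (finite_uniform (m := Num.min)).
- by move=> a b a0 b0; rewrite lt_min a0.
- by move=> a b j; apply: Pm; rewrite ge_min lexx.
- by move=> a b j; apply: Pm; rewrite ge_min lexx orbT.
Qed.

Lemma finite_uniform_max (P : R -> int -> Prop) :
  (forall a b j, a <= b -> P a j -> P b j) ->
  (forall j, exists a, P a j) ->
  forall N : nat, exists a, forall j, (`|j| < N)%N -> P a j.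
Proof.
move=> Pm H N; have [] := @finite_uniform (fun=> True) Num.max P _ _ _ _ N => //.
- by move=> a b j; apply: Pm; rewrite le_max lexx.
- by move=> a b j; apply: Pm; rewrite le_max lexx orbT.
- by move=> j; have [a Pa] := H j; exists a.
- by move=> a _ h; exists a.
Qed.

Definition uniform_tails G := forall e : R, 0 < e -> exists N : nat,
  forall z, closed_strip z -> forall j, (N <= `|j|)%N -> normc (G z j) <= e.

(** In c0, uniformly small tails upgrade coordinatewise statements to norm
    statements; for differentiability the tail is controlled by the Cauchy
    estimate on a disc inside the strip. *)
Lemma strip_regular_coordinates G :
  (forall j z, closed_strip z -> ccont (@closed_strip R) (G ^~ j) z) ->
  (forall j z, open_strip z -> exists l, cderive (G ^~ j) z l) ->
  uniform_tails G ->
  (exists M : R, forall z, closed_strip z -> forall j, normc (G z j) <= M) ->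
  strip_regular G.
Proof.
move=> Gc Gd Gt [M GM]; split.
- by move=> z cz e e0; have [N hN] := Gt _ e0; exists N => j; exact: hN.
- by exists M => z cz; apply: c0_norm_le => j; exact: GM.
- move=> z0 cz0 e e0; have e2 : 0 < e / 2 by lra.
  have [N hN] := Gt _ e2.
  have [] := @finite_uniform_min (fun d j => forall z, closed_strip z -> normc (z - z0) < d ->
    normc (G z j - G z0 j) <= e) _ _ N.
  + by move=> a b j ba h z cz zb; apply: h => //; exact: lt_le_trans ba.
  + by move=> j; have [d d0 hd] := Gc j z0 cz0 _ e0; exists d.
  move=> d d0 hd; exists d => // z cz zd; apply: c0_norm_le => j.
  have -> : (G z - G z0) j = G z j - G z0 j by [].
  have [Nj|jN] := leqP N `|j|; last exact: hd.
  have := le_normcB (G z j) (G z0 j); have := hN _ cz _ Nj; have := hN _ cz0 _ Nj; lra.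
move=> z0 oz0; have [r r0 hr] := open_strip_near oz0.
pose l j := projT1 (cid (Gd j z0 oz0)).
have lP j : cderive (G ^~ j) z0 (l j) by exact: projT2 (cid (Gd j z0 oz0)).
have holo j w : normc (w - z0) < r -> exists m, cderive (G ^~ j) w m.
  by move=> /hr; exact: Gd.
have tailC (e : R) : 0 < e -> exists N : nat, forall j, (N <= `|j|)%N ->
    forall w, normc (w - z0) < r -> normc (G w j) <= e.
  move=> e0; have [N hN] := Gt _ e0; exists N => j Nj w /hr /open_closed_strip cw.
  exact: hN.
exists l.
  move=> e e0; have [N hN] := tailC (e * r / 8) ltac:(by rewrite divr_gt0// mulr_gt0).
  exists N => j Nj.
  have -> : e = 8 * (e * r / 8 / r) by field; rewrite gt_eqF.
  exact: (cauchy_estimate r0 (holo j) (hN j Nj) (lP j)).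
move=> e e0; have [N hN] := tailC (e * r / 40) ltac:(by rewrite divr_gt0// mulr_gt0).
have [] := @finite_uniform_min (fun d j => forall h, normc h < d ->
    normc (G (z0 + h) j - G z0 j - l j * h) <= e * normc h) _ _ N.
- by move=> a b j ba H h hb; apply: H; exact: lt_le_trans ba.
- by move=> j; have [d d0 hd] := lP j _ e0; exists d.
move=> d d0 hd; exists (Num.min d (r / 2)); first by rewrite lt_min d0 divr_gt0.
move=> h h0; rewrite lt_min => /andP[h1 h2]; apply: c0_norm_le => j.
have -> : (h^-1 *: (G (z0 + h) - G z0) - l) j = h^-1 * (G (z0 + h) j - G z0 j - l j * h).
  transitivity (h^-1 * (G (z0 + h) j - G z0 j) - l j) => //.
  by rewrite [RHS]mulrBr [l j * h]mulrC mulKf.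
rewrite normcM normcV mulrC ler_pdivrMr ?normc_gt0//.
have [Nj|jN] := leqP N `|j|; last exact: hd.
apply: le_trans (cauchy_remainder r0 (holo j) (hN j Nj) (lP j) h2) _.
rewrite ler_wpM2r ?normc_ge0// le_eqVlt; apply/orP; left; apply/eqP.
by field; rewrite gt_eqF.
Qed.

Section consequences.
Variable f : R[i] -> int -> R[i].
Hypothesis sf : strip_regular f.

Lemma strip_coord_cont j z : closed_strip z -> ccont (@closed_strip R) (f ^~ j) z.
Proof.
have [t _ c _] := sf; move=> cz e e0; have [d d0 hd] := c _ cz _ e0.
exists d => // w cw wd; apply: le_trans (hd _ cw wd).
by apply: (@c0_norm_ge _ (f w - f z) j); apply: small_tails_sub; exact: t.
Qed.

Lemma strip_coord_derive j z : open_strip z -> exists l, cderive (f ^~ j) z l.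
Proof.
have [t _ _ D] := sf; move=> oz; have [l tl hl] := D _ oz; exists (l j) => e e0.
have [d1 d10 hd1] := open_strip_near oz.
have [d d0 hd] := hl _ e0; exists (Num.min d d1); first by rewrite lt_min d0.
move=> h; rewrite lt_min => /andP[h1 h2].
have [->|hn0] := eqVneq h 0.
  by rewrite addr0 subrr mulr0 subr0 normc_zero mulr0.
have nh : 0 < normc h by rewrite normc_gt0.
have tt : small_tails (h^-1 *: (f (z + h) - f z) - l).
  apply: small_tails_sub => //; apply: small_tails_scale; apply: small_tails_sub; apply: t.
    by apply/open_closed_strip/hd1; rewrite (_ : z + h - z = h)//; ring.
  exact: open_closed_strip.
have := le_trans (c0_norm_ge j tt) (hd _ hn0 h1).
rewrite -(ler_pM2r nh) -normcM; apply: le_trans; rewrite le_eqVlt; apply/orP; left; apply/eqP.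
congr normc; have -> : (h^-1 *: (f (z + h) - f z) - l) j = h^-1 * (f (z + h) j - f z j) - l j by [].
by field.
Qed.

Lemma strip_bounded : exists2 M : R, 0 <= M & forall z, closed_strip z -> forall j, normc (f z j) <= M.
Proof.
have [t [M hM] _ _] := sf; exists (Num.max 0 M); first by rewrite le_max lexx.
move=> z cz j; apply: le_trans (c0_norm_ge j (t _ cz)) _; apply: le_trans (hM _ cz) _.
by rewrite le_max lexx orbT.
Qed.

(** The tail bound at a point extends to a neighbourhood by continuity into c0, and
    finitely many neighbourhoods cover the bounded part of the strip. *)
Lemma compact_tails (Y e : R) : 0 < e -> exists N : nat, forall z, closed_strip z ->
  `|complex.Im z| <= Y -> forall j, (N <= `|j|)%N -> normc (f z j) <= e.
Proof.
move=> e0; have e2 : 0 < e / 2 by lra.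
have [t _ c _] := sf.
have cK : compact (`[0 : R, 1] `*` `[- Y, Y]).
  by apply: compact_setX; exact: segment_compact.
move: cK; rewrite compact_near_coveringP => cK.
have [N _ hN] : \forall N \near \oo, `[0 : R, 1] `*` `[- Y, Y] `<=`
    (fun u : R * R => 0 <= u.1 <= 1 -> forall j, (N <= `|j|)%N -> normc (f (u.1 +i* u.2) j) <= e).
  apply: cK => -[x y] [/= x01 yY]; rewrite in_itv/= in x01.
  have cz : closed_strip (x +i* y) by [].
  have [d d0 hd] := c _ cz _ e2; have [N hN] := t _ cz _ e2.
  have d2 : 0 < d / 2 by lra.
  exists (ball x (d / 2) `*` ball y (d / 2), [set n | (N <= n)%N]).
    split; last by exists N.
    by exists (ball x (d / 2), ball y (d / 2)) => //; split; exact: nbhsx_ballx.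
  move=> [[x' y'] n] [/= [xx' yy'] Nn] x'01 j nj.
  have cz' : closed_strip (x' +i* y') by [].
  have near : normc (x' +i* y' - (x +i* y)) < d.
    apply: le_lt_trans (normc_le_ReIm _) _; rewrite /= [d]splitr.
    by apply: ltrD; rewrite distrC.
  have h1 := le_trans (c0_norm_ge j (small_tails_sub (t _ cz') (t _ cz))) (hd _ cz' near).
  have h2 := hN j (leq_trans Nn nj).
  have := le_normc_diff (f (x' +i* y') j) (f (x +i* y) j).
  have -> : f (x' +i* y') j - f (x +i* y) j = (f (x' +i* y') - f (x +i* y)) j by [].
  lra.
exists N => z cz zY j Nj; have := hN N (leqnn N) (complex.Re z, complex.Im z).
have -> : complex.Re z +i* complex.Im z = z by case: (z).
apply => //; split; rewrite /= in_itv//=.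
by rewrite -ler_norml.
Qed.

Variables (theta delta : R).
Hypothesis delta0 : 0 < delta.

(** The Gaussian factor has the value 1 at theta, modulus at most 1 on the line
    Re z = 0, and decays as |Im z| grows. *)
Definition damping z : R[i] := cexp (delta%:C * (z * z - (theta ^+ 2)%:C)).

Lemma normc_damping z : normc (damping z) =
  expR (delta * (complex.Re z ^+ 2 - complex.Im z ^+ 2 - theta ^+ 2)).
Proof.
rewrite /damping normc_cexp; congr expR; rewrite Re_mul Re_sub Re_mul /=; ring.
Qed.

Lemma damping_theta : damping theta%:C = 1.
Proof. by rewrite /damping -rmorphM -rmorphB -rmorphM -expr2 subrr mulr0 cexp0. Qed.

Lemma normc_damping_le0 t : normc (damping (0 +i* t)) <= 1.
Proof.
rewrite normc_damping -expR0 ler_expR /=.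
apply: mulr_ge0_le0; first exact: ltW.
have := sqr_ge0 t; have := sqr_ge0 theta; rewrite expr0n /=; lra.
Qed.

Lemma normc_damping_le z : closed_strip z -> normc (damping z) <= expR delta.
Proof.
move=> /andP[z0 z1]; rewrite normc_damping ler_expR; apply: ler_piMr; first exact: ltW.
have := sqr_ge0 (complex.Im z); have := sqr_ge0 theta.
have : complex.Re z ^+ 2 <= 1 by rewrite expr_le1.
lra.
Qed.

Lemma damping_cderive z : exists l, cderive damping z l.
Proof.
eexists; apply: cderive_cexp_comp; apply: cderiveM; first exact: cderive_cst.
apply: cderiveD; last exact: cderive_cst.
apply: cderiveM; exact: cderive_id.
Qed.

(** For large |Im z| the decay of the factor suffices, and compact_tails covers the
    rest of the strip. *)
Lemma damped_uniform_tails : uniform_tails (fun z j => damping z * f z j).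
Proof.
move=> e e0; have [M M0 hM] := strip_bounded.
have ed0 := expR_gt0 delta.
pose B := expR delta * M / e.
have B0 : 0 <= B by rewrite /B divr_ge0 ?mulr_ge0// ltW.
pose Y := Num.max 1 (B / delta).
have e1 : 0 < e / expR delta by rewrite divr_gt0.
have [N hN] := compact_tails Y e1; exists N => z cz j Nj; rewrite normcM.
have [zY|zY] := leP `|complex.Im z| Y.
  apply: le_trans (ler_pM (normc_ge0 _) (normc_ge0 _) (normc_damping_le cz) (hN _ cz zY _ Nj)) _.
  by rewrite mulrC divfK// gt_eqF.
have y1 : B <= delta * complex.Im z ^+ 2.
  have Y1 : 1 <= Y by rewrite le_max lexx.
  have YB : B <= delta * Y by rewrite mulrC -ler_pdivrMr// le_max lexx orbT.
  apply: le_trans YB _; rewrite ler_pM2l// -real_normK ?num_real// expr2.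
  apply: le_trans (ltW zY) _; rewrite ler_peMl//; lra.
have h : normc (damping z) <= expR delta * (1 + B)^-1.
  rewrite normc_damping; apply: (@le_trans _ _ (expR delta * expR (- B))).
    rewrite -expRD ler_expR; move: cz; rewrite /closed_strip/= => /andP[z0 z1].
    have : complex.Re z ^+ 2 <= 1 by rewrite expr_le1.
    have h1 := sqr_ge0 theta; move=> h2.
    have : delta * (complex.Re z ^+ 2 - theta ^+ 2) <= delta.
      by apply: ler_piMr; [exact: ltW|lra].
    lra.
  rewrite ler_pM2l// expRN lef_pV2 ?posrE ?expR_gt0//; first exact: expR_ge1Dx.
  by rewrite ltr_pwDl.
apply: le_trans (ler_pM (normc_ge0 _) (normc_ge0 _) h (hM _ cz j)) _.
rewrite mulrAC ler_pdivrMr ?ltr_pwDl//.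
have -> : expR delta * M = B * e by rewrite /B divfK// gt_eqF.
by rewrite mulrC ler_pM2l// lerDr.
Qed.

End consequences.

End strip_criterion.

(** * From measures to integrable functions *)

Section regularization.
Variable R : realType.
Notation c0 := (c0Z R).
Notation E := (E_space R).
Notation L1 := (L1T R).
Variables (theta delta eps : R) (s : nat) (a : nat -> R) (N : nat -> nat).
Variable f : R[i] -> int -> R[i].
Hypotheses (theta01 : 0 < theta < 1) (delta0 : 0 < delta) (eps0 : 0 < eps) (s0 : (0 < s)%N).
Hypothesis cf : calderon E c0 f.
Notation q := (1 + 2 / s%:R : R).
Notation damp := (damping theta delta).
Hypothesis a_ge0 : forall k, 0 <= a k.
Hypothesis a_large : forall k, expR (- (a k * theta)) * (q + q) <= eps / 2 ^+ k.+1.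
Hypothesis N_large : forall k z, closed_strip z -> forall j, (N k <= `|j|)%N ->
  expR (a k * (1 - theta)) * (q + q) * normc (damp z * f z j) <= eps / 2 ^+ k.+1.
Hypothesis N_ge : forall k, (k <= N k)%N.
Hypothesis N_gt0 : forall k, (0 < N k)%N.
Hypothesis N_mono : forall k l, (k <= l)%N -> (N k <= N l)%N.

Let q_ge0 : 0 <= q. Proof. by rewrite addr_ge0// divr_ge0. Qed.

Let sE : subordinate E := E_subordinate R.
Let sL : subordinate L1 := L1_subordinate R.
Let sf : strip_regular f. Proof. by have /(calderonP _ sE) [] := cf. Qed.
Let bf0 : boundary_regular E (fun t => f (0 +i* t)).
Proof. by have /(calderonP _ sE) [] := cf. Qed.
Let bf1 : boundary_regular c0 (fun t => f (1 +i* t)).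
Proof. by have /(calderonP _ sE) [] := cf. Qed.

(** The blocks P_0, P_1 - P_0, P_2 - P_1, ... add up to the identity. *)
Definition block k (j : int) : R :=
  if k is l.+1 then vallee_poussin R s (N l.+1) j - vallee_poussin R s (N l) j
  else vallee_poussin R s (N 0) j.

Definition block_norm (k : nat) : R := if k is _.+1 then q + q else q.

(** The coefficients of the blocks: all the exponentials are 1 at theta, they are
    small on the left of theta and large on the right. *)
Definition weight k (z : R[i]) : R[i] :=
  if k is l.+1 then damp z * cexp ((a l)%:C * (z - theta%:C)) else damp z.

Definition regularized (z : R[i]) (j : int) : R[i] :=
  multiplier block (fun k => weight k z) j * f z j.

Notation G := regularized.

Lemma block_smoothing k : smoothing (block k) (block_norm k).
Proof.
have V n : smoothing (vallee_poussin R s n) q by move=> mu; exact: vallee_poussin_smoothing.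
by case: k => [|k] /=; [exact: V|apply: smoothingB; exact: V].
Qed.

Lemma block_low k j : (`|j| <= N k)%N -> block k.+1 j = 0.
Proof.
move=> jN; rewrite /block !vallee_poussin_low ?subrr//.
by apply: leq_trans jN _; exact: N_mono.
Qed.

Lemma block_finite k j : (`|j| < k)%N -> block k j = 0.
Proof. by case: k => // k jk; apply: block_low; apply: leq_trans (N_ge k). Qed.

Lemma block_high K k j : (k <= K)%N -> (s.+1 * N K <= `|j|)%N -> block k j = 0.
Proof.
move=> kK h; have V l : (l <= K)%N -> vallee_poussin R s (N l) j = 0.
  by move=> lK; apply: vallee_poussin_high; apply: leq_trans h; rewrite leq_mul2l N_mono ?orbT.
by case: k kK => [|k] kK; rewrite /block ?V ?subrr// ltnW.
Qed.

Lemma block_bound k j : `|block k j| <= block_norm k.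
Proof.
have V n : `|vallee_poussin R s n j| <= q by exact: vallee_poussin_bound.
case: k => [|k] /=; first exact: V.
by apply: le_trans (ler_normB _ _) _; apply: lerD; exact: V.
Qed.

Lemma normc_weight k z : closed_strip z ->
  normc (weight k.+1 z) <= normc (damp z) * expR (a k * (1 - theta)).
Proof.
move=> /andP[_ z1]; rewrite normcM [X in _ * X]normc_cexp Re_mul Re_sub; apply: ler_wpM2l; first exact: normc_ge0.
by rewrite ler_expR /= mul0r subr0 ler_wpM2l// lerD2r.
Qed.

Lemma normc_weight0 k t : normc (weight k (0 +i* t)) <= if k is l.+1 then expR (- (a l * theta)) else 1.
Proof.
have /andP[t0 _] := theta01; have d1 := normc_damping_le0 theta delta0 t.
case: k => [|k] //; rewrite normcM [X in _ * X]normc_cexp Re_mul Re_sub.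
rewrite [complex.Re (a k)%:C]/= [complex.Im (a k)%:C]/= mul0r subr0.
by rewrite [complex.Re (0 +i* t)]/= sub0r mulrN ler_piMl// expR_ge0.
Qed.

Lemma half_pow_sum m n : \sum_(m <= k < m + n) eps / 2 ^+ k.+1 <= eps / 2 ^+ m.
Proof.
have -> : \sum_(m <= k < m + n) eps / 2 ^+ k.+1 = eps / 2 ^+ m - eps / 2 ^+ (m + n).
  elim: n => [|n IH]; first by rewrite addn0 big_geq// subrr.
  rewrite addnS big_nat_recr ?leq_addr//= IH exprS; field.
  by rewrite !expf_neq0.
by rewrite gerBl divr_ge0 ?exprn_ge0// ltW.
Qed.

(** The block kills the frequencies |j| <= N k, and N k is so large that beyond it
    damp * f compensates the size of the exponential. *)
Lemma term_bound k z j : closed_strip z ->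
  normc (weight k.+1 z * (block k.+1 j)%:C * f z j) <= eps / 2 ^+ k.+1.
Proof.
move=> cz; have [jN|Nj] := leqP `|j| (N k).
  by rewrite block_low// mulr0 mul0r normc_zero divr_ge0 ?exprn_ge0// ltW.
apply: le_trans (N_large cz (ltnW Nj)).
rewrite normcM (normcM (weight k.+1 z)) normc_real (normcM (damp z) (f z j)).
have -> : expR (a k * (1 - theta)) * (q + q) * (normc (damp z) * normc (f z j)) =
  normc (damp z) * expR (a k * (1 - theta)) * (q + q) * normc (f z j) by ring.
rewrite ler_wpM2r ?normc_ge0//; apply: ler_pM; rewrite ?normc_ge0//.
  exact: normc_weight.
exact: (block_bound k.+1).
Qed.

Lemma regularized_terms z j : G z j = weight 0 z * (block 0 j)%:C * f z j +
  \sum_(k < `|j|) weight k.+1 z * (block k.+1 j)%:C * f z j.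
Proof. by rewrite /regularized /multiplier big_ord_recl mulrDl mulr_suml. Qed.

Lemma regularized_bound z j : closed_strip z ->
  normc (G z j) <= q * normc (damp z * f z j) + eps.
Proof.
move=> cz; rewrite regularized_terms; apply: le_trans (le_normcD _ _) _; apply: lerD.
  rewrite mulrAC normcM mulrC normc_real ler_wpM2r ?normc_ge0//; exact: (block_bound 0).
apply: le_trans (le_normc_sum _ _ _) _.
apply: (@le_trans _ _ (\sum_(k < `|j|) eps / 2 ^+ k.+1)).
  by apply: ler_sum => k _; exact: term_bound.
have := half_pow_sum 0 `|j|; rewrite add0n big_mkord expr0 divr1; exact.
Qed.

(** The blocks of index at most K vanish at j, and the others add up to a geometric
    tail. *)
Lemma regularized_tail K z j : closed_strip z -> (s.+1 * N K <= `|j|)%N ->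
  normc (G z j) <= eps / 2 ^+ K.
Proof.
move=> cz jK; have Kj : (K <= `|j|)%N.
  by apply: leq_trans jK; apply: leq_trans (N_ge K) _; rewrite leq_pmull.
rewrite regularized_terms (block_high (K := K))// mulr0 mul0r add0r.
rewrite -(big_mkord xpredT (fun k => weight k.+1 z * (block k.+1 j)%:C * f z j)).
have low : \sum_(0 <= k < K) weight k.+1 z * (block k.+1 j)%:C * f z j = 0.
  rewrite big_nat_cond big1// => k; rewrite andbT => /andP[_ kK].
  by rewrite (block_high (K := K))// mulr0 mul0r.
have -> : \sum_(0 <= k < `|j|) weight k.+1 z * (block k.+1 j)%:C * f z j =
    \sum_(K <= k < K + (`|j| - K)) weight k.+1 z * (block k.+1 j)%:C * f z j.
  rewrite subnKC//; transitivity (\sum_(0 <= k < K) weight k.+1 z * (block k.+1 j)%:C * f z j +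
    \sum_(K <= k < `|j|) weight k.+1 z * (block k.+1 j)%:C * f z j).
    exact: big_cat_nat.
  by rewrite low add0r.
apply: le_trans (le_normc_sum _ _ _) _.
apply: le_trans (half_pow_sum K (`|j| - K)); apply: ler_sum => k _.
exact: term_bound.
Qed.

Lemma eps_pow_small (e : R) : 0 < e -> exists K, eps / 2 ^+ K <= e.
Proof.
move=> e0; pose K := (Num.truncn (eps / e)).+1; exists K.
rewrite ler_pdivrMr ?exprn_gt0// mulrC -ler_pdivrMr//.
apply: (@le_trans _ _ K%:R); first exact/ltW/truncnS_gt.
by rewrite -natrX ler_nat ltnW// ltn_expl.
Qed.

Lemma regularized_uniform_tails : uniform_tails G.
Proof.
move=> e e0; have [K hK] := eps_pow_small e0; exists (s.+1 * N K)%N => z cz j Nj.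
exact: le_trans (regularized_tail cz Nj) hK.
Qed.

Lemma weight_cderive k z : exists l, cderive (weight k) z l.
Proof.
have [l dl] := damping_cderive theta delta z.
case: k => [|k]; first by exists l.
eexists; apply: cderiveM dl _; apply: cderive_cexp_comp; apply: cderiveM.
  exact: cderive_cst.
by apply: cderiveD; [exact: cderive_id|exact: cderive_cst].
Qed.

Lemma weight_cont D k z : ccont D (weight k) z.
Proof. by have [l dl] := weight_cderive k z; exact: cderive_cont dl. Qed.

Lemma regularized_strip : strip_regular G.
Proof.
have wm z : exists dw, forall k, cderive (weight k) z (dw k).
  exists (fun k => projT1 (cid (weight_cderive k z))) => k.
  exact: projT2 (cid (weight_cderive k z)).
apply: strip_regular_coordinates.
- move=> j z cz; apply: ccontM; last exact: strip_coord_cont.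
  apply: (@ccont_sum _ _ _ (fun k z => weight k z * (block k j)%:C)) => k.
  by apply: ccontM; [exact: weight_cont|exact: ccont_cst].
- move=> j z oz; have [m dm] := strip_coord_derive sf j oz; have [dw hw] := wm z.
  eexists; apply: cderiveM dm.
  apply: (@cderive_sum _ _ (fun k z => weight k z * (block k j)%:C)
    (fun k z => dw k * (block k j)%:C + weight k z * 0)) => k.
  by apply: cderiveM; [exact: hw|exact: cderive_cst].
- exact: regularized_uniform_tails.
- have [M M0 hM] := strip_bounded sf.
  exists (q * (expR delta * M) + eps) => z cz j.
  apply: le_trans (regularized_bound _ cz) _; rewrite lerD2r ler_wpM2l// normcM.
  by apply: ler_pM; rewrite ?normc_ge0// ?hM// normc_damping_le.
Qed.

(** At theta all weights are 1 and the blocks telescope. *)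
Lemma regularized_theta : G theta%:C = f theta%:C.
Proof.
apply: funext => j; rewrite /regularized -[RHS]mul1r; congr (_ * _).
rewrite /multiplier (eq_bigr (fun k : 'I__ => (block k j)%:C)); last first.
  move=> [[|k] /= _] _; rewrite damping_theta ?mul1r//.
  by rewrite subrr mulr0 cexp0 mul1r.
have -> : \sum_(k < `|j|.+1) (block k j)%:C = (vallee_poussin R s (N `|j|) j)%:C.
  elim: `|j|%N => [|n IH]; first by rewrite big_ord1.
  by rewrite big_ord_recr/= IH -rmorphD addrC subrK.
by rewrite vallee_poussin_low.
Qed.

Lemma weight_sum0 t n :
  \sum_(k < n) normc (weight k (0 +i* t)) * block_norm k <= q + eps.
Proof.
case: n => [|n]; first by rewrite big_ord0 addr_ge0// ltW.
rewrite big_ord_recl; apply: lerD.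
  by rewrite ler_piMl//; exact: (normc_weight0 0).
apply: (@le_trans _ _ (\sum_(k < n) eps / 2 ^+ k.+1)).
  apply: ler_sum => k _; apply: le_trans (a_large k); rewrite ler_wpM2r//.
    by rewrite addr_ge0.
  exact: (normc_weight0 k.+1).
have := half_pow_sum 0 n; rewrite add0n big_mkord expr0 divr1; exact.
Qed.

Lemma block_norm_ge0 k : 0 <= block_norm k.
Proof. by case: k => [|k] //=; rewrite addr_ge0. Qed.

(** The terms beyond K are dominated by twice a geometric series. *)
Lemma sum_head_tail (D : nat -> R) (e : R) K n : (forall k, 0 <= D k) ->
  \sum_(k < K.+1) D k <= e / 2 -> (forall k, D k.+1 <= eps / 2 ^+ k.+1 + eps / 2 ^+ k.+1) ->
  eps / 2 ^+ K <= e / 4 -> \sum_(k < n) D k <= e.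
Proof.
move=> D0 hD Dk hK; apply: (@le_trans _ _ (\sum_(k < K.+1 + n) D k)).
  rewrite -!(big_mkord xpredT D) [leRHS](big_cat_nat (n := n))//= ?leq_addl//.
  by rewrite lerDl sumr_ge0.
rewrite -(big_mkord xpredT D) (big_cat_nat (n := K.+1))//= ?leq_addr// big_mkord [e]splitr.
apply: lerD => //; rewrite addSn big_add1/=.
apply: (@le_trans _ _ (\sum_(K <= k < K + n) (eps / 2 ^+ k.+1 + eps / 2 ^+ k.+1))).
  by apply: ler_sum => k _; exact: Dk.
rewrite big_split/=; have := half_pow_sum K n; lra.
Qed.

(** The weights are summable on the left line uniformly in t, so the series of
    differences is controlled by finitely many of its terms. *)
Lemma weight_diff_sum t0 (e : R) : 0 < e -> exists2 d : R, 0 < d &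
  forall t, `|t - t0| < d -> forall n,
  \sum_(k < n) normc (weight k (0 +i* t) - weight k (0 +i* t0)) * block_norm k <= e.
Proof.
move=> e0; have e4 : 0 < e / 4 by lra.
have [K hK] := eps_pow_small e4.
have head m : exists2 d : R, 0 < d & forall t, `|t - t0| < d ->
    \sum_(k < m) normc (weight k (0 +i* t) - weight k (0 +i* t0)) * block_norm k <= e / 2.
  have : forall e' : R, 0 < e' -> exists2 d : R, 0 < d & forall t, `|t - t0| < d ->
    \sum_(k < m) normc (weight k (0 +i* t) - weight k (0 +i* t0)) * block_norm k <= e'.
    elim: m => [|m IH] e' e'0; first by exists 1 => // t _; rewrite big_ord0 ltW.
    have e'2 : 0 < e' / 2 by lra.
    have [d1 d10 h1] := IH _ e'2.
    have b1 : 0 < block_norm m + 1 by rewrite ltr_wpDl ?block_norm_ge0.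
    have [d2 d20 h2] := weight_cont setT m (0 +i* t0) (divr_gt0 e'2 b1).
    exists (Num.min d1 d2); first by rewrite lt_min d10.
    move=> t; rewrite lt_min => /andP[t1 t2]; rewrite big_ord_recr/= [e']splitr.
    apply: lerD; first exact: h1.
    have w2 : normc (weight m (0 +i* t) - weight m (0 +i* t0)) <= e' / 2 / (block_norm m + 1).
      by apply: h2 => //; rewrite /= subrr expr0n add0r sqrtr_sqr.
    apply: le_trans (ler_wpM2r (block_norm_ge0 m) w2) _.
    by rewrite mulrC; apply: mul_div_succ_le => //; exact: block_norm_ge0.
  by apply; lra.
have [d d0 hd] := head K.+1; exists d => // t td n.
apply: (@sum_head_tail (fun k => normc (weight k (0 +i* t) - weight k (0 +i* t0)) * block_norm k)
  e K n _ (hd t td) _ hK).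
  by move=> k; rewrite mulr_ge0 ?normc_ge0 ?block_norm_ge0.
move=> k.
have B u : normc (weight k.+1 (0 +i* u)) * block_norm k.+1 <= eps / 2 ^+ k.+1.
  apply: le_trans (a_large k); apply: ler_wpM2r; first exact: (block_norm_ge0 k.+1).
  exact: (normc_weight0 k.+1).
apply: le_trans (lerD (B t) (B t0)); rewrite -mulrDl; apply: ler_wpM2r (le_normcB _ _).
exact: (block_norm_ge0 k.+1).
Qed.

Lemma regularized_L1 t : carrier L1 (G (0 +i* t)) /\
  normS L1 (G (0 +i* t)) <= (q + eps) * normS E (f (0 +i* t)).
Proof.
have [h _ _] := bf0.
exact: (multiplier_E_L1 block_smoothing block_finite (weight_sum0 t) (h t)).
Qed.

(** The increment of G between t0 and t is the multiplier at t applied to the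
    increment of f, plus the increment of the multiplier applied to f at t0. *)
Lemma regularized_boundary0 : boundary_regular L1 (fun t => G (0 +i* t)).
Proof.
have [h1 h2 h3] := bf0; have B0 : 0 < q + eps by rewrite ltr_wpDl.
split.
- by move=> t; exact: (regularized_L1 t).1.
- move=> t0 e e0; have e2 : 0 < e / 2 by lra.
  have [d1 d10 hd1] := h2 t0 _ (divr_gt0 e2 B0).
  set n0 := normS E (f (0 +i* t0)).
  have n00 : 0 <= n0 by exact: sub_norm_ge0.
  have n01 : 0 < n0 + 1 by rewrite ltr_wpDl.
  have [d2 d20 hd2] := weight_diff_sum t0 (divr_gt0 e2 n01).
  exists (Num.min d1 d2); first by rewrite lt_min d10.
  move=> t; rewrite lt_min => /andP[t1 t2].
  have [La na] := multiplier_E_L1 (c := fun k => weight k (0 +i* t)) block_smoothing block_finite (weight_sum0 t)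
    (sub_carrierB sE (h1 t) (h1 t0)).
  have [Lb nb] := multiplier_E_L1 (c := fun k => weight k (0 +i* t) - weight k (0 +i* t0))
    block_smoothing block_finite (hd2 t t2) (h1 t0).
  have -> : G (0 +i* t) - G (0 +i* t0) =
    (fun j => multiplier block (fun k => weight k (0 +i* t)) j * (f (0 +i* t) - f (0 +i* t0)) j) +
    (fun j => multiplier block (fun k => weight k (0 +i* t) - weight k (0 +i* t0)) j * f (0 +i* t0) j).
    apply: funext => j.
    have M : multiplier block (fun k => weight k (0 +i* t) - weight k (0 +i* t0)) j =
      multiplier block (fun k => weight k (0 +i* t)) j - multiplier block (fun k => weight k (0 +i* t0)) j.
      by rewrite /multiplier -sumrB; apply: eq_bigr => k _; rewrite mulrBl.
    transitivity (multiplier block (fun k => weight k (0 +i* t)) j * (f (0 +i* t) j - f (0 +i* t0) j) +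
      multiplier block (fun k => weight k (0 +i* t) - weight k (0 +i* t0)) j * f (0 +i* t0) j) => //.
    rewrite M; transitivity (G (0 +i* t) j - G (0 +i* t0) j) => //.
    by rewrite /regularized; ring.
  apply: le_trans (sub_norm_add sL La Lb) _; rewrite [e]splitr; apply: lerD.
    apply: le_trans na _; rewrite mulrC -ler_pdivlMr//; exact: hd1.
  apply: le_trans nb _; rewrite mulrC; exact: mul_div_succ_le.
- move=> e e0; have [T hT] := h3 _ (divr_gt0 e0 B0); exists T => t Tt.
  apply: le_trans (regularized_L1 t).2 _; rewrite mulrC -ler_pdivlMr//; exact: hT.
Qed.

Lemma regularized_boundary1 : boundary_regular c0 (fun t => G (1 +i* t)).
Proof.
have [g1 g2 g3 _] := regularized_strip.
have cz (t : R) : closed_strip (1 +i* t) by rewrite /closed_strip/= ler01 lexx.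
have [h1 _ h3] := bf1.
split.
- by move=> t; apply/c0_carrierE; exact: g1.
- move=> t0 e e0; have [d d0 hd] := g3 _ (cz t0) _ e0; exists d => // t td.
  by apply: hd => //; rewrite /= subrr expr0n add0r sqrtr_sqr.
move=> e e0; have [n hn] := regularized_uniform_tails e0.
have [] := @finite_uniform_max R (fun T j => forall t, T < `|t| -> normc (G (1 +i* t) j) <= e) _ _ n.
- by move=> u v j uv h t vt; apply: h; exact: le_lt_trans vt.
- pose W k := if k is l.+1 then expR delta * expR (a l * (1 - theta)) else expR delta.
  move=> j; pose C := \sum_(k < `|j|.+1) W k * block_norm k.
  have w0 (k : nat) : 0 <= W k by case: k => [|k]; rewrite /W ?mulr_ge0 ?expR_ge0.
  have C0 : 0 <= C by apply: sumr_ge0 => k _; rewrite mulr_ge0 ?block_norm_ge0.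
  have C1 : 0 < C + 1 by rewrite ltr_wpDl.
  have [T hT] := h3 _ (divr_gt0 e0 C1); exists T => t Tt.
  have fj : normc (f (1 +i* t) j) <= e / (C + 1).
    by apply: le_trans (hT _ Tt); apply: c0_norm_ge; apply/c0_carrierE; exact: h1.
  have mC : normc (multiplier block (fun k => weight k (1 +i* t)) j) <= C.
    apply: le_trans (le_normc_sum _ _ _) _; apply: ler_sum => k _.
    rewrite normcM normc_real; apply: ler_pM; rewrite ?normc_ge0//; last exact: block_bound.
    have dl := normc_damping_le theta delta0 (cz t).
    case: (nat_of_ord k) => [|l]; rewrite /W //; apply: le_trans (normc_weight l (cz t)) _.
    by rewrite ler_wpM2r ?expR_ge0.
  rewrite normcM; apply: le_trans (ler_pM (normc_ge0 _) (normc_ge0 _) mC fj) _.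
  exact: mul_div_succ_le.
move=> T hT; exists T => t Tt; apply: c0_norm_le => j.
have [nj|jn] := leqP n `|j|; first exact: hn.
exact: hT.
Qed.

Lemma regularized_calderon : calderon L1 c0 G.
Proof.
apply/calderonP => //; split.
- exact: regularized_strip.
- exact: regularized_boundary0.
- exact: regularized_boundary1.
Qed.

Lemma regularized_norm : calderon_norm L1 c0 G <=
  Num.max ((q + eps) * calderon_norm E c0 f) (q * (expR delta * calderon_norm E c0 f) + eps).
Proof.
apply: calderon_norm_le => t; rewrite le_max.
  apply/orP; left; apply: le_trans (regularized_L1 t).2 _; rewrite ler_wpM2l//.
    by rewrite addr_ge0// ltW.
  exact: calderon_norm_ge0line.
apply/orP; right; apply: c0_norm_le => j.
have cz : closed_strip (1 +i* t) by rewrite /closed_strip/= ler01 lexx.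
apply: le_trans (regularized_bound _ cz) _; rewrite lerD2r ler_wpM2l// normcM.
apply: ler_pM; rewrite ?normc_ge0// ?normc_damping_le//.
apply: le_trans (calderon_norm_ge1line t sE cf); apply: c0_norm_ge.
by have [h _ _] := bf1; apply/c0_carrierE; exact: h.
Qed.

End regularization.

Section transfer.
Variable R : realType.
Notation c0 := (c0Z R).
Notation E := (E_space R).
Notation L1 := (L1T R).

(** The parameters are fixed in the order eps, s and delta, a, N: the tails needed
    for N k depend on the size of exp (a k (1 - theta)). *)
Lemma calderon_E_L1 (theta : R) (f : R[i] -> int -> R[i]) (e : R) :
  0 < theta < 1 -> calderon E c0 f -> 0 < e ->
  exists g, [/\ calderon L1 c0 g, g theta%:C = f theta%:C &
    calderon_norm L1 c0 g <= calderon_norm E c0 f + e].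
Proof.
move=> theta01 cf e0; have /andP[t0 t1] := theta01.
set n := calderon_norm E c0 f.
have n0 : 0 <= n by exact: calderon_norm_ge0 (E_subordinate R) cf.
have n1 : 0 < 3 * n + 1 by rewrite ltr_wpDl// mulr_ge0.
(* With eps <= 1, the two bounds of regularized_norm are at most n + 2 eps n and
   n + 3 eps n + eps. *)
pose eps : R := Num.min 1 (e / (3 * n + 1)).
have eps0 : 0 < eps by rewrite lt_min ltr01 divr_gt0.
have eps1 : eps <= 1 by rewrite ge_min lexx.
have epse : eps * (3 * n + 1) <= e by rewrite -ler_pdivlMr// ge_min lexx orbT.
pose s := (Num.truncn (2 / eps)).+1.
have s0 : (0 < s)%N by [].
have s0' : 0 < s%:R :> R by rewrite ltr0n.
set q := 1 + 2 / s%:R : R.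
have qe : q <= 1 + eps.
  rewrite lerD2l ler_pdivrMr// mulrC -ler_pdivrMr//; exact/ltW/truncnS_gt.
have q1 : 1 <= q by rewrite lerDl divr_ge0.
have q0 : 0 < q + q by lra.
pose delta := ln (1 + eps).
have delta0 : 0 < delta by rewrite ln_gt0// ltrDl.
have deltaE : expR delta = 1 + eps by rewrite lnK// posrE; lra.
(* a k is chosen so that exp (a k theta) >= A k. *)
pose A k : R := (q + q) * 2 ^+ k.+1 / eps.
have A0 k : 0 < A k by rewrite divr_gt0// mulr_gt0// exprn_gt0.
pose a k : R := Num.max 0 (ln (A k) / theta).
have a0 k : 0 <= a k by rewrite le_max lexx.
have a_large k : expR (- (a k * theta)) * (q + q) <= eps / 2 ^+ k.+1.
  have h : expR (- (a k * theta)) <= (A k)^-1.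
    rewrite expRN lef_pV2 ?posrE ?expR_gt0// -[leLHS]lnK ?posrE// ler_expR.
    by rewrite -ler_pdivrMr// le_max lexx orbT.
  apply: le_trans (ler_wpM2r (ltW q0) h) _.
  rewrite le_eqVlt; apply/orP; left; apply/eqP; rewrite /A; field.
  by rewrite !gt_eqF ?exprn_gt0.
have sf : strip_regular f by have /(calderonP _ (E_subordinate R)) [] := cf.
have tails k : exists n0 : nat, forall z, closed_strip z -> forall j : int, (n0 <= `|j|)%N ->
    expR (a k * (1 - theta)) * (q + q) * normc (damping theta delta z * f z j) <= eps / 2 ^+ k.+1.
  set D := expR (a k * (1 - theta)) * (q + q).
  have D0 : 0 < D by rewrite mulr_gt0// expR_gt0.
  have e'0 : 0 < eps / 2 ^+ k.+1 / D by rewrite !divr_gt0// exprn_gt0.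
  have [n1' hn] := damped_uniform_tails sf theta delta0 e'0.
  by exists n1' => z cz j nj; rewrite mulrC -ler_pdivlMr//; exact: hn.
pose N1 k := projT1 (cid (tails k)).
pose N k := \max_(i < k.+1) (N1 i + i).+1.
have N_max k i : (i <= k)%N -> ((N1 i + i).+1 <= N k)%N.
  move=> ik; exact: (leq_bigmax (Ordinal (ik : (i < k.+1)%N))).
have N_large k z : closed_strip z -> forall j : int, (N k <= `|j|)%N ->
    expR (a k * (1 - theta)) * (q + q) * normc (damping theta delta z * f z j) <= eps / 2 ^+ k.+1.
  move=> cz j Nj; apply: (projT2 (cid (tails k))) => //; apply: leq_trans Nj.
  by apply: leq_trans (N_max k k (leqnn k)); rewrite -/(N1 k) leqW// leq_addr.
have N_ge k : (k <= N k)%N.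
  by apply: leq_trans (N_max k k (leqnn k)); rewrite leqW// leq_addl.
have N_gt0 k : (0 < N k)%N by apply: leq_trans (N_max k k (leqnn k)).
have N_mono k l : (k <= l)%N -> (N k <= N l)%N.
  move=> kl; apply/bigmax_leqP => i _; apply: N_max.
  by apply: leq_trans kl; rewrite -ltnS.
exists (regularized theta delta s a N f); split.
- exact: (regularized_calderon theta01 delta0 eps0 s0 cf a0 a_large N_large).
- exact: regularized_theta.
apply: le_trans (regularized_norm theta01 delta0 eps0 s0 cf a0 a_large N_large N_ge N_gt0 N_mono) _.
rewrite -/n -/q deltaE ge_max.
have h1 : q * n <= (1 + eps) * n by rewrite ler_wpM2r.
have h2 : eps * n <= 1 * n by rewrite ler_wpM2r.
have h3 : eps * (eps * n) <= 1 * (eps * n) by rewrite ler_wpM2r// mulr_ge0// ltW.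
have h4 : (1 + eps) * (q * n) <= (1 + eps) * ((1 + eps) * n) by rewrite ler_wpM2l//; lra.
have h5 : 0 <= eps * n by rewrite mulr_ge0// ltW.
by apply/andP; split; nra.
Qed.

(** Both norms of an element are related by L1_sub_E, and so are those of
    increments. *)
Lemma calderon_L1_E (f : R[i] -> int -> R[i]) : calderon L1 c0 f ->
  calderon E c0 f /\ calderon_norm E c0 f <= calderon_norm L1 c0 f.
Proof.
have sL := L1_subordinate R; have sE := E_subordinate R.
move=> cf; have /(calderonP _ sL) [sf [b1 b2 b3] bc] := cf.
split.
  apply/(calderonP _ sE); split => //; split.
  - by move=> t; exact: (L1_sub_E (b1 t)).1.
  - move=> t0 e e0; have [d d0 hd] := b2 t0 _ e0; exists d => // t td.
    exact: le_trans (L1_sub_E (sub_carrierB sL (b1 t) (b1 t0))).2 (hd _ td).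
  - move=> e e0; have [T hT] := b3 _ e0; exists T => t Tt.
    exact: le_trans (L1_sub_E (b1 t)).2 (hT _ Tt).
apply: calderon_norm_le => t; last exact: calderon_norm_ge1line.
exact: le_trans (L1_sub_E (b1 t)).2 (calderon_norm_ge0line t sL cf).
Qed.

End transfer.

Theorem proposition0p1 (R : realType) (theta : R) (theta01 : 0 < theta < 1) :
  let X := complex_interpolation (L1T R) (c0Z R) theta in
  let Z := complex_interpolation (E_space R) (c0Z R) theta in
  carrier X = carrier Z /\
  (forall x, carrier X x -> normS X x = normS Z x).
Proof.
move=> X Z.
have sL := L1_subordinate R; have sE := E_subordinate R.
have XZ x : carrier X x -> carrier Z x /\ normS Z x <= normS X x.
  apply: interpolation_norm_le => // f cf fx e e0; have [cf' nf] := calderon_L1_E cf.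
  by exists f; split => //; apply: le_trans nf _; rewrite lerDl ltW.
have ZX x : carrier Z x -> carrier X x /\ normS X x <= normS Z x.
  apply: interpolation_norm_le => // f cf <- e e0; exact: calderon_E_L1.
split; first by apply/seteqP; split => x; [move=> /XZ []|move=> /ZX []].
move=> x Xx; have [Zx h1] := XZ x Xx; have [_ h2] := ZX x Zx.
by apply/eqP; rewrite eq_le h2.
Qed.
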